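(* Fix $\gamma,\gamma'\in\mathbb{T}$ and finite positive Borel measures $\sigma,\sigma'$ on $\mathbb{T}$. Let $\{k_n\}_{n\ge1}$ be a sequence of positive integers, $\{\lambda_n\}_{n\ge1}$ and $\{\lambda_n'\}_{n\ge1}$ two sequences in $\mathbb{T}$, and $\{\mu_{nk}:n\in\mathbb{N},1\le k\le k_n\}$, $\{\nu_{nk}:n\in\mathbb{N},1\le k\le k_n\}$ two infinitesimal arrays in $\mathcal{M}_{\mathbb{T}}^{\times}$. Define, for every $n\in\mathbb{N}$, \[ (\mu_n,\nu_n)=(\delta_{\lambda_n},\delta_{\lambda_n'})\boxtimes(\mu_{n1},\nu_{n1})\boxtimes\cdots\boxtimes(\mu_{nk_n},\nu_{nk_n}),\qquad \rho_n=\delta_{\lambda_n}\uplus\mu_{n1}\uplus\cdots\uplus\mu_{nk_n}. \] Suppose that $\{\nu_n\}_{n\ge1}$ converges weakly to $\nu_{\boxtimes}^{\gamma',\sigma'}$. Then the following statements are equivalent: (1) The sequence $\mu_n$ converges weakly to a measure $\mu\in\mathcal{M}_{\mathbb{T}}^{\times}$. (2) The sequence $\rho_n$ converges weakly to $\nu_{\uplus}^{\gamma,\sigma}$. (3) The sequence of measures \[ d\sigma_n(\zeta)=\sum_{k=1}^{k_n}(1-\Re\zeta)\,d\mu_{nk}^{\circ}(\zeta) \] converges weakly on $\mathbb{T}$ to the measure $\sigma$, and the sequence of complex numbers \[ \gamma_n=\exp\left(i\arg\lambda_n+i\sum_{k=1}^{k_n}\arg b_{nk}+i\sum_{k=1}^{k_n}\int_{\mathbb{T}}\Im\zeta\,d\mu_{nk}^{\circ}(\zeta)\right)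 \] converges to $\gamma$ as $n\to\infty$. Moreover, if (1)–(3) are satisfied, then \[ \Sigma_{(\mu,\nu_{\boxtimes}^{\gamma',\sigma'})}(z)=B_{\nu_{\uplus}^{\gamma,\sigma}}(z) \] in a neighborhood of zero.
   Context: $\mathbb{T}$ is the unit circle, $\mathbb{D}$ the open unit disk, $\mathcal{M}_{\mathbb{T}}$ the set of Borel probability measures on $\mathbb{T}$, $\mathcal{M}_{\mathbb{T}}^{\times}=\{\nu\in\mathcal{M}_{\mathbb{T}}:\int_{\mathbb{T}}\zeta\,d\nu(\zeta)\ne0\}$, and $\delta_\lambda$ is the point mass at $\lambda$. Weak convergence is convergence of integrals of continuous functions on $\mathbb{T}$. An array $\{\mu_{nk}\}$ is infinitesimal if $\lim_{n\to\infty}\max_{1\le k\le k_n}\mu_{nk}(\{\zeta\in\mathbb{T}:|\zeta-1|\ge\varepsilon\})=0$ for every $\varepsilon>0$. For $\mu\in\mathcal{M}_{\mathbb{T}}$ and $z\in\mathbb{D}$: $m_\mu(z)=\int_{\mathbb{T}}\frac{z\zeta}{1-z\zeta}d\mu(\zeta)$, $\eta_\mu(z)=\frac{m_\mu(z)}{1+m_\mu(z)}$, $B_\mu(z)=\frac1z\eta_\mu(z)$. The function $B_\mu$ maps $\mathbb{D}$ analytically into $\overline{\mathbb{D}}$, and every analytic map $\mathbb{D}\to\overline{\mathbb{D}}$ equals $B_\mu$ for a unique $\mu\in\mathcal{M}_{\mathbb{T}}$. $F^{\langle-1\rangle}$ denotes the inverse under composition near $0$. For $\mu\in\mathcal{M}_{\mathbb{T}}$,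 $\nu\in\mathcal{M}_{\mathbb{T}}^\times$, define analytic functions near $0$ by $R_\nu(z[1+m_\nu(z)])=m_\nu(z)$, ${}^cR_{(\mu,\nu)}(z[1+m_\nu(z)])(1+m_\mu(z))=m_\mu(z)(1+m_\nu(z))$, $T_\nu(z)=\left(\frac1zR_\nu\right)\circ R_\nu^{\langle-1\rangle}(z)$, ${}^cT_{(\mu,\nu)}(z)=\left(\frac1z{}^cR_{(\mu,\nu)}\right)\circ R_\nu^{\langle-1\rangle}(z)$, and $\Sigma_{(\mu,\nu)}(z)={}^cT_{(\mu,\nu)}\left(\frac z{1-z}\right)$, which equals $B_\mu(\eta_\nu^{\langle-1\rangle}(z))$ near $0$. Here $\left(\frac1zF\right)\circ G$ is $F(z)/z$ composed with $G$. The multiplicative c-free convolution $(\mu_1,\nu_1)\boxtimes(\mu_2,\nu_2)$ of pairs in $\mathcal{M}_{\mathbb{T}}\times\mathcal{M}_{\mathbb{T}}^\times$ is the unique pair $(\mu,\nu)\in\mathcal{M}_{\mathbb{T}}\times\mathcal{M}_{\mathbb{T}}^\times$ with $T_\nu=T_{\nu_1}T_{\nu_2}$ and ${}^cT_{(\mu,\nu)}={}^cT_{(\mu_1,\nu_1)}{}^cT_{(\mu_2,\nu_2)}$. The multiplicative boolean convolution $\mu\uplus\nu$ of $\mu,\nu\in\mathcal{M}_{\mathbb{T}}$ is the unique measure in $\mathcal{M}_{\mathbb{T}}$ with $B_{\mu\uplus\nu}=B_\mu B_\nu$ on $\mathbb{D}$. For $\gamma\in\mathbb{T}$ and a finite positive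 Borel measure $\sigma$ on $\mathbb{T}$: $\nu_{\uplus}^{\gamma,\sigma}\in\mathcal{M}_{\mathbb{T}}$ is the measure with $B_{\nu_{\uplus}^{\gamma,\sigma}}(z)=\gamma\exp\left(-\int_{\mathbb{T}}\frac{1+\zeta z}{1-\zeta z}d\sigma(\zeta)\right)$, $z\in\mathbb{D}$; and $\nu_{\boxtimes}^{\gamma,\sigma}\in\mathcal{M}_{\mathbb{T}}^\times$ is the measure for which $\eta^{\langle-1\rangle}_{\nu_{\boxtimes}^{\gamma,\sigma}}(z)=z\gamma\exp\left(\int_{\mathbb{T}}\frac{1+\zeta z}{1-\zeta z}d\sigma(\zeta)\right)$ (the local inverse near $0$ extends to $z\in\mathbb{D}$ by this formula). $\arg$ is the principal argument; $b_{nk}=\exp\left(i\int_{|\arg\zeta|<1}\arg\zeta\,d\mu_{nk}(\zeta)\right)$ and $d\mu_{nk}^\circ(\zeta)=d\mu_{nk}(b_{nk}\zeta)$, i.e. $\mu_{nk}^\circ(S)=\mu_{nk}(b_{nk}S)$.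
   Formalization: With γ, σ fixed in advance, (1) does not imply (2) (all measures δ_1, all λ equal to 1, γ = −1, σ = 0), so (1) is proved equivalent to (2) holding for some γ, σ; (2) and (3) are proved equivalent for every fixed γ, σ. *)

(* Defs.v *)
From HB Require Import structures.
From mathcomp Require Import all_boot all_order all_algebra.
From mathcomp Require Import complex.
From mathcomp Require Import all_classical all_reals all_analysis.
Set Implicit Arguments.
Unset Strict Implicit.
Unset Printing Implicit Defensive.
Import Order.TTheory GRing.Theory Num.Theory.
Import numFieldNormedType.Exports.
Local Open Scope classical_set_scope.
Local Open Scope ring_scope.
Local Open Scope complex_scope.
Local Notation Re := complex.Re.
Local Notation Im := complex.Im.

(* R[i] with the topology of its modulus, as a normed space over itself: in    *)
(* particular `derivable f z 1` means complex differentiability at z.          *)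
HB.instance Definition _ (R : realType) := NormedModule.copy R[i] R[i]^o.

(* The unit circle, with the topology induced by R[i] and its Borel sets. *)
Record circle (R : realType) := Circle { cval :> R[i]; _ : `|cval| == 1 }.

HB.instance Definition _ (R : realType) := [isSub for @cval R].
HB.instance Definition _ (R : realType) := [Choice of circle R by <:].

Lemma circle1_subproof (R : realType) : `|1 : R[i]| == 1.
Proof. by rewrite normr1. Qed.

HB.instance Definition _ (R : realType) :=
  isPointed.Build (circle R) (Circle (circle1_subproof R)).
HB.instance Definition _ (R : realType) :=
  Topological.copy (circle R) (initial_topology (@cval R)).
HB.instance Definition _ (R : realType) :=
  Measurable.copy (circle R) (g_sigma_algebraType (@open (circle R))).

Section circle_functions.
Context {R : realType}.
Implicit Types (b z : circle R) (t : R).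

Lemma rot_subproof b z : `|(z : R[i]) / (b : R[i])| == 1.
Proof.
case: b z => [b /eqP hb] [z /eqP hz] /=.
by rewrite normrM normfV hb hz invr1 mulr1.
Qed.

Lemma circle_neq0 z : (z : R[i]) != 0.
Proof.
by case: z => z /= hz; apply: contraTneq hz => ->; rewrite normr0 eq_sym oner_eq0.
Qed.

Definition rot b z : circle R := Circle (rot_subproof b z).

Lemma rot_continuous b : continuous (rot b).
Proof.
apply/continuous_comp_initial => z /=.
have -> : (@cval R) \o rot b =
  (fun z : R[i] => z / (b : R[i])) \o (@cval R) by [].
apply: continuous_comp; first exact: (@initial_continuous _ _ (@cval R)).
exact: mulrr_continuous.
Qed.

Lemma rot_measurable b : measurable_fun [set: circle R] (rot b).
Proof.
apply: (@measurability _ _ _ _ _ _ (@open (circle R))) => //.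
move=> _ [U oU <-]; rewrite setTI; apply: sub_sigma_algebra.
by move/continuousP : (@rot_continuous b); apply.
Qed.

HB.instance Definition _ b :=
  isMeasurableFun.Build _ _ _ _ (rot b) (rot_measurable b).

Lemma expi_subproof t : `|cos t +i* sin t| == 1.
Proof. by rewrite normc_def /= cos2Dsin2 sqrtr1. Qed.

(* exp (i t) *)
Definition expi t : circle R := Circle (expi_subproof t).

(* The principal argument; see arg_bounds and argK. *)
Definition arg z : R := if 0 <= Im z then acos (Re z) else - acos (Re z).

Lemma circle_sqr z : Re z ^+ 2 + Im z ^+ 2 = 1.
Proof.
case: z => z /=; rewrite normc_def => /eqP [] /(congr1 (fun x => x ^+ 2)).
by rewrite sqr_sqrtr ?addr_ge0 ?sqr_ge0// expr1n.
Qed.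

Lemma circle_Re_itv z : -1 <= Re z <= 1.
Proof.
rewrite -ler_norml -(ler_pXn2r (ltn0Sn 1)) ?nnegrE// expr1n real_normK ?num_real//.
by rewrite -(circle_sqr z) lerDl sqr_ge0.
Qed.

Lemma argK z : expi (arg z) = z.
Proof.
apply: val_inj => /=.
have zR := circle_Re_itv z; have zRi : Re z \in `[(-1), 1] by rewrite in_itv.
have E : 1 - Re z ^+ 2 = Im z ^+ 2 by rewrite -(circle_sqr z) addrC addKr.
rewrite /arg; case: ifPn => [z0|].
  rewrite acosK// sin_acos// E sqrtr_sqr ger0_norm//; by case: (cval z).
rewrite -ltNge => z0.
rewrite cosN sinN acosK// sin_acos// E sqrtr_sqr ltr0_norm// opprK.
by case: (cval z).
Qed.

Lemma arg_bounds z : - pi < arg z <= pi.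
Proof.
have zR := circle_Re_itv z.
rewrite /arg; case: ifPn => [z0|].
  rewrite acos_lepi// andbT (lt_le_trans _ (acos_ge0 zR))//.
  by rewrite oppr_lt0 pi_gt0.
rewrite -ltNge => z0; have [zR1 zR2] := andP zR.
have neq : -1 < Re z.
  rewrite lt_neqAle zR1 andbT; apply/eqP => zE; have := circle_sqr z.
  rewrite -zE sqrrN expr1n => /(canRL (addKr _)).
  by rewrite addNr => /eqP; rewrite sqrf_eq0 => /eqP zI; rewrite zI ltxx in z0.
rewrite ltrN2 acos_ltpi ?neq//=.
by rewrite (le_trans _ (pi_ge0 R))// oppr_le0 acos_ge0.
Qed.

End circle_functions.

Section transforms.
Context {R : realType}.
Local Notation C := R[i].
Local Notation T := (circle R).
Local Notation prob := (probability T R).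
Implicit Types (mu nu : prob) (F G : C -> C).

Definition cexp (z : C) : C :=
  (expR (Re z))%:C * (cos (Im z) +i* sin (Im z)).

Definition cintegral (mu : {measure set T -> \bar R}) (f : T -> C) : C :=
  (\int[mu]_x Re (f x)) +i* (\int[mu]_x Im (f x)).

Definition mean mu : C := cintegral mu (fun zeta => zeta : C).

Definition nonzero_mean mu : Prop := mean mu <> 0.

(* (1/z) F for F vanishing at 0, continued analytically to 0. *)
Definition divz F (z : C) : C := if z == 0 then derive1 F 0 else F z / z.

Definition m_transform mu (z : C) : C :=
  cintegral mu (fun zeta => z * (zeta : C) / (1 - z * (zeta : C))).

Definition eta mu (z : C) : C := m_transform mu z / (1 + m_transform mu z).

Definition B_transform mu : C -> C := divz (eta mu).

(* Functions "analytic near 0" are germs; the operators below return some      *)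
(* representative of the germ, so their values matter only near 0.             *)
Definition analytic_near0 F : Prop := \forall z \near (0 : C), derivable F z 1.

Definition locinv F : C -> C :=
  xget (fun=> 0) [set G | [/\ analytic_near0 G, G 0 = 0 &
    \forall z \near (0 : C), F (G z) = z]].

Definition R_transform nu : C -> C :=
  xget (fun=> 0) [set F | analytic_near0 F /\
    \forall z \near (0 : C),
      F (z * (1 + m_transform nu z)) = m_transform nu z].

Definition cR_transform mu nu : C -> C :=
  xget (fun=> 0) [set F | analytic_near0 F /\
    \forall z \near (0 : C),
      F (z * (1 + m_transform nu z)) * (1 + m_transform mu z) =
      m_transform mu z * (1 + m_transform nu z)].

Definition T_transform nu : C -> C :=
  divz (R_transform nu) \o locinv (R_transform nu).

Definition cT_transform mu nu : C -> C :=
  divz (cR_transform mu nu) \o locinv (R_transform nu).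

Definition Sigma_transform mu nu (z : C) : C :=
  cT_transform mu nu (z / (1 - z)).

(* is_cfree_conv p1 p2 p : p is the multiplicative c-free convolution of p1    *)
(* and p2 (their second components having nonzero mean).                       *)
Definition is_cfree_conv (p1 p2 p : prob * prob) : Prop :=
  [/\ nonzero_mean p.2,
      \forall z \near (0 : C),
        T_transform p.2 z = T_transform p1.2 z * T_transform p2.2 z &
      \forall z \near (0 : C),
        cT_transform p.1 p.2 z =
        cT_transform p1.1 p1.2 z * cT_transform p2.1 p2.2 z].

(* is_bool_conv mu nu rho : rho is the multiplicative boolean convolution. *)
Definition is_bool_conv (mu nu rho : prob) : Prop :=
  forall z : C, `|z| < 1 ->
    B_transform rho z = B_transform mu z * B_transform nu z.

(* y = (..((x op s_0) op s_1) op ..), for op given by its graph *)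
Fixpoint iterated (A : Type) (op : A -> A -> A -> Prop)
    (x : A) (s : seq A) (y : A) : Prop :=
  if s is a :: s' then exists2 r, op x a r & iterated op r s' y else y = x.

Definition herglotz (sigma : {finite_measure set T -> \bar R}) (z : C) : C :=
  cintegral sigma
    (fun zeta => (1 + (zeta : C) * z) / (1 - (zeta : C) * z)).

Definition is_bool_id (gamma : T) (sigma : {finite_measure set T -> \bar R})
    (nu : prob) : Prop :=
  forall z : C, `|z| < 1 ->
    B_transform nu z = (gamma : C) * cexp (- herglotz sigma z).

Definition is_free_id (gamma : T) (sigma : {finite_measure set T -> \bar R})
    (nu : prob) : Prop :=
  nonzero_mean nu /\
  \forall z \near (0 : C),
    locinv (eta nu) z = z * (gamma : C) * cexp (herglotz sigma z).

(* Set functions are allowed so that sums of densities can be used directly. *)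
Definition weak_cvg (m : nat -> set T -> \bar R) (m0 : set T -> \bar R) : Prop :=
  forall f : T -> R, continuous f ->
    ((\int[m n]_x (f x)%:E)%E @[n --> \oo] --> (\int[m0]_x (f x)%:E)%E).

Definition infinitesimal (kn : nat -> nat) (mu : forall n, 'I_(kn n) -> prob) :
    Prop :=
  forall eps : R, 0 < eps ->
    ((\big[maxe/0%E]_(k < kn n)
        mu n k [set zeta : T | eps%:C <= `|(zeta : C) - 1|])
      @[n --> \oo] --> 0%E).

Definition b_center mu : T :=
  expi (\int[mu]_(zeta in [set zeta : T | `|arg zeta| < 1]) arg zeta).

Definition centered mu : prob := distribution mu (rot (b_center mu)).

Lemma centeredE mu (S : set T) :
  centered mu S =
  mu [set z : T | exists2 x : T, S x & (z : C) = (b_center mu : C) * x].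
Proof.
rewrite /centered; move: (b_center mu) => b.
congr (mu _); apply/seteqP; split => z /=.
  move=> Sz; exists (rot b z) => //=.
  by rewrite mulrC divfK// circle_neq0.
move=> [x Sx zE]; rewrite (_ : rot _ z = x)//; apply: val_inj => /=.
by rewrite zE mulrC mulKf// circle_neq0.
Qed.

Definition sigma_row (k : nat) (mu : 'I_k -> prob) (A : set T) : \bar R :=
  (\sum_(j < k) \int[centered (mu j)]_(zeta in A) (1 - Re zeta)%:E)%E.

Definition gamma_row (lam : T) (k : nat) (mu : 'I_k -> prob) : T :=
  expi (arg lam + \sum_(j < k) arg (b_center (mu j)) +
        \sum_(j < k) \int[centered (mu j)]_zeta Im zeta).

End transforms.

(* Main.v *)
(* For a probability mu on the circle, D(z) = int 1 / (1 - z u) dmu satisfies   *)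
(* 1 + m = D, and B_mu = N / D with N(z) = int u / (1 - z u) dmu. Solving the  *)
(* functional equations gives cT_{mu,nu}(u / (1 - u)) = B_mu(eta_nu^-1(u)), so *)
(* the c-free product says that                                                *)
(*   g_n := B_{mu_n} o eta_{nu_n}^-1 = lam_n prod_k B_{mu_nk} o eta_{nu_nk}^-1 *)
(* near 0, and by the identity theorem on a disc independent of n, the means   *)
(* of nu_n and nu_nk being bounded away from 0. Let S_n be the sum over k of   *)
(* int (1 - Re u) for the centered mu_nk. Since |prod_k mean mu_nk| <= exp(-   *)
(* S_n / 2), and the value at 0 of g_n and of B_{rho_n} is lam_n prod_k mean   *)
(* mu_nk, S_n is bounded as soon as mu_n or rho_n has a limit of nonzero       *)
(* mean. When S_n is bounded, infinitesimality yields                          *)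
(*   g_n - B_{rho_n} -> 0,  since eta_{nu_nk}^-1(z) - z -> 0 uniformly in k,   *)
(*   B_{rho_n} - gamma_n exp(- int (1 + u z) / (1 - u z) dsigma_n) -> 0,       *)
(* and each of the three statements becomes a statement about limits of B      *)
(* near 0. Limit measures are produced along ultrafilters (Helly), and weak    *)
(* convergence is recovered from convergence of transforms near 0 through the  *)
(* moments and the density of trigonometric polynomials.                       *)

From HB Require Import structures.
Require Import Defs.
From mathcomp Require Import all_boot all_order all_algebra.
From mathcomp Require Import complex.
From mathcomp Require Import all_classical all_reals all_analysis.
From mathcomp Require Import measurable_realfun.
From mathcomp Require Import ring lra zify.
Set Implicit Arguments.
Unset Strict Implicit.
Unset Printing Implicit Defensive.
Import Order.TTheory GRing.Theory Num.Theory.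
Import numFieldNormedType.Exports.
Local Open Scope classical_set_scope.
Local Open Scope ring_scope.
Local Open Scope complex_scope.
Local Notation Re := complex.Re.
Local Notation Im := complex.Im.
Local Notation rot := Defs.rot.

(** * Complex moduli, integrals over the circle *)

(** Everything is read off analytic functions near 0. With [Dtr] and [Ntr] the integrals of
    [1 / (1 - z u)] and [u / (1 - z u)], one has [B_mu = Ntr / Dtr], and the functional equations
    have explicit solutions ([cR_near], [cT_near], [Sigma_near]). So the c-free product multiplies
    the functions [B_mu o eta_nu^-1], just as the boolean product multiplies the [B_mu]. The c-free
    identity is one of germs; [Sigma_product] extends it to an explicit disc by the identity theorem
    [polyapprox_eq0], and [g_product] makes the radius depend on the weak limit of [nu_n] alone.

    A measure of the array enters through two numbers: [sdev], the integral of [1 - Re u] for the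
    centered measure, and [dist1], the integral of [|u - 1|], uniformly small by infinitesimality.
    Centering bounds the integral of [Im u] by a multiple of [sdev] ([tdev_le]). Hence [B_mu] is a
    rotation times the exponential of a term of order [sdev], with error of order [sdev * dist1]
    ([Btr_row_exp]), and its Lipschitz constant is also of order [sdev] ([Btr_row_lip]). Summed over
    a row, with [S_n] the sum of the [sdev], errors are of order [S_n] times a small number. So
    [B_{rho_n}] is asymptotic to [gamma_n] times the exponential of minus the Herglotz integral of
    [sigma_n] ([rho_approx]), and to the c-free product function ([g_rho]). The bound on [S_n] comes
    from [row_mean] when (1) or (2) is assumed, and from the convergence of the masses under (3).

    Under (3) the asymptotic form converges ([rho_limit]). Conversely ([rho_limit_inv]), the modulus
    at 0 yields the limit mass, then [gamma_n] converges, and the Herglotz integrals are recovered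
    because the exponential is injective near 0. Between (1) and (2), the inverses [eta_{nu_n}^-1]
    converge on a fixed disc ([etainv_cvg]), so the limit [mu] satisfies
    [B_mu o eta_nu^-1 = lim B_{rho_n}]; this is also the final formula. Weak convergence and
    convergence of [B] near 0 are exchanged by [cvg_Btr] and [cvg_Rintegral_of_Btr], and limit
    measures come from [helly] and [helly_prob]. *)

Section modulus.
Context {R : realType}.
Local Notation C := R[i].
Implicit Types (z w : C) (x : R).

(** A modulus with values in [R]: the norm of [R[i]] takes its values in [R[i]], out of reach of
    [lra] and [nra]. *)
Definition cabs z : R := ComplexField.Normc.normc z.

Arguments cabs : simpl never.

Lemma normE_cabs z : `|z| = (cabs z)%:C.
Proof. by rewrite normc_def; case: z. Qed.

Lemma cabsE z : cabs z = Num.sqrt (Re z ^+ 2 + Im z ^+ 2).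
Proof. by case: z. Qed.

Lemma cabs_ge0 z : 0 <= cabs z.
Proof. by rewrite cabsE sqrtr_ge0. Qed.

Lemma cabs_sqr z : cabs z ^+ 2 = Re z ^+ 2 + Im z ^+ 2.
Proof. by rewrite cabsE sqr_sqrtr// addr_ge0// sqr_ge0. Qed.

Lemma cabs0 : cabs 0 = 0. Proof. exact: ComplexField.Normc.normc0. Qed.
Lemma cabs1 : cabs 1 = 1. Proof. exact: ComplexField.Normc.normc1. Qed.
Lemma cabsM z w : cabs (z * w) = cabs z * cabs w.
Proof. exact: ComplexField.Normc.normcM. Qed.
Lemma cabsV z : cabs z^-1 = (cabs z)^-1.
Proof. exact: ComplexField.Normc.normcV. Qed.
Lemma cabsN z : cabs (- z) = cabs z.
Proof. by rewrite /cabs (normcN z). Qed.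
Lemma cabsD z w : cabs (z + w) <= cabs z + cabs w.
Proof. exact: (le_normcD z w). Qed.
Lemma cabsC z w : cabs (z - w) = cabs (w - z).
Proof. by rewrite -cabsN opprB. Qed.
Lemma cabsB z w : cabs (z - w) <= cabs z + cabs w.
Proof. by rewrite (le_trans (cabsD _ _))// cabsN. Qed.
Lemma cabs_tri y z w : cabs (z - w) <= cabs (z - y) + cabs (y - w).
Proof. by rewrite -[z - w](subrKA y) (le_trans (cabsD _ _)). Qed.
Lemma cabs_lower z w : cabs z - cabs w <= cabs (z - w).
Proof. by rewrite lerBlDr -[X in cabs X <= _](subrK w) cabsD. Qed.
Lemma cabsX z n : cabs (z ^+ n) = cabs z ^+ n.
Proof. by elim: n => [|n IH]; rewrite ?expr0 ?cabs1// !exprS cabsM IH. Qed.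
Lemma cabs_eq0 z : (cabs z == 0) = (z == 0).
Proof.
apply/eqP/eqP => [|->]; last exact: cabs0.
exact: ComplexField.Normc.eq0_normc.
Qed.
Lemma cabs_gt0 z : (0 < cabs z) = (z != 0).
Proof. by rewrite lt_neqAle cabs_ge0 andbT eq_sym cabs_eq0. Qed.
Lemma cabsR x : cabs x%:C = `|x|.
Proof. by rewrite cabsE /= expr0n addr0 sqrtr_sqr. Qed.
Lemma cabs_Re z : `|Re z| <= cabs z.
Proof. by rewrite cabsE -sqrtr_sqr ler_wsqrtr// lerDl sqr_ge0. Qed.
Lemma cabs_Im z : `|Im z| <= cabs z.
Proof. by rewrite cabsE -sqrtr_sqr ler_wsqrtr// lerDr sqr_ge0. Qed.
Lemma Re_le_cabs z : Re z <= cabs z.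
Proof. exact: le_trans (ler_norm _) (cabs_Re z). Qed.
Lemma cabs_le_ReIm z : cabs z <= `|Re z| + `|Im z|.
Proof.
rewrite -(@ler_pXn2r _ 2)// ?nnegrE ?cabs_ge0 ?addr_ge0//.
rewrite cabs_sqr -(real_normK (num_real (Re z))) -(real_normK (num_real (Im z))).
by have := normr_ge0 (Re z); have := normr_ge0 (Im z); nra.
Qed.

Lemma cabs_sum (I : Type) (r : seq I) (P : pred I) (F : I -> C) :
  cabs (\sum_(i <- r | P i) F i) <= \sum_(i <- r | P i) cabs (F i).
Proof.
elim/big_rec2: _ => [|i x z _ zx]; first by rewrite cabs0.
by rewrite (le_trans (cabsD _ _))// lerD2l.
Qed.

Lemma cabs_prod (I : Type) (r : seq I) (P : pred I) (F : I -> C) :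
  cabs (\prod_(i <- r | P i) F i) = \prod_(i <- r | P i) cabs (F i).
Proof. by elim/big_rec2: _ => [|i x z _ <-]; rewrite ?cabs1 ?cabsM. Qed.

Lemma cabs_circle (u : circle R) : cabs (u : C) = 1.
Proof. by case: u => z /= /eqP; rewrite normE_cabs => -[]. Qed.

Lemma circle_conj (u : circle R) : (u : C)^-1 = ((u : C)^*)%C.
Proof.
apply: (mulfI (circle_neq0 u)); rewrite divff ?circle_neq0//.
have := circle_sqr u; case: (cval u) => a b /= ab.
by apply/eqP; rewrite eq_complex /=; apply/andP; split; apply/eqP; lra.
Qed.

Lemma cReD z w : Re (z + w) = Re z + Re w.
Proof. by case: z; case: w. Qed.
Lemma cImD z w : Im (z + w) = Im z + Im w.
Proof. by case: z; case: w. Qed.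
Lemma cReN z : Re (- z) = - Re z.
Proof. by case: z. Qed.
Lemma cImN z : Im (- z) = - Im z.
Proof. by case: z. Qed.
Lemma cReM z w : Re (z * w) = Re z * Re w - Im z * Im w.
Proof. by case: z; case: w. Qed.
Lemma cImM z w : Im (z * w) = Re z * Im w + Im z * Re w.
Proof. by case: z; case: w. Qed.

Lemma cReV z : Re z^-1 = Re z / cabs z ^+ 2.
Proof. by rewrite cabs_sqr; case: z. Qed.

Lemma complex_eqP z w : Re z = Re w -> Im z = Im w -> z = w.
Proof. by case: z; case: w => a b c d /= -> ->. Qed.

Lemma circle_sub1_sqr (u : circle R) : cabs ((u : C) - 1) ^+ 2 = 2 * (1 - Re u).
Proof. by rewrite cabs_sqr; have := circle_sqr u; case: (cval u) => a b /=; nra. Qed.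

Lemma cvg_cabsP T (F : set_system T) {FF : Filter F} (f : T -> C) (l : C) :
  f @ F --> l <-> forall e : R, 0 < e -> \forall x \near F, cabs (l - f x) < e.
Proof.
split=> [/cvgrPdist_lt fl e e0|fl].
  have := fl e%:C; rewrite ltcR => /(_ e0); apply: filterS => x.
  by rewrite normE_cabs ltcR.
apply/cvgrPdist_lt => e; rewrite ltcE /= => /andP[/eqP e1 e2].
have := fl _ e2; apply: filterS => x.
by rewrite normE_cabs ltcE /= e1 eqxx.
Qed.

Lemma nbhs_cabsP z (P : C -> Prop) :
  (\forall w \near z, P w) <->
  exists2 d : R, 0 < d & forall w, cabs (w - z) < d -> P w.
Proof.
split=> [/nbhs_normP[e e0 eP]|[d d0 dP]].
  move: e0; rewrite /= ltcE /= => /andP[/eqP e1 e2].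
  exists (Re e) => // w zw; apply: eP => /=.
  by rewrite /ball_ /= normE_cabs cabsC ltcE /= zw e1 eqxx.
apply/nbhs_normP; exists d%:C; first by rewrite /= ltcR.
by move=> w /=; rewrite /ball_ /= normE_cabs ltcR cabsC => /dP.
Qed.

Lemma nbhs0_cabsP (P : C -> Prop) :
  (\forall w \near (0 : C), P w) <->
  exists2 d : R, 0 < d & forall w, cabs w < d -> P w.
Proof.
by rewrite nbhs_cabsP; split=> -[d d0 dP]; exists d => // w; have := dP w; rewrite subr0.
Qed.

End modulus.

Arguments cabs : simpl never.

Section continuous_field_operations.
Context {S : topologicalType} {K : numFieldType}.
Implicit Types (f g : S -> K).

Lemma contC (c : K) : continuous (fun _ : S => c).
Proof. exact: cst_continuous. Qed.

Lemma contD f g : continuous f -> continuous g -> continuous (fun x => f x + g x).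
Proof. by move=> cf cg x; apply: (cvgD (cf x) (cg x)). Qed.

Lemma contN f : continuous f -> continuous (fun x => - f x).
Proof. by move=> cf x; apply: (cvgN (cf x)). Qed.

Lemma contB f g : continuous f -> continuous g -> continuous (fun x => f x - g x).
Proof. by move=> cf cg; apply: contD => //; exact: contN. Qed.

Lemma contM f g : continuous f -> continuous g -> continuous (fun x => f x * g x).
Proof. by move=> cf cg x; apply: (cvgM (cf x) (cg x)). Qed.

Lemma contV f : (forall x, f x != 0) -> continuous f -> continuous (fun x => (f x)^-1).
Proof. by move=> f0 cf x; apply: (cvgV (f0 x) (cf x)). Qed.

Lemma contNorm f : continuous f -> continuous (fun x => `|f x|).
Proof. by move=> cf x; apply: (cvg_norm (cf x)). Qed.

Lemma contX f n : continuous f -> continuous (fun x => f x ^+ n).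
Proof.
move=> cf; elim: n => [|n IH].
  by under eq_fun do rewrite expr0; exact: contC.
by under eq_fun do rewrite exprS; exact: contM.
Qed.

End continuous_field_operations.

Section derivative.
Context {R : realType}.
Local Notation C := R[i].

(** Differentiability as a first-order expansion with real epsilons. *)
Lemma derivable_cabs (F : C -> C) (z a : C) :
  (forall e : R, 0 < e -> exists2 d : R, 0 < d & forall h, cabs h < d ->
    cabs (F (h + z) - F z - a * h) <= e * cabs h) ->
  derivable F z 1 /\ derive1 F z = a.
Proof.
move=> Fa.
have cv : (fun h : C => h^-1 *: (F (h *: (1 : C) + z) - F z)) @ 0^' --> a.
  apply/cvg_cabsP => e e0; have e2 : 0 < e / 2 by rewrite divr_gt0.
  have [d d0 dF] := Fa _ e2.
  apply/nbhs0_cabsP; exists d => // h hd hN0.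
  have h0 : 0 < cabs h by rewrite cabs_gt0.
  have hn : h != 0 by rewrite -cabs_gt0.
  have -> : a - h^-1 *: (F (h *: (1 : C) + z) - F z) =
      - ((F (h + z) - F z - a * h) / h).
    rewrite (_ : h *: (1 : C) = h); last by rewrite /GRing.scale /= mulr1.
    by rewrite /GRing.scale /=; field.
  rewrite cabsN cabsM cabsV ltr_pdivrMr//.
  apply: (le_lt_trans (dF h hd)); nra.
split; first by apply/cvg_ex; exists a.
rewrite derive1E; apply: cvg_lim => //.
Qed.

Lemma derivable_continuous_cabs (F : C -> C) (z : C) : derivable F z 1 ->
  forall e : R, 0 < e -> exists2 d : R, 0 < d & forall w, cabs (w - z) < d ->
    cabs (F w - F z) < e.
Proof.
move=> /derivable1_diffP/differentiable_continuous/cvg_cabsP Fz e e0.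
have /nbhs_cabsP[d d0 dF] := Fz _ e0.
by exists d => // w /dF; rewrite cabsC.
Qed.

Lemma derive1_near (F G : C -> C) (z : C) : (\forall w \near z, F w = G w) ->
  derive1 F z = derive1 G z.
Proof.
move=> FG; rewrite !derive1E.
by apply: near_eq_derive => //; exact: oner_neq0.
Qed.

End derivative.

Section circle_integral.
Context {R : realType}.
Local Notation C := R[i].
Local Notation T := (circle R).

Lemma expi_continuous : continuous (@expi R).
Proof.
apply/continuous_comp_initial => t; apply/cvg_cabsP => e e0.
have e2 : 0 < e / 2 by rewrite divr_gt0.
have /cvgrPdist_lt/(_ _ e2) := @continuous_cos R t.
have /cvgrPdist_lt/(_ _ e2) := @continuous_sin R t.
apply: filterS2 => x s c /=; apply: le_lt_trans (cabs_le_ReIm _) _; rewrite /=.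
by rewrite (splitr e) ltrD.
Qed.

Lemma circle_compact : compact [set: T].
Proof.
rewrite (_ : [set: T] = (@expi R) @` `[- pi, pi]%classic).
  apply: continuous_compact; last exact: segment_compact.
  exact/continuous_subspaceT/expi_continuous.
apply/esym/seteqP; split => // z _ /=; exists (arg z); last exact: argK.
by rewrite /= in_itv /=; have /andP[/ltW -> ->] := arg_bounds z.
Qed.

Lemma continuous_circle_bounded (f : T -> R) : continuous f ->
  exists2 M : R, 0 < M & forall z, `|f z| <= M.
Proof.
move=> cf.
have : compact (f @` [set: T]).
  by apply: continuous_compact; [exact: continuous_subspaceT|exact: circle_compact].
move=> /compact_bounded[M [_ Mf]]; exists (`|M| + 1); first by rewrite ltr_wpDl.
move=> z; apply: (Mf (`|M| + 1)); last by exists z.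
by rewrite (le_lt_trans (ler_norm _))// ltrDl.
Qed.

Lemma continuous_circle_measurable (f : T -> R) : continuous f ->
  measurable_fun setT f.
Proof.
move=> /continuousP cf; apply: (measurability _ (measurable_realfun.RGenOpens.measurableE R)).
move=> /= _ [_ [a [b ->]]] <-; rewrite setTI; apply: sub_sigma_algebra.
by apply: cf; exact: interval_open.
Qed.

Lemma bounded_measurable_integrable (m : {finite_measure set T -> \bar R})
  (f : T -> R) (M : R) : measurable_fun setT f -> (forall z, `|f z| <= M) ->
  m.-integrable setT (EFin \o f).
Proof.
move=> mf Mf; apply: measurable_bounded_integrable => //.
  by rewrite ltey_eq fin_num_measure.
by exists M; split; [exact: num_real|move=> x Mx y _ /=; exact: le_trans (ltW Mx)].
Qed.

Lemma continuous_integrable (m : {finite_measure set T -> \bar R}) (f : T -> R) :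
  continuous f -> m.-integrable setT (EFin \o f).
Proof.
move=> cf; have [M _ Mf] := continuous_circle_bounded cf.
exact: bounded_measurable_integrable (continuous_circle_measurable cf) Mf.
Qed.

Definition mass (m : {finite_measure set T -> \bar R}) : R := fine (m setT).

Lemma mass_ge0 m : 0 <= mass m. Proof. exact: fine_ge0. Qed.

Lemma mass_prob (m : probability T R) : mass m = 1.
Proof. by rewrite /mass (_ : _ setT = 1%E)//; exact: (@probability_setT _ _ _ m). Qed.

Implicit Types (m : {finite_measure set T -> \bar R}) (f g : T -> C).

Lemma Rintegral_mass m (c : R) : \int[m]_x c = c * mass m.
Proof. by rewrite Rintegral_cst. Qed.

Lemma Rintegral_bound m (f : T -> R) (c : R) : continuous f ->
  (forall x, f x <= c) -> \int[m]_x f x <= c * mass m.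
Proof.
move=> cf fc; rewrite -Rintegral_mass; apply: le_Rintegral => //.
- exact: continuous_integrable.
- by apply: (@continuous_integrable m (cst c)); exact: cst_continuous.
Qed.

Lemma continuous_ReIm (S : topologicalType) (f : S -> C) :
  continuous f <->
  continuous (fun x => Re (f x)) /\ continuous (fun x => Im (f x)).
Proof.
split=> [cf|[cr ci] x].
  split=> x; apply/cvgrPdist_lt => e e0; have /cvg_cabsP/(_ _ e0) := cf x;
    apply: filterS => y; apply: le_lt_trans.
    by rewrite /= -cReN -cReD cabs_Re.
  by rewrite /= -cImN -cImD cabs_Im.
apply/cvg_cabsP => e e0; have e2 : 0 < e / 2 by rewrite divr_gt0.
have /cvgrPdist_lt/(_ _ e2) := cr x; have /cvgrPdist_lt/(_ _ e2) := ci x.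
apply: filterS2 => y s c; apply: le_lt_trans (cabs_le_ReIm _) _.
by rewrite cReD cReN cImD cImN (splitr e) ltrD.
Qed.

Lemma continuous_Re (S : topologicalType) (f : S -> C) :
  continuous f -> continuous (fun x => Re (f x)).
Proof. by move=> /continuous_ReIm[]. Qed.

Lemma continuous_Im (S : topologicalType) (f : S -> C) :
  continuous f -> continuous (fun x => Im (f x)).
Proof. by move=> /continuous_ReIm[]. Qed.

Lemma continuous_cabs (S : topologicalType) (f : S -> C) :
  continuous f -> continuous (fun x => cabs (f x)).
Proof.
move=> cf x; apply/cvgrPdist_lt => e e0; have /cvg_cabsP/(_ _ e0) := cf x.
apply: filterS => y; apply: le_lt_trans.
rewrite ler_norml cabs_lower andbT lerNl opprB cabsC.
exact: cabs_lower.
Qed.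

Lemma cval_continuous : continuous (@cval R).
Proof. exact: initial_continuous. Qed.

Lemma cintegralE m f :
  cintegral m f = (\int[m]_x Re (f x)) +i* (\int[m]_x Im (f x)).
Proof. by []. Qed.

Let intRe m f : continuous f -> m.-integrable setT (EFin \o (fun x => Re (f x))).
Proof. by move=> cf; apply: continuous_integrable; exact: continuous_Re. Qed.

Let intIm m f : continuous f -> m.-integrable setT (EFin \o (fun x => Im (f x))).
Proof. by move=> cf; apply: continuous_integrable; exact: continuous_Im. Qed.

Lemma cintegralD m f g : continuous f -> continuous g ->
  cintegral m (fun x => f x + g x) = cintegral m f + cintegral m g.
Proof.
move=> cf cg; rewrite !cintegralE; apply: complex_eqP => /=.
  by under eq_Rintegral do rewrite cReD; rewrite RintegralD//; exact: intRe.
by under eq_Rintegral do rewrite cImD; rewrite RintegralD//; exact: intIm.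
Qed.

Lemma cintegralZ m (c : C) f : continuous f ->
  cintegral m (fun x => c * f x) = c * cintegral m f.
Proof.
move=> cf; rewrite !cintegralE.
have cZ (g : T -> R) (r : R) : continuous g -> continuous (fun x => r * g x).
  by move=> cg; exact: contM (@contC _ _ _) cg.
have ir r := continuous_integrable m (cZ _ r (continuous_Re cf)).
have ii r := continuous_integrable m (cZ _ r (continuous_Im cf)).
apply: complex_eqP => /=.
  under eq_Rintegral do rewrite cReM.
  rewrite cReM /= RintegralB//; [|exact: ir|exact: ii].
  by rewrite !RintegralZl//; [exact: intIm|exact: intRe].
under eq_Rintegral do rewrite cImM.
rewrite cImM /= RintegralD//; [|exact: ii|exact: ir].
by rewrite !RintegralZl//; [exact: intRe|exact: intIm].
Qed.

Lemma cintegralN m f : continuous f ->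
  cintegral m (fun x => - f x) = - cintegral m f.
Proof.
move=> cf; rewrite -mulN1r -cintegralZ//.
by congr cintegral; apply: funext => x; rewrite mulN1r.
Qed.

Lemma cintegralB m f g : continuous f -> continuous g ->
  cintegral m (fun x => f x - g x) = cintegral m f - cintegral m g.
Proof.
by move=> cf cg; rewrite (cintegralD m cf (contN cg)) (cintegralN m cg).
Qed.

Lemma cintegral_cst m (c : C) : cintegral m (fun=> c) = c * (mass m)%:C.
Proof.
by rewrite cintegralE !Rintegral_mass; apply: complex_eqP; case: c => a b /=; ring.
Qed.

(** Multiplying by the unimodular [u] opposite to the phase of the integral makes it real and equal
    to its modulus; only real parts then need comparing. *)
Lemma cintegral_le m f (g : T -> R) : continuous f -> continuous g ->
  (forall x, cabs (f x) <= g x) -> cabs (cintegral m f) <= \int[m]_x g x.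
Proof.
move=> cf cg fg; set w := cintegral m f.
have [w0|w0] := eqVneq w 0.
  rewrite w0 cabs0; apply: Rintegral_ge0 => x _.
  exact: le_trans (cabs_ge0 _) (fg x).
have cw : cabs w != 0 by rewrite cabs_eq0.
pose u : C := (w^*)%C * (cabs w)^-1%:C.
have uw : u * w = (cabs w)%:C.
  rewrite /u mulrAC (_ : (w^*)%C * w = (cabs w ^+ 2)%:C).
    by rewrite -rmorphM /= expr2 mulfK.
  by rewrite cabs_sqr; case: (w) => a b; apply: complex_eqP => /=; ring.
have u1 : cabs u = 1.
  apply: (mulIf cw); rewrite -cabsM uw cabsR mul1r ger0_norm//.
  exact: cabs_ge0.
have -> : cabs w = \int[m]_x Re (u * f x).
  have := congr1 (fun z : C => Re z) uw.
  by rewrite /w -(cintegralZ m u cf) => /esym.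
have cuf : continuous (fun x => u * f x) by exact: contM (@contC _ _ _) cf.
apply: le_Rintegral => //; [exact: intRe|exact: continuous_integrable|].
move=> x _; apply: le_trans (Re_le_cabs _) _.
by rewrite cabsM u1 mul1r.
Qed.

Lemma cintegral_bound m f (c : R) : continuous f ->
  (forall x, cabs (f x) <= c) -> cabs (cintegral m f) <= c * mass m.
Proof.
move=> cf fc; rewrite -Rintegral_mass; apply: cintegral_le => //.
exact: cst_continuous.
Qed.

End circle_integral.

(** * Density of trigonometric polynomials *)

Section trigonometric_polynomials.
Context {R : realType}.
Local Notation C := R[i].
Local Notation T := (circle R).

Definition circle1 : T := Circle (@circle1_subproof R).

Lemma nbhs_circleP (z : T) (P : T -> Prop) :
  (\forall w \near z, P w) <->
  exists2 d : R, 0 < d & forall w : T, cabs ((w : C) - (z : C)) < d -> P w.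
Proof.
split=> [[B [[D oD <-] Dz] BP]|[d d0 dP]].
  have /nbhs_cabsP[d d0 dD] : \forall w \near (z : C), D w by exact: open_nbhs_nbhs.
  by exists d => // w /dD; exact: BP.
have : \forall w \near (z : C), cabs (w - (z : C)) < d by apply/nbhs_cabsP; exists d.
move=> /(@cval_continuous R z) zP; apply: (@filterS _ (nbhs z) _ _ _ _ zP).
by move=> w /= /dP.
Qed.

(** Closeness is measured by [1 - Re (z / w)], half the squared distance, the quantity on which the
    kernel below depends. By compactness, rotations near 1 move the values of [f] little, uniformly
    in the point. *)
Lemma circle_unif_continuous (f : T -> R) : continuous f ->
  forall e : R, 0 < e -> exists2 d : R, 0 < d &
    forall z w : T, 1 - Re (rot w z) < d -> `|f z - f w| < e.
Proof.
move=> cf e e0; have e2 : 0 < e / 2 by rewrite divr_gt0.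
have /compact_near_coveringP nc := @circle_compact R.
have : \forall b \near circle1, [set: T] `<=` (fun z => `|f (rot b z) - f z| < e).
  apply: (nc T (nbhs circle1) (fun b z => `|f (rot b z) - f z| < e)) => z0 _.
  have /cvgrPdist_lt/(_ _ e2)/nbhs_circleP[d d0 dz] := cf z0.
  have d2 : 0 < d / 2 by rewrite divr_gt0.
  exists ([set z : T | cabs ((z : C) - (z0 : C)) < d / 2],
          [set b : T | cabs ((b : C) - 1) < d / 2]).
    by split; apply/nbhs_circleP; exists (d / 2).
  move=> [z b] [/= zd bd].
  have fz : `|f z0 - f z| < e / 2 by apply: dz; rewrite (lt_trans zd)//; lra.
  have : `|f z0 - f (rot b z)| < e / 2.
    apply: dz; rewrite -[cabs _]mulr1 -(cabs_circle b) -cabsM mulrBl.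
    rewrite divfK ?circle_neq0// (le_lt_trans (cabs_tri (z0 : C) _ _))//.
    rewrite (splitr d) ltrD// -{1}[z0 : C]mulr1 -mulrBr cabsM cabs_circle mul1r.
    by rewrite cabsC.
  move=> fb; rewrite -(subrKA (f z0)) (le_lt_trans (ler_normD _ _))//.
  by rewrite (splitr e) ltrD// distrC.
move=> /nbhs_circleP[d d0 dP]; exists (d ^+ 2 / 2); first by rewrite divr_gt0// exprn_gt0.
move=> z w zw; rewrite distrC.
have {1}-> : w = rot (rot w z) z.
  by apply: val_inj => /=; rewrite invf_div mulrCA divff ?circle_neq0// mulr1.
apply: dP => //.
rewrite -(@ltr_pXn2r _ 2)// ?nnegrE ?cabs_ge0 ?(ltW d0)// circle_sub1_sqr; lra.
Qed.

(** Real parts suffice: on the circle negative frequencies are conjugates of positive ones. *)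
Inductive trigpoly (N : nat) : (T -> R) -> Prop :=
| Trig_mono a p of (p <= N)%N : trigpoly N (fun z => Re (a * (z : C) ^+ p))
| Trig_add f g of trigpoly N f & trigpoly N g : trigpoly N (fun z => f z + g z).

Lemma trigpolyM N M f g : trigpoly N f -> trigpoly M g ->
  trigpoly (N + M) (fun z => f z * g z).
Proof.
move=> tf; elim: tf g => [a p pN|f1 f2 _ IH1 _ IH2] g tg; last first.
  by under eq_fun do rewrite mulrDl; apply: Trig_add; [exact: IH1|exact: IH2].
elim: tg => [b q qM|g1 g2 _ IH1 _ IH2]; last first.
  by under eq_fun do rewrite mulrDr; apply: Trig_add.
have zc (z : T) n : ((z : C)^*)%C ^+ n * (z : C) ^+ n = 1.
  by rewrite -circle_conj -exprMn mulVf ?circle_neq0// expr1n.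
have half (x y : C) : Re x * Re y = Re (2^-1%:C * (x * y)) + Re (2^-1%:C * (x * y^*%C)).
  by case: x; case: y => c d a' b' /=; lra.
have conjM (x y : C) n : ((x * y ^+ n)^*)%C = x^*%C * (y^*%C) ^+ n.
  by rewrite rmorphM rmorphXn.
have Rc (x : C) : Re (x^*)%C = Re x by case: x.
wlog qp : a b p q N M pN qM / (q <= p)%N.
  move=> W; have [qp|/ltnW pq] := leqP q p; first exact: (W a b p q N M).
  by rewrite addnC; under eq_fun do rewrite mulrC; exact: (W b a q p M N).
have E (z : T) : Re (a * (z : C) ^+ p) * Re (b * (z : C) ^+ q) =
    Re ((2^-1%:C * (a * b)) * (z : C) ^+ (p + q)) +
    Re ((2^-1%:C * (a * b^*%C)) * (z : C) ^+ (p - q)).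
  rewrite half conjM; congr (Re _ + Re _); first by rewrite exprD; ring.
  rewrite -{1}(subnK qp) exprD; have := zc z q.
  set u := _ ^+ q; set v := _ ^+ q => uv.
  by rewrite -[RHS]mulr1 -uv; ring.
under eq_fun do rewrite E.
by apply: Trig_add; apply: Trig_mono; lia.
Qed.

End trigonometric_polynomials.

Section roots_of_unity.
Context {R : realType}.
Local Notation C := R[i].
Local Notation T := (circle R).

Lemma expiD (x y : R) : (expi (x + y) : C) = (expi x : C) * (expi y : C).
Proof. by apply: complex_eqP; rewrite /= ?cosD ?sinD//; ring. Qed.

Lemma expi0 : (expi 0 : C) = 1.
Proof. by apply: complex_eqP; rewrite /= ?cos0 ?sin0. Qed.

Lemma expiN (x : R) : (expi (- x) : C) = (expi x : C)^-1.
Proof.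
by apply: (mulfI (circle_neq0 (expi x))); rewrite -expiD subrr expi0 divff ?circle_neq0.
Qed.

Lemma expiMn (x : R) n : (expi (x *+ n) : C) = (expi x : C) ^+ n.
Proof. by elim: n => [|n IH]; rewrite ?mulr0n ?expi0// mulrS expiD IH exprS. Qed.

Lemma expi_sum (I : Type) (r : seq I) (F : I -> R) :
  (expi (\sum_(i <- r) F i) : C) = \prod_(i <- r) (expi (F i) : C).
Proof. by elim: r => [|i r IH]; rewrite ?big_nil ?expi0// !big_cons expiD IH. Qed.

Lemma expi_neq1 (x : R) : 0 < x < pi *+ 2 -> (expi x : C) != 1.
Proof.
move=> /andP[x0 x2]; have xE : x = (x / 2) *+ 2 by rewrite mulr2n -splitr.
have s0 : 0 < sin (x / 2).
  by apply: sin_gt0_pi; rewrite divr_gt0//= ltr_pdivrMr// mulr_natr.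
apply/eqP => /(congr1 (fun z : C => Re z)) /=.
rewrite xE cos_mulr2n; have := cos2Dsin2 (x / 2); nra.
Qed.

(** The sign is negative because [rot] divides: rotating by [unity_pt M j] multiplies by
    [unity_root M ^+ j]. *)
Definition unity_root M : C := expi (- (pi *+ 2 / M%:R)).

Lemma unity_rootX M : (0 < M)%N -> unity_root M ^+ M = 1.
Proof.
move=> M0; rewrite /unity_root -expiMn mulNrn -[_ *+ M]mulr_natr.
rewrite divfK ?pnatr_eq0 -?lt0n// expiN.
have -> : (expi (pi *+ 2 : R) : C) = 1; last by rewrite invr1.
by apply: complex_eqP => /=; rewrite ?cos2pi ?sin2pi.
Qed.

Lemma sum_unity_root M p : (0 < p < M)%N ->
  \sum_(j < M) unity_root M ^+ (p * j) = 0.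
Proof.
move=> /andP[p0 pM]; have M0 : (0 < M)%N by exact: leq_trans pM.
set w := unity_root M ^+ p.
have w1 : w != 1.
  rewrite /w /unity_root expiN exprVn -expiMn invr_eq1; apply: expi_neq1.
  have MR : 0 < M%:R :> R by rewrite ltr0n.
  have pi2 : 0 < pi *+ 2 :> R by have := pi_gt0 R; rewrite mulr2n; lra.
  rewrite -[_ *+ p]mulr_natr mulr_gt0 ?divr_gt0 ?ltr0n//= mulrAC ltr_pdivrMr//.
  by rewrite ltr_pM2l// ltr_nat.
under eq_bigr do rewrite exprM -/w.
apply: (mulfI (_ : w - 1 != 0)); first by rewrite subr_eq0.
by rewrite mulr0 -subrX1 /w exprAC unity_rootX// expr1n subrr.
Qed.

Definition unity_pt M j : T := expi (pi *+ 2 / M%:R *+ j).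

Lemma rot_unity_pt M j (z : T) : (rot (unity_pt M j) z : C) = (z : C) * unity_root M ^+ j.
Proof. by rewrite /unity_root expiN exprVn -expiMn. Qed.

(** Frequencies strictly between 0 and [M] sum to zero over the [M]-th roots of unity; only the
    constant term survives. *)
Lemma trigpoly_average N M (f : T -> R) : (N < M)%N -> trigpoly N f ->
  exists c, forall z, \sum_(j < M) f (rot (unity_pt M j) z) = c.
Proof.
move=> NM; elim=> [a p pN|g h _ [c gc] _ [d hd]]; last first.
  by exists (c + d) => z; rewrite big_split /= gc hd.
have E (z : T) : \sum_(j < M) Re (a * (rot (unity_pt M j) z : C) ^+ p) =
    Re (a * (z : C) ^+ p * \sum_(j < M) unity_root M ^+ (p * j)).
  have Rs (F : 'I_M -> C) : \sum_(j < M) Re (F j) = Re (\sum_(j < M) F j).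
    by elim/big_rec2: _ => // i y x _ ->; rewrite cReD.
  rewrite Rs mulr_sumr; congr Re; apply: eq_bigr => j _.
  by rewrite rot_unity_pt exprMn -exprM mulnC mulrA.
case: p pN E => [|p] pN E.
  by exists (Re (a * \sum_(j < M) unity_root M ^+ (0 * j))) => z; rewrite E expr0 mulr1.
exists 0 => z; rewrite E sum_unity_root ?mulr0//.
exact: leq_ltn_trans NM.
Qed.

Lemma trigpoly_scale N (c : R) (f : T -> R) : trigpoly N f ->
  trigpoly N (fun z => c * f z).
Proof.
elim=> [a p pN|g h _ IHg _ IHh].
  rewrite (_ : (fun _ => _) = fun z : T => Re ((c%:C * a) * (z : C) ^+ p)).
    exact: Trig_mono.
  by apply: funext => z; rewrite -mulrA [in RHS]cReM /= mul0r subr0.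
by under eq_fun do rewrite mulrDr; apply: Trig_add.
Qed.

Lemma trigpoly_rot N (w : T) (f : T -> R) : trigpoly N f ->
  trigpoly N (fun z => f (rot w z)).
Proof.
elim=> [a p pN|g h _ IHg _ IHh]; last exact: Trig_add.
rewrite (_ : (fun _ => _) = fun z : T => Re ((a * (w : C)^-1 ^+ p) * (z : C) ^+ p)).
  exact: Trig_mono.
by apply: funext => z /=; rewrite exprMn; congr Re; ring.
Qed.

Lemma trigpoly_sum N (I : Type) (r : seq I) (F : I -> T -> R) :
  (forall i, trigpoly N (F i)) -> trigpoly N (fun z => \sum_(i <- r) F i z).
Proof.
move=> tF; elim: r => [|i r IH].
  rewrite (_ : (fun _ => _) = fun z : T => Re (0 * (z : C) ^+ 0)).
    exact: Trig_mono.
  by apply: funext => z; rewrite big_nil mul0r.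
by under eq_fun do rewrite big_cons; apply: Trig_add.
Qed.

(** At [z = exp(i t)] this is [cos(t / 2) ^ (2 n)], an unnormalized de la Vallee Poussin kernel:
    nonnegative, of degree [n], peaked at 1. *)
Definition fejer_kernel n (z : T) : R := ((1 + Re z) / 2) ^+ n.

Lemma trigpoly_fejer n : trigpoly n (fejer_kernel n).
Proof.
elim: n => [|n IH].
  rewrite (_ : fejer_kernel 0 = fun z : T => Re (1 * (z : C) ^+ 0)).
    exact: Trig_mono.
  by apply: funext => z; rewrite /fejer_kernel !expr0 mul1r.
rewrite (_ : fejer_kernel n.+1 = fun z => ((1 + Re z) / 2) * fejer_kernel n z).
  rewrite -add1n; apply: trigpolyM => //.
  rewrite (_ : (fun _ => _) = fun z : T => Re (2^-1%:C * (z : C) ^+ 0) + Re (2^-1%:C * (z : C) ^+ 1)).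
    by apply: Trig_add; exact: Trig_mono.
  by apply: funext => z; rewrite expr0 expr1 !cReM /=; lra.
by apply: funext => z; rewrite /fejer_kernel exprS.
Qed.

Lemma fejer_kernel_ge0 n (z : T) : 0 <= fejer_kernel n z.
Proof. by apply: exprn_ge0; have := circle_Re_itv z; lra. Qed.

(** The factor [n + 1] is the number of translates summed in the approximation. Squaring Bernoulli's
    bound gives a decay in [1 / m ^ 2], which beats [n + 1 = 2 m + 3]. *)
Lemma fejer_kernel_decay (d e : R) : 0 < d -> 0 < e -> exists n, forall z : T,
  d <= 1 - Re z -> n.+1%:R * fejer_kernel n z <= e.
Proof.
move=> d0 e0.
(* (1 - x)^(2m) (1 + m x)^2 <= 1 *)
have bern (x : R) m : 0 <= x <= 1 -> (1 - x) ^+ m * (1 + m%:R * x) <= 1.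
  move=> /andP[x0 x1]; elim: m => [|m IH]; first by rewrite expr0 mul1r mul0r addr0.
  rewrite exprSr -mulrA (le_trans _ IH)// ler_wpM2l ?exprn_ge0 ?subr_ge0//.
  by rewrite -natr1; have : 0 <= m%:R :> R by []; nra.
have [m mE] : exists m : nat, (4 / e + 4) / d ^+ 2 * 4 <= m%:R.
  by exists (Num.bound ((4 / e + 4) / d ^+ 2 * 4)); apply: ltW; apply: archi_boundP;
    rewrite !mulr_ge0 ?addr_ge0 ?divr_ge0 ?invr_ge0 ?sqr_ge0// ltW.
exists (2 * m.+1)%N => z dz.
set x := (1 - Re z) / 2; have zb := circle_Re_itv z.
have x01 : 0 <= x <= 1 by rewrite /x; lra.
have -> : fejer_kernel (2 * m.+1) z = ((1 - x) ^+ m.+1) ^+ 2.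
  by rewrite /fejer_kernel -exprM mulnC /x; congr (_ ^+ _); field.
have B := bern x m.+1 x01; set y := (1 - x) ^+ m.+1 in B *.
have y0 : 0 <= y by rewrite exprn_ge0//; lra.
have xd : d / 2 <= x by rewrite /x; lra.
rewrite -natr1 natrM.
set M : R := m.+1%:R in B *; have M1 : 1 <= M by rewrite ler1n.
have MmE : (4 / e + 4) * 4 <= M * d ^+ 2.
  have : (4 / e + 4) / d ^+ 2 * 4 <= M by rewrite (le_trans mE)// ler_nat.
  by rewrite mulrAC ler_pdivrMr// exprn_gt0.
have yM : y * (M * (d / 2)) <= 1.
  apply: le_trans B; rewrite ler_wpM2l//.
  have : M * (d / 2) <= M * x by rewrite ler_wpM2l// (le_trans _ M1).
  lra.
have q0 : 0 <= y * (M * (d / 2)) by rewrite !mulr_ge0// ?divr_ge0// ?ltW// (lt_le_trans _ M1).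
have sq : (y * (M * (d / 2))) ^+ 2 <= 1 by rewrite expr_le1.
have sq' : y ^+ 2 * M * (M * d ^+ 2) <= 4.
  rewrite (_ : _ * _ * _ = 4 * (y * (M * (d / 2))) ^+ 2); last by field.
  lra.
have yM0 : 0 <= y ^+ 2 * M by rewrite mulr_ge0 ?sqr_ge0//; lra.
have : y ^+ 2 * M * ((4 / e + 4) * 4) <= 4 by apply: le_trans sq'; rewrite ler_wpM2l.
have e4 : 0 < 4 / e by rewrite divr_gt0.
have E4 : e * (4 / e) = 4 by rewrite mulrC divfK// gt_eqF.
have y2 : y ^+ 2 <= y ^+ 2 * M by rewrite ler_peMr// sqr_ge0.
have -> : (2 * M + 1) * y ^+ 2 = 2 * (y ^+ 2 * M) + y ^+ 2 by ring.
move: (4 / e) e4 E4 => t t0 et; move: (y ^+ 2 * M) yM0 y2 => u u0 yu hu.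
have : u * t <= 1 by nra.
nra.
Qed.

End roots_of_unity.

Section density.
Context {R : realType}.
Local Notation C := R[i].
Local Notation T := (circle R).

Lemma trigpoly_continuous N (f : T -> R) : trigpoly N f -> continuous f.
Proof.
elim=> [a p _|g h _ cg _ ch]; last exact: contD.
apply: continuous_Re; apply: contM; first exact: contC.
by apply: contX; exact: cval_continuous.
Qed.

(* f is averaged against translates of the kernel ((1 + cos) / 2) ^ n centered *)
(* at the (n+1)-st roots of unity; the sum of the translates is constant, and  *)
(* at least 1 by evaluation at 1.                                              *)
Lemma trigpoly_dense (f : T -> R) : continuous f -> forall e : R, 0 < e ->
  exists N g, trigpoly N g /\ forall z, `|f z - g z| <= e.
Proof.
move=> cf e e0; have [B B0 fB] := continuous_circle_bounded cf.
have e2 : 0 < e / 2 by rewrite divr_gt0.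
have [d d0 fd] := circle_unif_continuous cf e2.
have eB : 0 < e / (4 * B) by rewrite divr_gt0// mulr_gt0.
have [n nP] := fejer_kernel_decay d0 eB.
pose K j (z : T) := fejer_kernel n (rot (unity_pt n.+1 j) z).
have [c cE] := trigpoly_average (ltnSn n) (@trigpoly_fejer R n).
have K0 j z : 0 <= K j z by exact: fejer_kernel_ge0.
have c1 : 1 <= c.
  rewrite -(cE (@circle1 R)) big_ord_recl [X in X + _](_ : _ = 1).
    by rewrite lerDl; apply: sumr_ge0 => i _; exact: fejer_kernel_ge0.
  rewrite /fejer_kernel rot_unity_pt expr0 mulr1 /=.
  by rewrite (_ : (1 + 1) / 2 = 1) ?expr1n//; lra.
have c0 : 0 < c by lra.
exists n, (fun z => c^-1 * \sum_(j < n.+1) f (unity_pt n.+1 j) * K j z); split.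
  apply: trigpoly_scale; apply: trigpoly_sum => i.
  by apply: trigpoly_scale; apply: trigpoly_rot; exact: trigpoly_fejer.
move=> z.
have -> : f z = c^-1 * \sum_(j < n.+1) f z * K j z.
  by rewrite -mulr_sumr cE mulrCA mulVf ?mulr1// gt_eqF.
rewrite -mulrBr -sumrB normrM gtr0_norm ?invr_gt0// mulrC ler_pdivrMr//.
apply: le_trans (ler_norm_sum _ _ _) _.
have bnd j : `|f z * K j z - f (unity_pt n.+1 j) * K j z| <=
    e / 2 * K j z + 2 * B * (e / (4 * B) / n.+1%:R).
  rewrite -mulrBl normrM (ger0_norm (K0 j z)).
  have r0 : 0 <= 2 * B * (e / (4 * B) / n.+1%:R).
    by rewrite !mulr_ge0 ?invr_ge0 ?mulr_ge0// ltW.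
  (* Translates centered near [z] use uniform continuity; the others use the decay of the kernel,
     which supplies the factor [1 / (n + 1)]. *)
  have [zd|zd] := ltP (1 - Re (rot (unity_pt n.+1 j) z)) d.
    rewrite (le_trans (y := e / 2 * K j z)) ?lerDl//.
    by apply: ler_wpM2r => //; apply: ltW; exact: fd.
  have Kj : K j z <= e / (4 * B) / n.+1%:R.
    by rewrite ler_pdivlMr ?ltr0n// mulrC; exact: nP.
  rewrite (le_trans (y := 2 * B * (e / (4 * B) / n.+1%:R)))//; last first.
    by rewrite lerDr mulr_ge0// ltW.
  apply: ler_pM => //; have := ler_normB (f z) (f (unity_pt n.+1 j)).
  by have := fB z; have := fB (unity_pt n.+1 j); lra.
apply: (le_trans (ler_sum _ (fun (j : 'I_n.+1) _ => bnd j))).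
rewrite big_split /= -mulr_sumr cE sumr_const card_ord -[X in _ + X]mulr_natr.
have -> : 2 * B * (e / (4 * B) / n.+1%:R) * n.+1%:R = e / 2.
  have nn : n.+1%:R != 0 :> R by rewrite pnatr_eq0.
  by move: (n.+1%:R) nn => N nn; field; rewrite nn gt_eqF.
have : e / 2 <= e / 2 * c by rewrite ler_peMr// ltW.
lra.
Qed.

Definition moment (m : {finite_measure set T -> \bar R}) p : C :=
  cintegral m (fun z => (z : C) ^+ p).

Lemma cvg_ReIm (I : Type) (F : set_system I) {FF : Filter F} (f : I -> C) (l : C) :
  f @ F --> l ->
  ((fun i => Re (f i)) @ F --> Re l) /\ ((fun i => Im (f i)) @ F --> Im l).
Proof.
move=> /cvg_cabsP fl; split; apply/cvgrPdist_lt => e e0;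
  apply: filterS (fl _ e0) => i; apply: le_lt_trans.
  by rewrite -cReN -cReD cabs_Re.
by rewrite -cImN -cImD cabs_Im.
Qed.

Lemma cvg_of_ReIm (I : Type) (F : set_system I) {FF : Filter F} (f : I -> C) (l : C) :
  (fun i => Re (f i)) @ F --> Re l -> (fun i => Im (f i)) @ F --> Im l -> f @ F --> l.
Proof.
move=> /cvgrPdist_lt rl /cvgrPdist_lt il; apply/cvg_cabsP => e e0.
have e2 : 0 < e / 2 by rewrite divr_gt0.
apply: filterS2 (rl _ e2) (il _ e2) => i s c.
apply: le_lt_trans (cabs_le_ReIm _) _.
by rewrite cReD cReN cImD cImN (splitr e) ltrD.
Qed.

Lemma Rintegral_ReZ (m : {finite_measure set T -> \bar R}) (a : C) (f : T -> C) :
  continuous f -> \int[m]_z Re (a * f z) = Re (a * cintegral m f).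
Proof. by move=> cf; rewrite -cintegralZ. Qed.

Section cvg_integral.
Context {I : Type} (F : set_system I) {FF : ProperFilter F}.
Variables (m_ : I -> {finite_measure set T -> \bar R}) (m : {finite_measure set T -> \bar R}).

(** Moments give the integrals of trigonometric polynomials, which are uniformly dense; the moment
    of order 0 keeps the masses bounded. *)
Lemma cvg_Rintegral_of_moments : (forall p, moment (m_ i) p @[i --> F] --> moment m p) ->
  forall f : T -> R, continuous f -> \int[m_ i]_z f z @[i --> F] --> \int[m]_z f z.
Proof.
move=> mp f cf.
have cX p : continuous (fun z : T => (z : C) ^+ p).
  by apply: contX; exact: cval_continuous.
have trig_cvg N g : trigpoly N g -> \int[m_ i]_z g z @[i --> F] --> \int[m]_z g z.
  elim=> [a p _|g1 g2 t1 IH1 t2 IH2].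
    under eq_fun do rewrite Rintegral_ReZ//; rewrite Rintegral_ReZ//.
    have h : a * moment (m_ i) p @[i --> F] --> a * moment m p.
      by apply: cvgMl_tmp; exact: mp.
    by have [] := cvg_ReIm h.
  have E (m0 : {finite_measure set T -> \bar R}) :
      \int[m0]_z (g1 z + g2 z) = \int[m0]_z g1 z + \int[m0]_z g2 z.
    by rewrite RintegralD//; apply: continuous_integrable;
      [exact: trigpoly_continuous t1|exact: trigpoly_continuous t2].
  by under eq_fun do rewrite E; rewrite E; exact: cvgD.
have M0 := mass_ge0 m; pose M := mass m + 1; have Mgt : 0 < M by rewrite ltr_wpDl.
have mM : \forall i \near F, mass (m_ i) <= M.
  have := trig_cvg 0%N _ (Trig_mono 1 (leqnn 0)).
  move=> /cvgrPdist_lt/(_ 1 ltr01); apply: filterS => i.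
  under eq_Rintegral do rewrite mul1r expr0 /=.
  under [X in _ - X]eq_Rintegral do rewrite mul1r expr0 /=.
  by rewrite !Rintegral_mass !mul1r /M ltr_norml; lra.
apply/cvgrPdist_lt => e e0; have e3 : 0 < e / (4 * M) by rewrite divr_gt0// mulr_gt0.
have [N [g [tg fg]]] := trigpoly_dense cf e3.
have cg := trigpoly_continuous tg.
have dist (m0 : {finite_measure set T -> \bar R}) : mass m0 <= M ->
    `|\int[m0]_z f z - \int[m0]_z g z| <= e / 4.
  move=> m0M; have [i1 i2] := (continuous_integrable m0 cf, continuous_integrable m0 cg).
  rewrite -RintegralB// (le_trans (le_normr_Rintegral _ _))//.
    by apply: (@continuous_integrable _ m0 (fun z => f z - g z)); exact: contB.
  apply: le_trans (Rintegral_bound _ _ fg) _.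
    by apply: contNorm; exact: contB.

  have -> : e / 4 = e / (4 * M) * M by field; rewrite gt_eqF.
  by rewrite ler_wpM2l// ltW.
have e4 : 0 < e / 4 by rewrite divr_gt0.
have /cvgrPdist_lt/(_ _ e4) := trig_cvg _ _ tg.
apply: filterS2 mM => i mi gi.
have := dist _ mi; have : `|\int[m]_z f z - \int[m]_z g z| <= e / 4.
  by apply: dist; rewrite /M; lra.
move: gi; rewrite !ler_norml !ltr_norml => /andP[? ?] /andP[? ?] /andP[? ?].
by apply/andP; split; lra.
Qed.

Lemma cvg_cintegral : (forall f : T -> R, continuous f ->
    \int[m_ i]_z f z @[i --> F] --> \int[m]_z f z) ->
  forall f : T -> C, continuous f -> cintegral (m_ i) f @[i --> F] --> cintegral m f.
Proof.
move=> mf f cf; apply: cvg_of_ReIm; rewrite /cintegral /=.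
  by apply: (mf (fun z => Re (f z))); exact: continuous_Re.
by apply: (mf (fun z => Im (f z))); exact: continuous_Im.
Qed.

End cvg_integral.

Lemma EFin_Rintegral (m : {finite_measure set T -> \bar R}) (f : T -> R) :
  continuous f -> (\int[m]_z (f z)%:E)%E = (\int[m]_z f z)%:E.
Proof. by move=> cf; rewrite fineK//; apply: integrable_fin_num => //; exact: continuous_integrable. Qed.

Lemma weak_cvgP (m_ : nat -> {finite_measure set T -> \bar R})
    (m : {finite_measure set T -> \bar R}) :
  weak_cvg m_ m <-> forall f : T -> R, continuous f ->
    \int[m_ n]_z f z @[n --> \oo] --> \int[m]_z f z.
Proof.
split=> mf f cf; have := mf f cf.
  under eq_fun do rewrite EFin_Rintegral//.
  by rewrite EFin_Rintegral// => /fine_cvgP[].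
move=> h; under eq_fun do rewrite EFin_Rintegral//.
by rewrite EFin_Rintegral//; apply: cvg_EFin => //; exact: nearW.
Qed.

End density.

(** * Weak compactness *)

Section step_approximation.
Context {R : realType}.

(** Abel summation: the step function equal to [c k.+1] on []t k, t k.+1]] is a combination of
    indicators of half-lines, so its integral involves distribution functions only. *)
Lemma telescope_steps (c t : nat -> R) (x : R) N : {homo t : i j / (i <= j)%N >-> i <= j} ->
  t 0%N < x <= t N ->
  exists k, [/\ (k < N)%N, t k < x <= t k.+1 &
    c N + \sum_(j < N) (c j - c j.+1) * (x <= t j)%R%:R = c k.+1].
Proof.
move=> tmon; elim: N => [|N IH]; first by move=> /andP[/lt_le_trans h /h]; rewrite ltxx.
move=> /andP[t0x xN]; rewrite big_ord_recr /=; have [xtN|tNx] := leP x (t N).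
  have [k [kN kx E]] := IH (introT andP (conj t0x xtN)).
  by exists k; split=> //; [exact: ltnW|rewrite -E mulr1; ring].
exists N; split => //; first by rewrite tNx.
rewrite mulr0 addr0 big1 ?addr0// => j _.
by rewrite leNgt (le_lt_trans _ tNx) ?mulr0//; apply: tmon; exact: ltnW.
Qed.

(** A Stieltjes sum whose error is the oscillation [w] of [h] on the cells times the mass. It is
    applied on the circle with [X] the argument and on the line with [X] the identity, hence the
    general [O] and [X]. *)
Lemma Rintegral_step d (O : measurableType d) (m : {finite_measure set O -> \bar R})
    (X h : O -> R) (c t : nat -> R) (w B : R) N :
  0 <= w -> measurable_fun setT X -> measurable_fun setT h -> (forall x, `|h x| <= B) ->
  {homo t : i j / (i <= j)%N >-> i <= j} ->
  m [set x | ~ (t 0%N < X x <= t N)] = 0%E ->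
  (forall x k, (k < N)%N -> t k < X x <= t k.+1 -> `|h x - c k.+1| <= w) ->
  `|\int[m]_x h x - (c N * fine (m setT) +
      \sum_(j < N) (c j - c j.+1) * fine (m [set x | X x <= t j]))| <= w * fine (m setT).
Proof.
move=> w0 mX mh hB tmon out0 hw.
have mset a : measurable [set x | X x <= a].
  rewrite (_ : [set x | _] = setT `&` X @^-1` `]-oo, a]%classic); first exact: mX.
  by apply/seteqP; split => x /=; rewrite in_itv/= ?andbT => // -[].
have mout : measurable [set x | ~ (t 0%N < X x <= t N)].
  rewrite (_ : [set x | _] = ~` ([set x | X x <= t N] `\` [set x | X x <= t 0%N])).
    by apply: measurableC; exact: measurableD.
  apply/seteqP; split => x /=.
    by move=> H [xN /negP x0]; apply: H; rewrite xN ltNge x0.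
  by move=> H /andP[x0 xN]; apply: H; split => //; rewrite leNgt x0.
have mfin A : measurable A -> m A \is a fin_num by exact: fin_num_measure.
have bint (f : O -> R) M : measurable_fun setT f -> (forall x, `|f x| <= M) ->
    m.-integrable setT (EFin \o f).
  move=> mf fM; apply: measurable_bounded_integrable => //.
    by rewrite ltey_eq mfin.
  by exists M; split; [exact: num_real|move=> x Mx y _ /=; exact: le_trans (ltW Mx)].
have iI A : measurable A -> m.-integrable setT (EFin \o (\1_A : O -> R)).
  move=> mA; apply: (bint _ 1); first exact: measurable_realfun.measurable_indic.
  by move=> x; rewrite indicE; case: (_ \in _); rewrite ?normr1 ?normr0.
have intI A : measurable A -> \int[m]_x \1_A x = fine (m A).
  by move=> mA; rewrite /Rintegral integral_indic// setIT.
pose s x : R := c N + \sum_(j < N) (c j - c j.+1) * \1_[set x | X x <= t j] x.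
have iZ (r : R) A : measurable A -> m.-integrable setT (EFin \o (fun x => r * \1_A x)).
  move=> mA; have := integrableZl measurableT r (iI _ mA).
  by apply: eq_integrable => // x _ /=; rewrite EFinM.
have iS n : m.-integrable setT
    (EFin \o (fun x => \sum_(j < n) (c j - c j.+1) * \1_[set x | X x <= t j] x)) /\
    \int[m]_x (\sum_(j < n) (c j - c j.+1) * \1_[set x | X x <= t j] x) =
    \sum_(j < n) (c j - c j.+1) * fine (m [set x | X x <= t j]).
  elim: n => [|n [IHi IHe]].
    split; last by rewrite big_ord0; under eq_Rintegral do rewrite big_ord0; rewrite Rintegral_cst// mul0r.
    apply: (bint _ 0) => [|x]; last by rewrite big_ord0 normr0.
    by under eq_fun do rewrite big_ord0; exact: measurable_cst.
  split.
    have := integrableD measurableT IHi (iZ (c n - c n.+1) _ (mset (t n))).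
    by apply: eq_integrable => // x _ /=; rewrite big_ord_recr /= EFinD.
  under eq_Rintegral do rewrite big_ord_recr /=.
  rewrite RintegralD//; last exact: iZ.
  by rewrite IHe big_ord_recr /= RintegralZl// ?intI//; exact: iI.
have icst (r : R) : m.-integrable setT (EFin \o (cst r)).
  by apply: (bint _ `|r|) => //; exact: measurable_cst.
have is_ : m.-integrable setT (EFin \o s).
  have := integrableD measurableT (icst (c N)) (iS N).1.
  by apply: eq_integrable => // x _ /=; rewrite EFinD.
have ih : m.-integrable setT (EFin \o h) by exact: bint mh hB.
have intS : \int[m]_x s x = c N * fine (m setT) +
      \sum_(j < N) (c j - c j.+1) * fine (m [set x | X x <= t j]).
  by rewrite RintegralD// ?(iS N).2 ?Rintegral_cst//; [exact: icst|exact: (iS N).1].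
rewrite -intS -RintegralB//.
have ihs : m.-integrable setT (EFin \o (fun x => h x - s x)).
  have := integrableB measurableT ih is_.
  by apply: eq_integrable => // x _ /=; rewrite EFinB.
apply: le_trans (le_normr_Rintegral measurableT ihs) _.
have [S S0 sS] : exists2 S : R, 0 <= S & forall x, `|s x| <= S.
  exists (`|c N| + \sum_(j < N) `|c j - c j.+1|).
    by rewrite addr_ge0// sumr_ge0.
  move=> x; rewrite (le_trans (ler_normD _ _))// lerD2l.
  rewrite (le_trans (ler_norm_sum _ _ _))//; apply: ler_sum => j _.
  by rewrite normrM indicE; case: (_ \in _); rewrite ?normr1 ?normr0 ?mulr1 ?mulr0.
pose o := [set x | ~ (t 0%N < X x <= t N)].
have B0 : 0 <= B + S by rewrite addr_ge0// (le_trans (normr_ge0 (h point))).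
apply: (@le_trans _ _ (\int[m]_x (cst w x + (B + S) * \1_o x))).
  apply: le_Rintegral => //.
  - have := integrable_abse ihs; by apply: eq_integrable => // x _ /=.
  - have := integrableD measurableT (icst w) (iZ (B + S) _ mout).
    by apply: eq_integrable => // x _ /=; rewrite EFinD.
  move=> x _; rewrite indicE /=; have [xin|xo] := boolP (t 0%N < X x <= t N).
    have [k [kN kx E]] := telescope_steps c tmon xin.
    rewrite memNset ?mulr0 ?addr0; last by move=> /(_ xin).
    have -> : s x = c k.+1; last exact: hw kN kx.
    rewrite -E /s; congr (_ + _); apply: eq_bigr => j _; rewrite indicE.
    by have [xj|xj] := leP (X x) (t j); [rewrite mem_set|rewrite memNset//=; apply/negP; rewrite -ltNge].
  rewrite mem_set /o; last exact/negP.
  rewrite mulr1 (le_trans (ler_normB _ _))// ler_wpDl// lerD//.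
rewrite (RintegralD measurableT (icst w) (iZ (B + S) _ mout)).
rewrite RintegralZl// ?intI//; last exact: iI.
by rewrite out0 mulr0 addr0 Rintegral_cst.
Qed.

End step_approximation.

Section compactness.
Context {R : realType}.
Local Notation C := R[i].
Local Notation T := (circle R).

(** A compact segment provides a cluster point, and an ultrafilter converges to its cluster
    points. *)
Lemma ultra_cvg_bounded (U : set_system nat) {UU : UltraFilter U} (u : nat -> R) (M : R) :
  (forall n, `|u n| <= M) -> exists l : R, u @ U --> l.
Proof.
move=> uM; have : (u @ U) `[- M, M]%classic.
  by apply: (@filterS _ U _ setT) => [n _|]; [rewrite /= in_itv /= -ler_norml|exact: filterT].
move=> /(@segment_compact R (- M) M)[l [_ lU]]; exists l => B lB.
have [//|UB] := in_ultra_setVsetC (u @^-1` B) UU.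
have [x [nBx Bx]] := lU (~` B) B UB lB.
by [].
Qed.

Lemma measurable_arg : measurable_fun setT (@arg R).
Proof.
have cR : continuous (fun z : T => Re z) by exact/continuous_Re/cval_continuous.
have cI : continuous (fun z : T => Im z) by exact/continuous_Im/cval_continuous.
have mR := continuous_circle_measurable cR; have mI := continuous_circle_measurable cI.
have macos : measurable_fun setT (fun z : T => acos (Re z)).
  apply: (measurability _ (measurable_realfun.RGenOInfty.measurableE R)).
  move=> /= _ [_ [a ->]] <-; rewrite setTI.
  have acosb (z : T) : 0 <= acos (Re z) <= pi.
    by rewrite acos_ge0 ?acos_lepi ?circle_Re_itv.
  have [a0|a0] := ltP a 0.
    rewrite (_ : _ @^-1` _ = setT)//; apply/seteqP; split => // z _ /=.
    by rewrite in_itv /= andbT (lt_le_trans a0)//; have /andP[] := acosb z.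
  have [api|api] := leP pi a.
    rewrite (_ : _ @^-1` _ = set0)//; apply/seteqP; split => // z /=.
    by rewrite in_itv /= andbT ltNge (le_trans _ api)//; have /andP[] := acosb z.
  rewrite (_ : _ @^-1` _ = setT `&` (fun z : T => Re z) @^-1` `]-oo, (cos a)[%classic).
    exact: mR.
  have ap : a \in `[0, pi] by rewrite in_itv /= a0 ltW.
  have E (z : T) : (Re z < cos a) = (a < acos (Re z)).
    rewrite -{1}(@acosK R (Re z)) ?in_itv /= ?circle_Re_itv//.
    by rewrite ltr_cos// in_itv /= acosb.
  by rewrite setTI; apply/seteqP; split => z /=; rewrite !in_itv /= andbT E.
rewrite (_ : @arg R = fun z => if 0 <= Im z then acos (Re z) else - acos (Re z))//.
apply: measurable_fun_ifT => //; last exact: measurableT_comp.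
by apply: measurable_fun_ler => //; exact: measurable_cst.
Qed.

Lemma measurable_expi : measurable_fun (setT : set (measurableTypeR R)) (@expi R : measurableTypeR R -> T).
Proof.
apply: (@measurability _ _ _ _ _ _ (@open T)) => //.
move=> _ [V oV <-]; rewrite setTI; apply: open_measurable.
by move/continuousP : (@expi_continuous R); apply.
Qed.

Lemma finite_measure_of d (O : measurableType d) (m : {measure set O -> \bar R}) :
  (m setT < +oo)%E -> exists m' : {finite_measure set O -> \bar R}, m' = m :> (set O -> \bar R).
Proof.
move=> mT; exists (mfrestr measurableT mT).
by apply: funext => A /=; rewrite /mfrestr /mrestr setIT.
Qed.

Lemma stieltjes_itv (F : cumulative R R) (a b : R) : a <= b ->
  lebesgue_stieltjes_measure F `]a, b]%classic = (F b - F a)%:E.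
Proof.
move=> ab; rewrite /lebesgue_stieltjes_measure /measure_extension.
by rewrite measurable_mu_extE/= ?wlength_itv_bnd//; exact: is_ocitv.
Qed.

(** [F] is the right limit of [G], taken as an infimum over later points; the sandwich between
    values of [G] is what later estimates need. *)
Lemma cumulative_above (G : R -> R) : nondecreasing G -> exists F : cumulative R R,
  (forall t, G t <= F t) /\ (forall s t, t < s -> F t <= G s).
Proof.
move=> Gmon.
pose S t := [set G s | s in [set s : R | t < s]].
have S0 t : S t !=set0 by exists (G (t + 1)); exists (t + 1) => //=; rewrite ltrDl.
have Slb t : lbound (S t) (G t) by move=> _ [s /= ts <-]; exact/Gmon/ltW.
have Sinf t : has_inf (S t) by split => //; exists (G t); exact: Slb.
pose F t := inf (S t).
have GF t : G t <= F t by apply: lb_le_inf.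
have FG s t : t < s -> F t <= G s by move=> ts; apply: (ge_inf (Sinf t).2); exists s.
have Fmon : nondecreasing F.
  by move=> x y xy; apply: lb_le_inf => // _ [s /= ys <-]; apply: FG; exact: le_lt_trans ys.
have Frc : forall x, F @ at_right x --> F x.
  move=> x; apply/cvgrPdist_lt => e e0.
  have [_ [s /= xs <-] sF] := inf_adherent e0 (Sinf x).
  apply: filterS2 (nbhs_right_gt x) (nbhs_right_lt xs) => y xy ys.
  have := Fmon _ _ (ltW xy); have := FG _ _ ys.
  by rewrite distrC ltr_norml /F in sF *; lra.
pose Fc : cumulative R R := HB.pack F (isCumulative.Build R _ R F Fmon Frc).
by exists Fc.
Qed.

(** The constant 8 is the length of []-4, 4]], the interval that [helly] cuts into [N] cells. *)
Lemma expi_arg_partition (f : T -> R) (e : R) : continuous f -> 0 < e ->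
  exists2 N, (0 < N)%N & forall s t : R, `|s - t| <= 8 / N%:R -> `|f (expi s) - f (expi t)| < e.
Proof.
move=> cf e0; have [d d0 fd] := circle_unif_continuous cf e0.
have /cvgrPdist_lt/(_ _ d0)/nbhs_normP[r /= r0 rd] := @continuous_cos R 0.
have [n nr] : exists n : nat, 8 / r < n%:R.
  by exists (Num.bound (8 / r)); apply: archi_boundP; rewrite divr_ge0// ltW.
have n0 : 0 < n%:R :> R by apply: le_lt_trans nr; rewrite divr_ge0// ltW.
exists n; first by rewrite -(ltr_nat R).
move=> s t st; apply: fd.
have -> : Re (rot (expi t) (expi s)) = cos (s - t).
  have := expiD s (- t); rewrite expiN => /(congr1 (fun z : C => Re z)) /= <-.
  by [].
have : `|cos 0 - cos (s - t)| < d.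
  apply: rd; rewrite /ball_ /= sub0r normrN (le_lt_trans st)//.
  by rewrite ltr_pdivrMr// mulrC -ltr_pdivrMr.
by rewrite cos0 ltr_norml => /andP[].
Qed.

End compactness.

Section helly.
Context {R : realType}.
Local Notation C := R[i].
Local Notation T := (circle R).

Lemma cvg_bigsum (V : numFieldType) I (F : set_system I) {FF : Filter F} (J : Type) (r : seq J)
    (u : J -> I -> V) (l : J -> V) :
  (forall j, u j i @[i --> F] --> l j) ->
  \sum_(j <- r) u j i @[i --> F] --> \sum_(j <- r) l j.
Proof.
move=> ul; elim: r => [|j r IH].
  by rewrite big_nil; under eq_fun do rewrite big_nil; exact: cvg_cst.
by rewrite big_cons; under eq_fun do rewrite big_cons; exact: cvgD.
Qed.

(* The limit is the push-forward by [expi] of the Lebesgue-Stieltjes measure of  *)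
(* the limit along [U] of the distribution functions of [arg], made right        *)
(* continuous; the increments of that limit control the error of step sums.      *)
Lemma helly (U : set_system nat) {UU : UltraFilter U}
    (m_ : nat -> {finite_measure set T -> \bar R}) (M : R) :
  (forall n, mass (m_ n) <= M) -> exists m : {finite_measure set T -> \bar R},
  forall f : T -> R, continuous f -> \int[m_ n]_z f z @[n --> U] --> \int[m]_z f z.
Proof.
move=> mM.
have M0 : 0 <= M by exact: le_trans (mass_ge0 _) (mM 0%N).
have mA t : measurable [set z : T | arg z <= t].
  rewrite (_ : [set z | _] = setT `&` (@arg R) @^-1` `]-oo, t]%classic).
    exact: measurable_arg.
  by apply/seteqP; split => x /=; rewrite in_itv/= ?andbT // => -[].
pose G n t := fine (m_ n [set z : T | arg z <= t]).
have Gmon n : {homo G n : s t / s <= t}.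
  move=> s t st; apply: fine_le; rewrite ?fin_num_measure//.
  by apply: le_measure; rewrite ?inE// => z /= /le_trans; apply.
have G0 n t : t <= - pi -> G n t = 0.
  move=> tpi; rewrite /G (_ : [set z | _] = set0) ?measure0//.
  apply/seteqP; split => // z /=; have /andP[za _] := arg_bounds z.
  by rewrite leNgt (le_lt_trans tpi za).
have Gtot n t : pi <= t -> G n t = mass (m_ n).
  move=> tpi; rewrite /G /mass (_ : [set z | _] = setT)//.
  by apply/seteqP; split => // z _ /=; have /andP[_ /le_trans] := arg_bounds z; apply.
have Gge0 n t : 0 <= G n t by exact: fine_ge0.
have GM n t : `|G n t| <= M.
  rewrite ger0_norm//; apply: le_trans (mM n).
  rewrite -(Gtot n (Num.max pi t)) ?le_max ?lexx//; apply: Gmon.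
  by rewrite le_max lexx orbT.
have /choice[GU GUl] : forall t, exists l : R, G n t @[n --> U] --> l.
  by move=> t; exact: ultra_cvg_bounded (GM^~ t).
(* The interval []-4, 4]] contains [[- pi, pi]] in its interior, so the limit distribution function
   and its right-continuous version are constant near its endpoints. *)
have pi4 : pi < 4 :> R by have := @pihalf_lt2 R; lra.
have pi0 := pi_gt0 R.
have GUmon : nondecreasing GU.
  move=> s t st; apply: ler_cvg_to (GUl s) (GUl t) _.
  by apply: nearW => n; exact: Gmon.
have GUuniq t l : G n t @[n --> U] --> l -> GU t = l by exact: cvg_unique (GUl t).
have GU0 t : t <= - pi -> GU t = 0.
  move=> tpi; apply: GUuniq; under eq_fun do rewrite G0//.
  exact: cvg_cst.
have [F [GF FG]] := cumulative_above GUmon.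
have F4 : F (- 4) = 0.
  apply/eqP; rewrite eq_le; apply/andP; split.
    by rewrite -(GU0 (- pi) (lexx _)); apply: FG; lra.
  by rewrite -(GU0 (- 4)) ?GF//; lra.
have F4' : F 4 = GU 4.
  apply/eqP; rewrite eq_le GF andbT -(_ : GU 5 = GU 4); first by apply: FG; lra.
  apply: GUuniq; rewrite (_ : (fun n => G n 5) = (fun n => G n 4)); first exact: GUl.
  by apply: funext => n; rewrite !Gtot//; lra.
have GU4 : GU 4 <= M.
  apply: (cvgr_to_le (GUl 4)); apply: nearW => n.
  by rewrite (le_trans (ler_norm _)).
pose lam : {measure set (measurableTypeR R) -> \bar R} := lebesgue_stieltjes_measure F.
have lamE a b : a <= b -> lam `]a, b]%classic = (F b - F a)%:E by exact: stieltjes_itv.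
pose D : set (measurableTypeR R) := `](-4), 4]%classic.
have mD : measurable D by exact: measurable_itv.
have lamD : (lam D < +oo)%E by rewrite lamE ?ltry//; lra.
pose r : {finite_measure set (measurableTypeR R) -> \bar R} := mfrestr mD lamD.
have rE A : r A = lam (A `&` D) by [].
have rT : fine (r setT) = F 4.
  by rewrite rE setTI lamE ?F4 ?subr0//; lra.
pose ex := @expi R : measurableTypeR R -> T.
have [m mE] : exists m : {finite_measure set T -> \bar R},
    m = pushforward r ex :> (set T -> \bar R).
  apply: (@finite_measure_of R _ T
    (@measure_function_pushforward__canonical__measure_function_Measure
       _ _ _ _ _ r ex (@measurable_expi R))).
  by rewrite /= /pushforward preimage_setT ltey_eq fin_num_measure.
exists m => f cf.
have [B B0 fB] := continuous_circle_bounded cf.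
have mf := continuous_circle_measurable cf.
have intm : \int[m]_z f z = \int[r]_t f (expi t).
  have -> : \int[m]_z f z = fine (\int[pushforward r ex]_z (f z)%:E)%E by rewrite -mE.
  rewrite integral_pushforward ?preimage_setT//.
  - exact: measurable_expi.
  - exact/measurable_EFinP.
  apply: measurable_bounded_integrable => //.
  - by rewrite ltey_eq fin_num_measure.
  - by apply: measurableT_comp => //; exact: measurable_expi.
  - exists B; split; first exact: num_real.
    by move=> x Bx y _ /=; exact: le_trans (fB _) (ltW Bx).
apply/cvgrPdist_lt => e e0.
(* Three errors of size at most [w M] are added below: two step sums and the exchange of [F] and
   [GU]. What is left of [e] serves the convergence of the step sums. *)
pose w := e / (5 * (M + 1)).
have w0 : 0 < w by rewrite divr_gt0// mulr_gt0// ltr_wpDl.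
have wM : 5 * (w * M) < e.
  have : 5 * (w * (M + 1)) = e by rewrite /w; field; rewrite gt_eqF// ltr_wpDl.
  nra.
have [N N0 fN] := expi_arg_partition cf w0.
have NR0 : 0 < N%:R :> R by rewrite ltr0n.
pose t j : R := - 4 + 8 * j%:R / N%:R.
pose c j : R := f (expi (t j)).
have t0 : t 0%N = - 4 by rewrite /t mulr0 mul0r addr0.
have tN : t N = 4 by rewrite /t mulfK ?gt_eqF//; lra.
have tS j : t j.+1 - t j = 8 / N%:R by rewrite /t -natr1; field; rewrite gt_eqF.
have tmon : {homo t : i j / (i <= j)%N >-> i <= j}.
  by move=> i j ij; rewrite /t lerD2l ler_pM2r ?invr_gt0// ler_pM2l// ler_nat.
have tlt j : t j < t j.+1 by rewrite -subr_gt0 tS divr_gt0.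
have tclose x k : t k < x <= t k.+1 -> `|x - t k.+1| <= 8 / N%:R.
  by move=> /andP[kx xk]; have := tS k; rewrite distrC ger0_norm ?subr_ge0//; lra.
have stepm n : `|\int[m_ n]_z f z - (c N * mass (m_ n) +
      \sum_(j < N) (c j - c j.+1) * G n (t j))| <= w * M.
  apply: le_trans (ler_wpM2l (ltW w0) (mM n)).
  apply: Rintegral_step (ltW w0) measurable_arg mf fB tmon _ _.
    rewrite (_ : [set x | _] = set0) ?measure0//; apply/seteqP; split => // z /=; apply.
    by have /andP[? ?] := arg_bounds z; rewrite t0 tN; apply/andP; split; lra.
  move=> z k kN /tclose zk; rewrite -{1}[z]argK; apply: ltW; exact: fN.
have stepr : `|\int[m]_z f z - (c N * F 4 +
      \sum_(j < N) (c j - c j.+1) * F (t j))| <= w * M.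
  rewrite intm; have := @Rintegral_step R _ (measurableTypeR R) r id
    (fun t => f (expi t)) c t w B N (ltW w0).
  rewrite rT => H; apply: (le_trans _ (ler_wpM2l (ltW w0) GU4)); rewrite -F4'.
  rewrite [X in _ - (_ + X)](_ : _ = \sum_(j < N) (c j - c j.+1) * fine (r [set x | x <= t j])).
    apply: H => //.
    - by apply: measurableT_comp => //; exact: measurable_expi.
    - rewrite (_ : [set x | _] = ~` D).
        by rewrite rE setICl measure0.
      by apply/seteqP; split => z /=; rewrite /D /= in_itv /= t0 tN.
    - by move=> x k kN /tclose zk; apply: ltW; exact: fN.
  apply: eq_bigr => j _; congr (_ * _).
  have tj4 : t j <= 4 by rewrite -tN; apply: tmon; exact: ltnW.
  have tj4' : - 4 <= t j by rewrite -t0; apply: tmon.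
  rewrite rE (_ : _ `&` D = `](-4), (t j)]%classic) ?lamE ?F4 ?subr0//.
  apply/seteqP; split => z; rewrite /D /= !in_itv /=.
    by move=> [zt /andP[z4 _]]; apply/andP; split.
  by move=> /andP[z4 zt]; split => //; rewrite z4 (le_trans zt).
have c1 j : `|c j - c j.+1| <= w.
  by apply: ltW; apply: fN; rewrite distrC tS ger0_norm// divr_ge0.
(* At a grid point [F] exceeds [GU] by at most the next increment of [GU], and these increments
   telescope; so [F] and [GU] need not agree on the grid. *)
have FGU : `|\sum_(j < N) (c j - c j.+1) * (F (t j) - GU (t j))| <= w * M.
  apply: le_trans (ler_norm_sum _ _ _) _.
  apply: (@le_trans _ _ (\sum_(j < N) w * (GU (t j.+1) - GU (t j)))).
    apply: ler_sum => j _; rewrite normrM [X in _ * X]ger0_norm ?subr_ge0//.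
    by apply: ler_pM => //; rewrite ?subr_ge0// lerD2r FG.
  rewrite -mulr_sumr (_ : \sum_(j < N) _ = GU (t N) - GU (t 0%N)); last first.
    by rewrite -(telescope_sumr (fun j => GU (t j)) (leq0n N)) big_mkord.
  by rewrite t0 tN (GU0 (-4)) ?subr0 ?ler_wpM2l// ?(ltW w0)//; lra.
have Lcvg : c N * mass (m_ n) + \sum_(j < N) (c j - c j.+1) * G n (t j) @[n --> U] -->
    c N * GU 4 + \sum_(j < N) (c j - c j.+1) * GU (t j).
  apply: cvgD.
    apply: cvgMl_tmp; rewrite (_ : (fun n => mass (m_ n)) = (fun n => G n 4)); first exact: GUl.
    by apply: funext => n; rewrite Gtot// ltW.
  by apply: cvg_bigsum => j; apply: cvgMl_tmp; exact: GUl.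
have e5 : 0 < e - 3 * (w * M) by rewrite subr_gt0; nra.
have LE : c N * F 4 + \sum_(j < N) (c j - c j.+1) * F (t j) =
    c N * GU 4 + \sum_(j < N) (c j - c j.+1) * GU (t j) +
    \sum_(j < N) (c j - c j.+1) * (F (t j) - GU (t j)).
  by rewrite F4' -addrA -big_split /=; congr (_ + _); apply: eq_bigr => j _; ring.
move/cvgrPdist_lt/(_ _ e5): Lcvg; apply: filterS => n.
move: (stepm n) stepr FGU; rewrite LE !ler_norml !ltr_norml.
move=> /andP[? ?] /andP[? ?] /andP[? ?] /andP[? ?].
by apply/andP; split; lra.
Qed.

End helly.

(** * Uniform limits of polynomials and local inverses *)

Section polynomial_approximation.
Context {R : realType}.
Local Notation C := R[i].
Implicit Types (f g : C -> C) (r s : R).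

(* On discs, functions analytic on the open disc and continuous on the closed  *)
(* one are handled through this uniform closure of the polynomials.            *)
Definition polyapprox r f := forall e : R, 0 < e ->
  exists P : {poly C}, forall z, cabs z <= r -> cabs (f z - P.[z]) <= e.

Lemma polyapprox_ext r f g : (forall z, cabs z <= r -> f z = g z) ->
  polyapprox r f -> polyapprox r g.
Proof.
by move=> fg pf e /pf[P Pe]; exists P => z zr; rewrite -fg//; exact: Pe.
Qed.

Lemma polyapprox_uniform r f : (forall e : R, 0 < e -> exists2 g, polyapprox r g &
  forall z, cabs z <= r -> cabs (f z - g z) <= e) -> polyapprox r f.
Proof.
move=> h e e0; have e2 : 0 < e / 2 by rewrite divr_gt0.
have [g /(_ _ e2)[P Pg] fg] := h _ e2; exists P => z zr.
rewrite (le_trans (cabs_tri (g z) _ _))// (splitr e).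
by apply: lerD; [exact: fg|exact: Pg].
Qed.

Lemma polyapprox_poly r (P : {poly C}) : polyapprox r (fun z => P.[z]).
Proof. by move=> e e0; exists P => z _; rewrite subrr cabs0 ltW. Qed.

Lemma polyapprox_cst r (c : C) : polyapprox r (fun=> c).
Proof. by apply: (polyapprox_ext _ (@polyapprox_poly r c%:P)) => z _; rewrite hornerC. Qed.

Lemma polyapprox_id r : polyapprox r id.
Proof. by apply: (polyapprox_ext _ (@polyapprox_poly r (polyX _))) => z _; rewrite hornerX. Qed.

Lemma poly_bounded r (P : {poly C}) : exists2 M : R, 0 < M &
  forall z, cabs z <= r -> cabs P.[z] <= M.
Proof.
elim/poly_ind: P => [|P c [M M0 PM]].
  by exists 1 => // z _; rewrite horner0 cabs0.
exists (M * `|r| + cabs c + 1) => [|z zr].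
  by rewrite ltr_wpDl// addr_ge0 ?cabs_ge0// mulr_ge0// ltW.
rewrite hornerMXaddC (le_trans (cabsD _ _))// (@le_trans _ _ (M * `|r| + cabs c)) ?lerDl//.
rewrite lerD2r cabsM; apply: ler_pM; rewrite ?cabs_ge0//; first exact: PM.
exact: le_trans zr (ler_norm _).
Qed.

Lemma polyapprox_bounded r f : polyapprox r f -> exists2 M : R, 0 < M &
  forall z, cabs z <= r -> cabs (f z) <= M.
Proof.
move=> /(_ _ ltr01)[P fP]; have [M M0 PM] := poly_bounded r P.
exists (1 + M) => [|z zr]; first by rewrite addr_gt0.
rewrite -[f z](subrK P.[z]) (le_trans (cabsD _ _))//.
by apply: lerD; [exact: fP|exact: PM].
Qed.

Lemma polyapproxD r f g : polyapprox r f -> polyapprox r g ->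
  polyapprox r (fun z => f z + g z).
Proof.
move=> pf pg e e0; have e2 : 0 < e / 2 by rewrite divr_gt0.
have [[P fP] [Q gQ]] := (pf _ e2, pg _ e2); exists (P + Q) => z zr.
rewrite hornerD opprD addrACA (le_trans (cabsD _ _))// (splitr e).
by apply: lerD; [exact: fP|exact: gQ].
Qed.

Lemma polyapproxM r f g : polyapprox r f -> polyapprox r g ->
  polyapprox r (fun z => f z * g z).
Proof.
move=> pf pg e e0.
have [A A0 fA] := polyapprox_bounded pf; have [B B0 gB] := polyapprox_bounded pg.
pose t : R := Num.min 1 (e / (1 + A + B)).
have s0 : 0 < 1 + A + B by rewrite !addr_gt0.
have t0 : 0 < t by rewrite lt_min ltr01 divr_gt0.
have t1 : t <= 1 by rewrite ge_min lexx.
have te : t * (1 + A + B) <= e by rewrite -ler_pdivlMr// ge_min lexx orbT.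
have [[P fP] [Q gQ]] := (pf _ t0, pg _ t0); exists (P * Q) => z zr.
have -> : f z * g z - (P * Q).[z] = (f z - P.[z]) * g z + P.[z] * (g z - Q.[z]).
  by rewrite hornerM; ring.
rewrite (le_trans (cabsD _ _))// !cabsM.
have PA : cabs P.[z] <= t + A.
  rewrite -[P.[z]](subrK (f z)) (le_trans (cabsD _ _))// cabsC.
  by apply: lerD; [exact: fP|exact: fA].
have h1 : cabs (f z - P.[z]) * cabs (g z) <= t * B.
  by apply: ler_pM; rewrite ?cabs_ge0 ?fP ?gB.
have h2 : cabs P.[z] * cabs (g z - Q.[z]) <= (t + A) * t.
  by apply: ler_pM; rewrite ?cabs_ge0 ?gQ.
nra.
Qed.

Lemma polyapproxZ r (c : C) f : polyapprox r f -> polyapprox r (fun z => c * f z).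
Proof. by move=> pf; apply: polyapproxM => //; exact: polyapprox_cst. Qed.

Lemma polyapproxB r f g : polyapprox r f -> polyapprox r g ->
  polyapprox r (fun z => f z - g z).
Proof.
move=> pf /(polyapproxZ (-1)) pg; apply: polyapprox_ext (polyapproxD pf pg) => z _.
by rewrite mulN1r.
Qed.

Lemma polyapprox_horner r f (P : {poly C}) : polyapprox r f ->
  polyapprox r (fun z => P.[f z]).
Proof.
move=> pf; elim/poly_ind: P => [|P c IH].
  by apply: polyapprox_ext (polyapprox_cst r 0) => z _; rewrite horner0.
apply: polyapprox_ext (polyapproxD (polyapproxM IH pf) (polyapprox_cst r c)) => z _.
by rewrite hornerMXaddC.
Qed.

Lemma polyapprox_comp r s f g : polyapprox s g -> polyapprox r f ->
  (forall z, cabs z <= r -> cabs (f z) <= s) -> polyapprox r (fun z => g (f z)).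
Proof.
move=> pg pf fs; apply: polyapprox_uniform => e /pg[P gP].
exists (fun z => P.[f z]); first exact: polyapprox_horner.
by move=> z /fs; exact: gP.
Qed.

Lemma polyapprox_prod (I : Type) (l : seq I) r (f : I -> C -> C) :
  (forall i, polyapprox r (f i)) -> polyapprox r (fun z => \prod_(i <- l) f i z).
Proof.
move=> pf; elim: l => [|i l IH].
  by apply: polyapprox_ext (polyapprox_cst r 1) => z _; rewrite big_nil.
by apply: polyapprox_ext (polyapproxM (pf i) IH) => z _; rewrite big_cons.
Qed.

Lemma expr_small (q e : R) : 0 <= q < 1 -> 0 < e -> exists N, q ^+ N <= e.
Proof.
move=> /andP[q0 q1] e0; have : `|q| < 1 by rewrite ger0_norm.
move=> /cvg_expr/cvgrPdist_lt/(_ _ e0)[N _ /(_ N (leqnn N))].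
by rewrite sub0r normrN ger0_norm ?exprn_ge0// => /ltW; exists N.
Qed.

(** The geometric series in [1 - f] converges uniformly, with ratio [1 / 2]. *)
Lemma polyapproxV r f : polyapprox r f ->
  (forall z, cabs z <= r -> cabs (1 - f z) <= 1 / 2) -> polyapprox r (fun z => (f z)^-1).
Proof.
move=> pf f1; apply: polyapprox_uniform => e e0.
have e2 : 0 < e / 2 by rewrite divr_gt0.
have h2 : 0 <= (1 / 2 : R) < 1 by apply/andP; split; lra.
have [N NE] := expr_small h2 e2.
exists (fun z => \sum_(i < N) (1 - f z) ^+ i).
  have pq := polyapproxB (polyapprox_cst r 1) pf.
  apply: polyapprox_ext (polyapprox_horner (\sum_(i < N) 'X^i) pq) => z _.
  by rewrite horner_sum; apply: eq_bigr => i _; rewrite hornerXn.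
move=> z zr; have fz := f1 _ zr; set q := 1 - f z in fz *.
have fq : f z = 1 - q by rewrite /q; ring.
have fl : 1 / 2 <= cabs (f z).
  by rewrite fq; have := cabs_lower 1 q; rewrite cabs1; lra.
have f0 : f z != 0 by rewrite -cabs_gt0; lra.
have -> : (f z)^-1 - \sum_(i < N) q ^+ i = q ^+ N / f z.
  apply: (mulfI f0); rewrite mulrBr divff// mulrCA divff// mulr1 fq.
  by have := subrX1 q N; rewrite -[1 - q]opprB mulNr => <-; ring.
rewrite cabsM cabsV cabsX ler_pdivrMr; last lra.
have : cabs q ^+ N <= e / 2.
  by apply: le_trans NE; apply: lerXn2r => //; rewrite nnegrE ?cabs_ge0//; lra.
nra.
Qed.

(** Cauchy's estimate by a discrete mean: summing over the [K]-th roots of unity, with [K] above the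
    size of [P], isolates one coefficient exactly. The exponent [K - j] stands for [- j] modulo
    [K]. *)
Lemma cauchy_coef (P : {poly C}) (r M : R) j : 0 <= r ->
  (forall z, cabs z <= r -> cabs P.[z] <= M) -> cabs P`_j * r ^+ j <= M.
Proof.
move=> r0 PM; pose K := (size P + j).+1; have K0 : (0 < K)%N by [].
pose w : C := unity_root K; have wK : w ^+ K = 1 by exact: unity_rootX.
have cw : cabs w = 1 by exact: cabs_circle.
have key : \sum_(i < K) P.[r%:C * w ^+ i] * w ^+ ((K - j) * i) = K%:R * (P`_j * r%:C ^+ j).
  transitivity (\sum_(i < K) \sum_(l < K) P`_l * r%:C ^+ l * w ^+ ((l + (K - j)) * i)).
    apply: eq_bigr => i _; rewrite (@horner_coef_wide _ K); last by rewrite /K; lia.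
    rewrite mulr_suml; apply: eq_bigr => l _.
    by rewrite exprMn -!exprM mulnDl exprD [(i * l)%N]mulnC; ring.
  rewrite exchange_big /=.
  have jK : (j < K)%N by rewrite /K; lia.
  rewrite (bigD1 (Ordinal jK)) //= [X in _ + X]big1 ?addr0 => [|l lj].
    rewrite (eq_bigr (fun=> P`_j * r%:C ^+ j)) => [|i _]; last first.
      by rewrite subnKC ?(ltnW jK)// exprM wK expr1n mulr1.
    by rewrite sumr_const card_ord mulr_natl.
  rewrite -mulr_sumr; have lj' : (l : nat) != j by apply: contraNneq lj => lj; apply/eqP/val_inj.
  have lK := ltn_ord l.
  have [l_j|j_l] := ltnP l j.
    rewrite sum_unity_root ?mulr0//; apply/andP; split; lia.
  rewrite (eq_bigr (fun i : 'I_K => w ^+ ((l - j) * i))) => [|i _].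
    rewrite sum_unity_root ?mulr0//; apply/andP; split; lia.
  have -> : (l + (K - j) = (l - j) + K)%N by lia.
  by rewrite mulnDl exprD [w ^+ (K * i)]exprM wK expr1n mulr1.
have KR : 0 < K%:R :> R by rewrite ltr0n.
rewrite -(@ler_pM2l _ K%:R)//.
have -> : K%:R * (cabs P`_j * r ^+ j) = cabs (K%:R * (P`_j * r%:C ^+ j)).
  rewrite !cabsM cabsX cabsR (ger0_norm r0); congr (_ * _).
  by rewrite (_ : K%:R = (K%:R : R)%:C) ?cabsR ?ger0_norm// rmorph_nat.
rewrite -key (le_trans (cabs_sum _ _ _))//.
apply: (@le_trans _ _ (\sum_(i < K) M)); last by rewrite sumr_const card_ord mulr_natl.
apply: ler_sum => i _; rewrite cabsM !cabsX cw expr1n mulr1; apply: PM.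
by rewrite cabsM cabsX cw expr1n mulr1 cabsR ger0_norm.
Qed.

Lemma geometric_tail (q : R) N K : 0 <= q < 1 ->
  \sum_(i < K) (if (i < N)%N then 0 else q ^+ i) <= q ^+ N / (1 - q).
Proof.
move=> /andP[q0 q1]; have q1' : 0 < 1 - q by lra.
suff : \sum_(i < K) (if (i < N)%N then 0 else q ^+ i) <= (q ^+ N - q ^+ (maxn N K)) / (1 - q).
  move=> /le_trans; apply; rewrite ler_pM2r ?invr_gt0// lerBlDr lerDl.
  exact: exprn_ge0.
elim: K => [|K IH]; first by rewrite big_ord0 maxn0 subrr mul0r.
rewrite big_ord_recr /=; case: ltnP => NK.
  by rewrite addr0 (le_trans IH)// (maxn_idPl (ltnW NK)) (maxn_idPl NK).
rewrite (le_trans (lerD IH (lexx _)))// (maxn_idPr NK) (maxn_idPr (leqW NK)).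
rewrite exprS; move: (q ^+ N) (q ^+ K) => a b.
by rewrite le_eqVlt; apply/orP; left; apply/eqP; field; rewrite gt_eqF.
Qed.

(** The identity theorem. For a polynomial close to [f], Cauchy's estimate on the small disc where
    [f] vanishes makes the first [N] coefficients small; on the large disc it bounds the others,
    which contribute at [z] a geometric tail of ratio [|z| / r]. *)
Lemma polyapprox_eq0 r f : polyapprox r f -> (\forall z \near (0 : C), f z = 0) ->
  forall z, cabs z < r -> f z = 0.
Proof.
move=> pf /nbhs0_cabsP[d0 d00 fd0] z zr.
have r0 : 0 < r by exact: le_lt_trans (cabs_ge0 z) zr.
pose d := Num.min (d0 / 2) r.
have dd0 : d < d0 by rewrite gt_min ltr_pdivrMr// ltr_pMr// ltr1n.
have d_gt0 : 0 < d by rewrite lt_min divr_gt0.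
have fd u : cabs u <= d -> f u = 0 by move=> ud; apply: fd0; exact: le_lt_trans ud dd0.
have dr : d <= r by rewrite ge_min lexx orbT.
have [M M0 fM] := polyapprox_bounded pf.
apply/eqP; rewrite -cabs_eq0 eq_le cabs_ge0 andbT; apply/ler_addgt0Pr => e e0; rewrite add0r.
set q := cabs z / r; have q01 : 0 <= q < 1.
  by rewrite divr_ge0 ?cabs_ge0 ?(ltW r0)//= ltr_pdivrMr// mul1r.
have q1 : 0 < 1 - q by lra.
have [N NE] : exists N, q ^+ N <= e * (1 - q) / (3 * (M + 1)).
  by apply: expr_small => //; rewrite divr_gt0// mulr_gt0// ?addr_gt0.
set A := \sum_(i < N) (cabs z / d) ^+ i.
have A0 : 0 <= A by apply: sumr_ge0 => i _; rewrite exprn_ge0// divr_ge0 ?cabs_ge0// ltW.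
(* The precision is chosen after [N], because [A] depends on [N]. *)
pose t := Num.min 1 (e / (3 * (A + 1))).
have t0 : 0 < t by rewrite lt_min ltr01 divr_gt0// mulr_gt0// ltr_wpDl.
have t1 : t <= 1 by rewrite ge_min lexx.
have tA : 3 * (t * (A + 1)) <= e.
  by rewrite mulrCA -ler_pdivlMr ?mulr_gt0 ?ltr_wpDl// ge_min lexx orbT.
have [P fP] := pf _ t0.
have P1 u : cabs u <= d -> cabs P.[u] <= t.
  by move=> ud; have := fP u (le_trans ud dr); rewrite fd// sub0r cabsN.
have P2 u : cabs u <= r -> cabs P.[u] <= M + 1.
  move=> ur; rewrite -[P.[u]](subrK (f u)) (le_trans (cabsD _ _))// cabsC addrC.
  by apply: lerD; [exact: fM|exact: le_trans (fP _ ur) t1].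
have Pz : cabs P.[z] <= t * A + (M + 1) * (q ^+ N / (1 - q)).
  rewrite (@horner_coef_wide _ (N + size P)%N) ?leq_addl//.
  apply: le_trans (cabs_sum _ _ _) _.
  apply: (@le_trans _ _ (\sum_(i < N + size P)
     (t * (if (i < N)%N then (cabs z / d) ^+ i else 0) +
      (M + 1) * (if (i < N)%N then 0 else q ^+ i)))).
    apply: ler_sum => i _; rewrite cabsM cabsX; case: ltnP => _.
      rewrite mulr0 addr0 expr_div_n mulrA ler_pdivlMr ?exprn_gt0// mulrAC.
      by rewrite ler_wpM2r ?exprn_ge0 ?cabs_ge0// cauchy_coef// ltW.
    rewrite mulr0 add0r expr_div_n mulrA ler_pdivlMr ?exprn_gt0// mulrAC.
    by rewrite ler_wpM2r ?exprn_ge0 ?cabs_ge0// cauchy_coef// ltW.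
  rewrite big_split /= -!mulr_sumr lerD//.
    rewrite ler_wpM2l ?(ltW t0)// big_split_ord /= [X in _ + X]big1 => [|i _]; last first.
      by rewrite ltnNge leq_addr.
    by rewrite addr0 /A le_eqVlt; apply/orP; left; apply/eqP; apply: eq_bigr => i _; rewrite ltn_ord.
  by rewrite ler_wpM2l ?geometric_tail//; lra.
have qN : (M + 1) * (q ^+ N / (1 - q)) <= e / 3.
  rewrite mulrA ler_pdivrMr// mulrC -ler_pdivlMr ?addr_gt0//.
  apply: le_trans NE _; rewrite le_eqVlt; apply/orP; left; apply/eqP.
  by field; rewrite gt_eqF// addr_gt0.
rewrite -[f z](subrK P.[z]) (le_trans (cabsD _ _))//.
have := fP z (ltW zr).
lra.
Qed.

End polynomial_approximation.

Section local_inverse.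
Context {R : realType}.
Local Notation C := R[i].
Implicit Types (F G k : C -> C) (r s : R) (a z : C).

(** [F] is [u |-> a u] up to a Lipschitz perturbation of constant [|a| / 2]: a quantitative
    hypothesis for the inverse function theorem on a disc of explicit radius. *)
Definition strict_on F a s := forall u v, cabs u <= s -> cabs v <= s ->
  cabs (F u - F v - a * (u - v)) <= cabs a / 2 * cabs (u - v).

(* The inverse on the closed disc of radius [s], 0 outside the image. *)
Definition discinv F s z : C := xget 0 [set u | cabs u <= s /\ F u = z].

Lemma strict_onW F a s r : r <= s -> strict_on F a s -> strict_on F a r.
Proof. by move=> rs Fa u v ur vr; apply: Fa; exact: le_trans rs. Qed.

(** The increment error splits as [(u - v) (k(u) - a) + v (k(u) - k(v))]; each piece is at most
    [L s |u - v|], a quarter of [|a| |u - v|]. *)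
Lemma strict_on_mul k L s a : 0 <= L ->
  (forall u v, cabs u <= s -> cabs v <= s -> cabs (k u - k v) <= L * cabs (u - v)) ->
  k 0 = a -> 4 * (L * s) <= cabs a -> strict_on (fun u => u * k u) a s.
Proof.
move=> L0 kL k0 Ls u v us vs.
have s0 : 0 <= s by exact: le_trans (cabs_ge0 u) us.
have -> : u * k u - v * k v - a * (u - v) = (u - v) * (k u - a) + v * (k u - k v) by ring.
rewrite (le_trans (cabsD _ _))// !cabsM.
have h1 : cabs (k u - a) <= L * s.
  rewrite -k0 (le_trans (kL _ _ us _))// ?cabs0// subr0.
  by rewrite ler_wpM2l.
have h2 : cabs v * cabs (k u - k v) <= s * (L * cabs (u - v)).
  by apply: ler_pM; rewrite ?cabs_ge0// kL.
have := cabs_ge0 (u - v); nra.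
Qed.

Section strict.
Variables (F : C -> C) (a : C) (s : R).
Hypotheses (a0 : a != 0) (s0 : 0 < s) (Fa : strict_on F a s) (F0 : F 0 = 0).

Let ca0 : 0 < cabs a. Proof. by rewrite cabs_gt0. Qed.

Lemma strict_on_lower u v : cabs u <= s -> cabs v <= s ->
  cabs a / 2 * cabs (u - v) <= cabs (F u - F v).
Proof.
move=> us vs; have := Fa us vs; have := cabs_lower (a * (u - v)) (F u - F v).
by rewrite [cabs (a * (u - v) - _)]cabsC cabsM; lra.
Qed.

Lemma strict_on_inj u v : cabs u <= s -> cabs v <= s -> F u = F v -> u = v.
Proof.
move=> us vs uv; have := strict_on_lower us vs; rewrite uv subrr cabs0 => h.
apply/eqP; rewrite -subr_eq0 -cabs_eq0 eq_le cabs_ge0 andbT.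
by have := ca0; have := cabs_ge0 (u - v); nra.
Qed.

(** Newton's iteration with the slope frozen at [a]; [strict_on] makes it contract by [1 / 2]. *)
Let newton z u := u + (z - F u) / a.

Let newton_half z u v : cabs u <= s -> cabs v <= s ->
  cabs (newton z u - newton z v) <= cabs (u - v) / 2.
Proof.
move=> us vs.
have -> : newton z u - newton z v = - (F u - F v - a * (u - v)) / a.
  by rewrite /newton; field.
rewrite cabsM cabsN cabsV ler_pdivrMr//; have := Fa us vs; lra.
Qed.

Let newton_disc z u : cabs z <= cabs a * s / 2 -> cabs u <= s -> cabs (newton z u) <= s.
Proof.
move=> zs us; have z0 : cabs (0 : C) <= s by rewrite cabs0 ltW.
have := newton_half z us z0; rewrite {2}/newton F0 !subr0 add0r => h.
have za : cabs (z / a) <= s / 2.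
  by rewrite cabsM cabsV ler_pdivrMr// (le_trans zs)//; nra.
have := cabsD (newton z u - z / a) (z / a); rewrite subrK; lra.
Qed.

Let newton_iter z n := iter n (newton z) 0.

Let newton_iter_disc z n : cabs z <= cabs a * s / 2 -> cabs (newton_iter z n) <= s.
Proof.
move=> zs; elim: n => [|n IH]; first by rewrite /newton_iter /= cabs0 ltW.
by rewrite /newton_iter iterS; exact: newton_disc.
Qed.

Lemma discinv_spec z : cabs z <= cabs a * s / 2 ->
  cabs (discinv F s z) <= s /\ F (discinv F s z) = z.
Proof.
move=> zs; suff [u [us Fu]] : exists u, cabs u <= s /\ F u = z.
  by rewrite /discinv; case: xgetP => [w -> //|/(_ u)]; case.
have step n : cabs (newton_iter z n.+1 - newton_iter z n) <= s / 2 ^+ n.+1.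
  elim: n => [|n IH].
    rewrite /newton_iter /= /newton F0 !subr0 add0r expr1.
    by rewrite cabsM cabsV ler_pdivrMr// (le_trans zs)//; nra.
  have := newton_half z (newton_iter_disc n.+1 zs) (newton_iter_disc n zs).
  move=> /le_trans; apply; rewrite (exprS _ n.+1) invfM mulrCA.
  by rewrite [leRHS]mulrC ler_pM2r.
have cauchy n m : cabs (newton_iter z (n + m) - newton_iter z n) <= s / 2 ^+ n.
  suff : cabs (newton_iter z (n + m) - newton_iter z n) <= s / 2 ^+ n - s / 2 ^+ (n + m).
    by move=> /le_trans; apply; rewrite lerBlDr lerDl divr_ge0 ?exprn_ge0// ltW.
  elim: m => [|m IH]; first by rewrite addn0 !subrr cabs0.
  rewrite (le_trans (cabs_tri (newton_iter z (n + m)) _ _))//.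
  have := step (n + m)%N; rewrite addnS => h; apply: le_trans (lerD h IH) _.
  have -> : s / 2 ^+ (n + m) = 2 * (s / 2 ^+ (n + m).+1).
    by rewrite exprS; field; rewrite expf_neq0.
  lra.
(* Boundedness alone gives a limit of the iterates along an ultrafilter; [cauchy] then supplies the
   rate. *)
have [U [UU sU]] := ultraFilterLemma (eventually_filter : ProperFilter (@eventually)).
have bR n : `|Re (newton_iter z n)| <= s.
  by rewrite (le_trans (cabs_Re _))// newton_iter_disc.
have bI n : `|Im (newton_iter z n)| <= s.
  by rewrite (le_trans (cabs_Im _))// newton_iter_disc.
have [x xl] := ultra_cvg_bounded bR; have [y yl] := ultra_cvg_bounded bI.
pose l : C := x +i* y.
have ul : newton_iter z n @[n --> U] --> l by exact: cvg_of_ReIm.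
have near_l n : cabs (l - newton_iter z n) <= s / 2 ^+ n.
  apply/ler_addgt0Pr => e e0.
  have /cvg_cabsP/(_ _ e0) lU := ul.
  have nU : U [set m | (n <= m)%N] by apply: sU; exists n.
  have [m [nm lm]] := filter_ex (filterI nU lU).
  rewrite (le_trans (cabs_tri (newton_iter z m) _ _))// addrC lerD ?(ltW lm)//.
  by rewrite /= in nm; rewrite -(subnKC nm).
have ls : cabs l <= s.
  apply/ler_addgt0Pr => e e0.
  have /cvg_cabsP/(_ _ e0)/filter_ex[m lm] := ul.
  have := newton_iter_disc m zs; have := cabs_lower l (newton_iter z m).
  by move: lm => /=; lra.
exists l; split => //.
suff E : newton z l = l.
  by apply/eqP; rewrite eq_sym -subr_eq0 -[_ == 0](mulIr_eq0 _ (mulIf (invr_neq0 a0)));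
    rewrite -(inj_eq (addrI l)) addr0; apply/eqP.
apply/eqP; rewrite -subr_eq0 -cabs_eq0 eq_le cabs_ge0 andbT.
apply/ler_addgt0Pr => e e0; rewrite add0r.
have [N NE] : exists N, (1 / 2 : R) ^+ N <= e / (2 * s).
  by apply: expr_small; [apply/andP; split; lra|rewrite divr_gt0// mulr_gt0].
have sN : s / 2 ^+ N <= e / 2.
  rewrite -[2 ^+ N]invrK -exprVn invrK; move: NE; rewrite mul1r.
  rewrite ler_pdivlMr ?mulr_gt0//; lra.
have h1 := newton_half z ls (newton_iter_disc N zs).
have h2 := near_l N; have h3 := near_l N.+1.
have h4 : s / 2 ^+ N.+1 <= s / 2 ^+ N.
  by rewrite ler_pM2l// lef_pV2 ?posrE ?exprn_gt0// ler_eXn2l// ltr1n.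
have := cabs_tri (newton z (newton_iter z N)) (newton z l) l.
have -> : newton z (newton_iter z N) = newton_iter z N.+1 by [].
by rewrite [cabs (newton_iter z N.+1 - l)]cabsC; lra.
Qed.

Lemma discinvK u : cabs u <= s -> discinv F s (F u) = u.
Proof.
move=> us; rewrite /discinv; case: xgetP => [w -> [ws Fw]|/(_ u) []//].
exact: strict_on_inj.
Qed.

Lemma discinv0 : discinv F s 0 = 0.
Proof. by rewrite -{1}F0 discinvK// cabs0 ltW. Qed.

Lemma discinv_lip z w : cabs z <= cabs a * s / 2 -> cabs w <= cabs a * s / 2 ->
  cabs a / 2 * cabs (discinv F s z - discinv F s w) <= cabs (z - w).
Proof.
move=> /discinv_spec[zs Fz] /discinv_spec[ws Fw].
by have := strict_on_lower zs ws; rewrite Fz Fw.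
Qed.

Lemma discinv_bound z : cabs z <= cabs a * s / 2 -> cabs a / 2 * cabs (discinv F s z) <= cabs z.
Proof.
move=> zs; have z0 : cabs (0 : C) <= cabs a * s / 2.
  by rewrite cabs0 !mulr_ge0 ?cabs_ge0// ltW.
by have := discinv_lip zs z0; rewrite discinv0 !subr0.
Qed.

(** The Newton iterates arise from [F] by composition and arithmetic, and converge uniformly to the
    inverse with error [s / 2 ^ N]. *)
Lemma discinv_polyapprox : polyapprox s F -> polyapprox (cabs a * s / 2) (discinv F s).
Proof.
move=> pF; set r := cabs a * s / 2.
have pN n : polyapprox r (fun z => newton_iter z n).
  elim: n => [|n IH]; first exact: polyapprox_cst.
  apply: (polyapprox_ext _ (polyapproxD IH (polyapproxM
    (polyapproxB (@polyapprox_id _ r) (polyapprox_comp pF IH _)) (@polyapprox_cst _ r a^-1)))) => //.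
  by move=> z zr; exact: newton_iter_disc.
apply: polyapprox_uniform => e e0.
have [N NE] : exists N, (1 / 2 : R) ^+ N <= e / s.
  by apply: expr_small; [apply/andP; split; lra|rewrite divr_gt0].
exists (fun z => newton_iter z N); first exact: pN.
move=> z zr; have [gs Fg] := discinv_spec zr; set g := discinv F s z in gs Fg *.
have ng : newton z g = g by rewrite /newton Fg subrr mul0r addr0.
have : cabs (g - newton_iter z N) <= s * (1 / 2) ^+ N.
  elim: (N) => [|n IH]; first by rewrite expr0 mulr1 subr0.
  have := newton_half z gs (newton_iter_disc n zr); rewrite ng => h.
  by rewrite exprS; apply: le_trans h _; lra.
move=> /le_trans; apply; move: NE; rewrite ler_pdivlMr//; lra.
Qed.

Lemma derivable_cabsE (H : C -> C) (z : C) : derivable H z 1 ->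
  forall e : R, 0 < e -> exists2 d : R, 0 < d & forall h, cabs h < d ->
    cabs (H (h + z) - H z - derive1 H z * h) <= e * cabs h.
Proof.
move=> dH e e0.
have : (fun h : C => h^-1 *: (H (h *: (1 : C) + z) - H z)) @ 0^' --> derive1 H z.
  by rewrite derive1E; exact: dH.
move=> /cvg_cabsP/(_ _ e0)/nbhs0_cabsP[d d0 dP]; exists d => // h hd.
have [->|h0] := eqVneq h 0.
  by rewrite add0r subrr mulr0 subrr cabs0 mulr0.
have hc : 0 < cabs h by rewrite cabs_gt0.
have := dP h hd h0; rewrite (_ : h *: (1 : C) = h); last by rewrite /GRing.scale /= mulr1.
rewrite /GRing.scale /= => /ltW de.
have -> : H (h + z) - H z - derive1 H z * h =
  - ((derive1 H z - h^-1 * (H (h + z) - H z)) * h) by field.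
by rewrite cabsN cabsM ler_wpM2r ?cabs_ge0.
Qed.

Lemma discinv_derivable z : cabs z < cabs a * s / 2 -> cabs (discinv F s z) < s ->
  derivable F (discinv F s z) 1 -> derivable (discinv F s) z 1.
Proof.
move=> zs gs dF; set g := discinv F s z in gs dF.
have [_ Fg] := discinv_spec (ltW zs); rewrite -/g in Fg.
set d := derive1 F g; have dE := derivable_cabsE dF; rewrite -/d in dE.
(* The derivative at [g] is bounded below: along a small real increment [x], compare the first-order
   expansion with the lower bound [|a| x / 2] on the increment of [F]. *)
have cd : cabs a / 4 <= cabs d.
  have a4 : 0 < cabs a / 4 by rewrite divr_gt0.
  have [t t0 tF] := dE _ a4.
  pose x := Num.min (t / 2) (s - cabs g).
  have x0 : 0 < x by rewrite lt_min divr_gt0// subr_gt0.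
  have xt : x < t by rewrite gt_min; apply/orP; left; lra.
  have xs : x <= s - cabs g by rewrite ge_min lexx orbT.
  have cx : cabs x%:C = x by rewrite cabsR gtr0_norm.
  have := tF x%:C; rewrite cx => /(_ xt) h1.
  have xg : cabs (x%:C + g) <= s by rewrite (le_trans (cabsD _ _))// cx; lra.
  have := strict_on_lower xg (ltW gs); rewrite addrK cx => h2.
  have := cabs_lower (F (x%:C + g) - F g) (d * x%:C); rewrite cabsM cx => h3.
  have : x * (cabs a / 4) <= x * cabs d by lra.
  by rewrite ler_pM2l.
have d0 : 0 < cabs d by apply: lt_le_trans cd; rewrite divr_gt0.
have dn0 : d != 0 by rewrite -cabs_gt0.
suff : derivable (discinv F s) z 1 /\ derive1 (discinv F s) z = d^-1 by case.
apply: derivable_cabs => e e0.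
have e1 : 0 < e * cabs d * cabs a / 2 by rewrite divr_gt0// !mulr_gt0.
have [t t0 tF] := dE _ e1.
pose y := Num.min (t * cabs a / 2) (cabs a * s / 2 - cabs z).
exists y => [|h].
  by rewrite lt_min subr_gt0 zs andbT divr_gt0// mulr_gt0.
rewrite lt_min => /andP[h1 h2].
have hz : cabs (h + z) <= cabs a * s / 2 by rewrite (le_trans (cabsD _ _))//; lra.
have [vs Fv] := discinv_spec hz; set v := discinv F s (h + z) in vs Fv *.
have vg : cabs a / 2 * cabs (v - g) <= cabs h.
  by have := discinv_lip hz (ltW zs); rewrite addrK.
have vt : cabs (v - g) < t.
  by rewrite -(@ltr_pM2l _ (cabs a / 2)) ?divr_gt0//; lra.
have := tF _ vt; rewrite subrK Fv Fg addrK => h3.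
have -> : v - g - d^-1 * h = - ((h - d * (v - g)) / d) by field.
rewrite cabsN cabsM cabsV ler_pdivrMr//; apply: le_trans h3 _.
have := ler_wpM2l (ltW (mulr_gt0 e0 d0)) vg; lra.
Qed.

End strict.
End local_inverse.

(** * Transforms of measures on the circle *)

Section cauchy_transform.
Context {R : realType}.
Local Notation C := R[i].
Local Notation T := (circle R).
Implicit Types (m : {finite_measure set T -> \bar R}) (g : T -> C) (z w : C) (u : T).

(** A Cauchy transform with weight. The weights [1], [u], [u - 1], [1 - Re u] and [u ^ p] all occur,
    so estimates are proved once, in terms of the L1 norm [absint] of the weight. *)
Definition ctr m g z : C := cintegral m (fun u => g u / (1 - z * (u : C))).

Definition absint m g : R := \int[m]_u cabs (g u).

Lemma absint_ge0 m g : 0 <= absint m g.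
Proof. by apply: Rintegral_ge0 => u _; exact: cabs_ge0. Qed.

Lemma cabs_mul_circle z u : cabs (z * (u : C)) = cabs z.
Proof. by rewrite cabsM cabs_circle mulr1. Qed.

Lemma denom_ge z u (r : R) : cabs z <= r -> 1 - r <= cabs (1 - z * (u : C)).
Proof.
by move=> zr; have := cabs_lower 1 (z * (u : C)); rewrite cabs1 cabs_mul_circle; lra.
Qed.

Lemma denom_neq0 z u : cabs z < 1 -> 1 - z * (u : C) != 0.
Proof.
by move=> z1; rewrite -cabs_gt0 (lt_le_trans _ (denom_ge u (lexx _)))// subr_gt0.
Qed.

Lemma cont_circle : continuous (fun u => (u : C)).
Proof. exact: cval_continuous. Qed.

Lemma cont_denom z : continuous (fun u => 1 - z * (u : C)).
Proof. exact: (contB (@contC _ _ 1) (contM (@contC _ _ z) cont_circle)). Qed.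

Lemma cont_invdenom z : cabs z < 1 -> continuous (fun u => (1 - z * (u : C))^-1).
Proof. by move=> z1; exact: (contV (fun u => denom_neq0 u z1) (cont_denom (z := z))). Qed.

Lemma cont_ctr g z : continuous g -> cabs z < 1 -> continuous (fun u => g u / (1 - z * (u : C))).
Proof. by move=> cg z1; exact: (contM cg (cont_invdenom z1)). Qed.

Lemma cintegral_weight m g (k : T -> C) (c : R) : continuous g -> continuous k ->
  (forall u, cabs (k u) <= c) -> cabs (cintegral m (fun u => g u * k u)) <= c * absint m g.
Proof.
move=> cg ck kc.
have cc : continuous (fun u => c * cabs (g u)).
  exact: (contM (@contC _ _ c) (continuous_cabs cg)).
apply: (@le_trans _ _ (\int[m]_u (c * cabs (g u)))).
  apply: (cintegral_le m (contM cg ck) cc) => u.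
  by rewrite cabsM mulrC ler_wpM2r ?cabs_ge0.
rewrite RintegralZl//; exact: (continuous_integrable m (continuous_cabs cg)).
Qed.

Lemma ctr_bound m g z (r : R) : continuous g -> cabs z <= r -> r < 1 ->
  cabs (ctr m g z) <= (1 - r)^-1 * absint m g.
Proof.
move=> cg zr r1; apply: (cintegral_weight m cg) => [|u].
  by apply: cont_invdenom; exact: le_lt_trans r1.
by rewrite cabsV lef_pV2 ?posrE ?subr_gt0// ?denom_ge// (lt_le_trans _ (denom_ge u zr))// subr_gt0.
Qed.

Lemma ctr_lip m g z w (r : R) : continuous g -> cabs z <= r -> cabs w <= r -> r < 1 ->
  cabs (ctr m g z - ctr m g w) <= (1 - r) ^- 2 * absint m g * cabs (z - w).
Proof.
move=> cg zr wr r1; have z1 := le_lt_trans zr r1; have w1 := le_lt_trans wr r1.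
have r0 : 0 < 1 - r by rewrite subr_gt0.
rewrite /ctr -cintegralB; [|exact: cont_ctr|exact: cont_ctr].
pose k u := (z - w) * (u : C) * ((1 - z * (u : C))^-1 * (1 - w * (u : C))^-1).
rewrite (_ : cintegral _ _ = cintegral m (fun u => g u * k u)); last first.
  congr cintegral; apply: funext => u.
  by have := denom_neq0 u z1; have := denom_neq0 u w1; rewrite /k => ? ?; field; apply/andP.
rewrite mulrAC; apply: (cintegral_weight m cg) => [|u].
  exact: (contM (contM (@contC _ _ (z - w)) cont_circle)
    (contM (cont_invdenom z1) (cont_invdenom w1))).
rewrite !cabsM cabs_circle mulr1 mulrC ler_wpM2r ?cabs_ge0// !cabsV expr2 invfM.
by apply: ler_pM; rewrite ?invr_ge0 ?cabs_ge0// lef_pV2 ?posrE ?denom_ge//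
  (lt_le_trans r0)// denom_ge.
Qed.

Lemma ctr_derivable m g z : continuous g -> cabs z < 1 -> derivable (ctr m g) z 1.
Proof.
move=> cg z1; pose r := (1 + cabs z) / 2.
have zr : cabs z <= r by rewrite /r; lra.
have r1 : r < 1 by rewrite /r; lra.
have r0 : 0 < 1 - r by rewrite subr_gt0.
pose a := cintegral m (fun u => g u * ((u : C) * ((1 - z * (u : C))^-1 * (1 - z * (u : C))^-1))).
have ca : continuous (fun u : T => g u * ((u : C) * ((1 - z * (u : C))^-1 * (1 - z * (u : C))^-1))).
  exact: (contM cg (contM cont_circle (contM (cont_invdenom z1) (cont_invdenom z1)))).
suff : derivable (ctr m g) z 1 /\ derive1 (ctr m g) z = a by case.
apply: derivable_cabs => e e0.
pose K := (1 - r) ^- 3 * absint m g + 1.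
have K0 : 0 < K by rewrite ltr_wpDl// mulr_ge0 ?absint_ge0// invr_ge0 exprn_ge0// ltW.
exists (Num.min ((1 - cabs z) / 2) (e / K)).
  by rewrite lt_min !divr_gt0// subr_gt0.
move=> h; rewrite lt_min => /andP[h1 h2].
have hr : cabs (h + z) <= r by rewrite (le_trans (cabsD _ _))// /r; lra.
have hz1 : cabs (h + z) < 1 by exact: le_lt_trans r1.
rewrite /ctr -cintegralB; [|exact: cont_ctr|exact: cont_ctr].
rewrite mulrC -[h * a](cintegralZ m h ca) -cintegralB; last 2 first.
- exact: (contB (cont_ctr cg hz1) (cont_ctr cg z1)).
- exact: (contM (@contC _ _ h) ca).
pose k u := (h * (u : C)) ^+ 2 *
  ((1 - (h + z) * (u : C))^-1 * ((1 - z * (u : C))^-1 * (1 - z * (u : C))^-1)).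
rewrite (_ : cintegral _ _ = cintegral m (fun u => g u * k u)); last first.
  congr cintegral; apply: funext => u.
  have := denom_neq0 u z1; have := denom_neq0 u hz1; rewrite /k => A B.
  by field; apply/andP.
apply: (@le_trans _ _ ((cabs h ^+ 2 * (1 - r) ^- 3) * absint m g)).
  apply: (cintegral_weight m cg) => [|u].
    exact: (contM (contX (n := 2) (contM (@contC _ _ h) cont_circle)) (contM (cont_invdenom hz1)
      (contM (cont_invdenom z1) (cont_invdenom z1)))).
  rewrite cabsM cabsX cabs_mul_circle ler_wpM2l ?exprn_ge0 ?cabs_ge0//.
  rewrite !cabsM !cabsV !exprS expr0 mulr1 !invfM.
  have inv v : cabs v <= r -> (cabs (1 - v * (u : C)))^-1 <= (1 - r)^-1.
    by move=> vr; rewrite lef_pV2 ?posrE ?denom_ge// (lt_le_trans r0)// denom_ge.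
  by apply: ler_pM; rewrite ?mulr_ge0 ?invr_ge0 ?cabs_ge0 ?inv//;
    apply: ler_pM; rewrite ?invr_ge0 ?cabs_ge0 ?inv.
have h0 := cabs_ge0 h.
have : cabs h * K <= e by rewrite -ler_pdivlMr// ltW.
rewrite /K; move: ((1 - r) ^- 3) (absint m g) (cabs h) h0 => t A x x0 xK.
have -> : x ^+ 2 * t * A = x * (x * (t * A)) by ring.
by rewrite [leRHS]mulrC ler_wpM2l//; lra.
Qed.

Lemma cont_powg g p : continuous g -> continuous (fun u => g u * (u : C) ^+ p).
Proof. by move=> cg; exact: (contM cg (contX (n := p) cont_circle)). Qed.

(** Taylor expansion at 0 with exact remainder, by iterating [1 / (1 - z u) = 1 + z u / (1 - z u)];
    the remainder is again a [ctr]. *)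
Lemma ctr_expand m g z p : continuous g -> cabs z < 1 ->
  ctr m g z = \sum_(j < p) z ^+ j * cintegral m (fun u => g u * (u : C) ^+ j) +
    z ^+ p * ctr m (fun u => g u * (u : C) ^+ p) z.
Proof.
move=> cg z1; elim: p => [|p IH].
  rewrite big_ord0 add0r expr0 mul1r; congr ctr.
  by apply: funext => u; rewrite expr0 mulr1.
rewrite IH big_ord_recr /= -addrA; congr (_ + _).
rewrite exprSr -mulrA -mulrDr; congr (_ * _).
rewrite /ctr -(cintegralZ m z (cont_ctr (cont_powg (p := p.+1) cg) z1)).
rewrite -cintegralD; [|exact: cont_powg|]; last first.
  exact: (contM (@contC _ _ z) (cont_ctr (cont_powg (p := p.+1) cg) z1)).
congr cintegral; apply: funext => u; rewrite exprS.
by have := denom_neq0 u z1 => ?; field.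
Qed.

Lemma absint_pow m g p : absint m (fun u => g u * (u : C) ^+ p) = absint m g.
Proof.
by congr (Rintegral m _); apply: funext => u; rewrite cabsM cabsX cabs_circle expr1n mulr1.
Qed.

Lemma ctr_polyapprox m g (r : R) : continuous g -> 0 <= r < 1 -> polyapprox r (ctr m g).
Proof.
move=> cg /andP[r0 r1] e e0; have r1' : 0 < 1 - r by rewrite subr_gt0.
have A0 := absint_ge0 m g.
have [N NE] : exists N, r ^+ N <= e * (1 - r) / (absint m g + 1).
  by apply: expr_small; [rewrite r0|rewrite divr_gt0 ?mulr_gt0// ltr_wpDl].
exists (\poly_(j < N) cintegral m (fun u => g u * (u : C) ^+ j)) => z zr.
have z1 := le_lt_trans zr r1.
rewrite (ctr_expand m N cg z1) horner_poly.
rewrite (eq_bigr _ (fun (j : 'I_N) _ => mulrC (z ^+ j) _)) addrC addKr.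
rewrite cabsM cabsX.
have := ctr_bound m (cont_powg (p := N) cg) zr r1; rewrite absint_pow => h.
have h1 : cabs z ^+ N <= r ^+ N by apply: lerXn2r; rewrite ?nnegrE ?cabs_ge0.
apply: le_trans (ler_pM _ _ h1 h) _; rewrite ?exprn_ge0 ?cabs_ge0//.
move: NE; rewrite ler_pdivlMr ?ltr_wpDl// => NE.
rewrite mulrCA mulrC ler_pdivrMr//; apply: le_trans NE.
by rewrite ler_wpM2l ?exprn_ge0// lerDl.
Qed.

End cauchy_transform.

Section transforms_of_probabilities.
Context {R : realType}.
Local Notation C := R[i].
Local Notation T := (circle R).
Implicit Types (mu nu : probability T R) (z w : C) (u : T).

(** [Dtr] is [1 + m_mu] and [z Ntr] is [m_mu]; so [Btr] is [eta_mu / z] without the removable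
    singularity at 0. *)
Definition Dtr mu := ctr mu (fun=> 1).
Definition Ntr mu := ctr mu (fun u => u : C).
Definition Btr mu z : C := Ntr mu z / Dtr mu z.

Let c1 : continuous (fun _ : T => 1 : C). Proof. exact: (@contC T C 1). Qed.

Lemma absint_unimodular mu (g : T -> C) : (forall u, cabs (g u) = 1) -> absint mu g = 1.
Proof.
move=> g1; rewrite /absint (_ : (fun u => cabs (g u)) = fun=> 1).
  by rewrite Rintegral_mass mul1r mass_prob.
by apply: funext => u.
Qed.

Lemma absint1 mu : absint mu (fun=> 1) = 1.
Proof. by apply: absint_unimodular => u; rewrite cabs1. Qed.

Lemma absint_id mu : absint mu (fun u => u : C) = 1.
Proof. by apply: absint_unimodular => u; rewrite cabs_circle. Qed.

Lemma m_transformE mu z : cabs z < 1 -> m_transform mu z = z * Ntr mu z.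
Proof.
move=> z1; rewrite /Ntr /ctr -(cintegralZ _ _ (cont_ctr cont_circle z1)).
by congr cintegral; apply: funext => u; rewrite mulrA.
Qed.

Lemma DtrE mu z : cabs z < 1 -> Dtr mu z = 1 + z * Ntr mu z.
Proof.
move=> z1; rewrite /Dtr (ctr_expand _ 1 c1 z1) big_ord_recl big_ord0 /= addr0 expr0 mul1r expr1.
congr (_ + _ * _); last by congr ctr; apply: funext => u; rewrite mul1r expr1.
rewrite (_ : (fun _ => _) = fun=> 1); last by apply: funext => u; rewrite expr0 mulr1.
by rewrite cintegral_cst mul1r mass_prob.
Qed.

(** [1 / (1 - w)] has positive real part when [|w| < 1], bounded below uniformly in the point of the
    circle, so the integral has positive real part. *)
Lemma Dtr_neq0 mu z : cabs z < 1 -> Dtr mu z != 0.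
Proof.
move=> z1; suff : 0 < Re (Dtr mu z) by apply: contraTneq => ->; rewrite ltxx.
rewrite /Dtr /ctr /cintegral /=.
apply: (@lt_le_trans _ _ (\int[mu]_u ((1 - cabs z) / 4))).
  by rewrite Rintegral_mass mass_prob mulr1 divr_gt0// subr_gt0.
apply: le_Rintegral => //.
- exact: (continuous_integrable mu (@contC T R _)).
- exact: (continuous_integrable mu (continuous_Re (cont_ctr c1 z1))).
move=> u _; rewrite mul1r cReV; set w := z * (u : C).
have wz : cabs w = cabs z by exact: cabs_mul_circle.
have d0 : 0 < cabs (1 - w) by rewrite cabs_gt0 denom_neq0.
have d2 : cabs (1 - w) <= 2 by have := cabsB 1 w; rewrite cabs1 wz; lra.
have re : 1 - cabs z <= Re (1 - w).
  by rewrite cReD cReN /= lerD2l lerN2 -wz Re_le_cabs.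
rewrite ler_pdivlMr ?exprn_gt0//; apply: le_trans re.
have : cabs (1 - w) ^+ 2 <= 4 by nra.
move: (_ ^+ 2) => x x4; have : 0 <= (1 - cabs z) * (4 - x) by rewrite mulr_ge0; lra.
lra.
Qed.

Lemma Btr_eta mu z : cabs z < 1 -> eta mu z = z * Btr mu z.
Proof. by move=> z1; rewrite /eta m_transformE// -DtrE// /Btr mulrA. Qed.

Lemma derive1_mulid (k : C -> C) : derivable k 0 1 -> derive1 (fun z => z * k z) 0 = k 0.
Proof.
move=> dk; suff : derivable (fun z => z * k z) 0 1 /\ derive1 (fun z => z * k z) 0 = k 0 by case.
apply: derivable_cabs => e e0; have [d d0 dP] := derivable_continuous_cabs dk e0.
exists d => // h hd; rewrite addr0 mul0r subr0 [k 0 * h]mulrC -mulrBr cabsM mulrC.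
by rewrite ler_wpM2r ?cabs_ge0// ltW// dP// subr0.
Qed.

Lemma Ntr_derivable mu z : cabs z < 1 -> derivable (Ntr mu) z 1.
Proof. exact/ctr_derivable/cont_circle. Qed.

Lemma Dtr_derivable mu z : cabs z < 1 -> derivable (Dtr mu) z 1.
Proof. exact/ctr_derivable/c1. Qed.

Lemma Btr_derivable mu z : cabs z < 1 -> derivable (Btr mu) z 1.
Proof.
move=> z1; apply: derivableM; first exact: Ntr_derivable.
by apply: derivableV; [exact: Dtr_neq0|exact: Dtr_derivable].
Qed.

Lemma near0_disc (r : R) : 0 < r -> \forall z \near (0 : C), cabs z < r.
Proof. by move=> r0; apply/nbhs0_cabsP; exists r. Qed.

Lemma divzE (F k : C -> C) z : (\forall w \near (0 : C), F w = w * k w) ->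
  derivable k 0 1 -> F z = z * k z -> Defs.divz F z = k z.
Proof.
move=> Fk dk Fz; rewrite /Defs.divz; have [->|z0] := eqVneq z 0.
  by rewrite -(derive1_mulid dk); exact: derive1_near.
by rewrite Fz mulrAC divff// mul1r.
Qed.

Lemma B_transformE mu z : cabs z < 1 -> B_transform mu z = Btr mu z.
Proof.
move=> z1; apply: divzE; last exact: Btr_eta.
  by apply: filterS (near0_disc ltr01) => w /Btr_eta.
by apply: Btr_derivable; rewrite cabs0.
Qed.

Lemma Ntr0 mu : Ntr mu 0 = mean mu.
Proof. by congr cintegral; apply: funext => u; rewrite mul0r subr0 divr1. Qed.

Lemma Dtr0 mu : Dtr mu 0 = 1.
Proof. by rewrite DtrE ?cabs0// mul0r addr0. Qed.

Lemma Btr0 mu : Btr mu 0 = mean mu.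
Proof. by rewrite /Btr Ntr0 Dtr0 divr1. Qed.

Lemma mean_le1 mu : cabs (mean mu) <= 1.
Proof.
have := cintegral_bound mu cont_circle (fun u => _ : cabs (u : C) <= 1).
by rewrite mass_prob mulr1; apply => u; rewrite cabs_circle.
Qed.

(** * Bounds on the disc of radius 1/4, uniform in the measure *)

Section quarter_disc.
Variable mu : probability T R.

Let q : (1 / 4 : R) < 1. Proof. lra. Qed.
Let q1 : (1 - 1 / 4 : R)^-1 = 4 / 3. Proof. by field. Qed.
Let q2 : (1 - 1 / 4 : R) ^- 2 = 16 / 9. Proof. by field. Qed.

Lemma Ntr_bound z : cabs z <= 1 / 4 -> cabs (Ntr mu z) <= 4 / 3.
Proof.
move=> zq; have := ctr_bound mu cont_circle zq q; by rewrite absint_id mulr1 q1.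
Qed.

Lemma Dtr_bound z : cabs z <= 1 / 4 -> cabs (1 - Dtr mu z) <= 1 / 3.
Proof.
move=> zq; rewrite DtrE; last by have := q; lra.
rewrite opprD addNKr cabsN cabsM; have := Ntr_bound zq.
by have := cabs_ge0 z; have := cabs_ge0 (Ntr mu z); nra.
Qed.

Lemma Dtr_lower z : cabs z <= 1 / 4 -> 2 / 3 <= cabs (Dtr mu z).
Proof.
move=> zq; have := Dtr_bound zq; have := cabs_lower 1 (1 - Dtr mu z).
by rewrite subKr cabs1; lra.
Qed.

Lemma Ntr_lip z w : cabs z <= 1 / 4 -> cabs w <= 1 / 4 ->
  cabs (Ntr mu z - Ntr mu w) <= 2 * cabs (z - w).
Proof.
move=> zq wq; have := ctr_lip mu cont_circle zq wq q; rewrite absint_id mulr1 q2.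
move=> /le_trans; apply; rewrite ler_wpM2r ?cabs_ge0//; lra.
Qed.

Lemma Dtr_lip z w : cabs z <= 1 / 4 -> cabs w <= 1 / 4 ->
  cabs (Dtr mu z - Dtr mu w) <= 2 * cabs (z - w).
Proof.
move=> zq wq; have := ctr_lip mu c1 zq wq q; rewrite absint1 mulr1 q2.
move=> /le_trans; apply; rewrite ler_wpM2r ?cabs_ge0//; lra.
Qed.

Lemma Btr_bound z : cabs z <= 1 / 4 -> cabs (Btr mu z) <= 2.
Proof.
move=> zq; rewrite /Btr cabsM cabsV ler_pdivrMr; last by have := Dtr_lower zq; lra.
by have := Ntr_bound zq; have := Dtr_lower zq; lra.
Qed.

Lemma Btr_lip z w : cabs z <= 1 / 4 -> cabs w <= 1 / 4 ->
  cabs (Btr mu z - Btr mu w) <= 9 * cabs (z - w).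
Proof.
move=> zq wq; have dz := Dtr_lower zq; have dw := Dtr_lower wq.
have z0 : Dtr mu z != 0 by rewrite -cabs_gt0; lra.
have w0 : Dtr mu w != 0 by rewrite -cabs_gt0; lra.
have -> : Btr mu z - Btr mu w =
    ((Ntr mu z - Ntr mu w) - Btr mu w * (Dtr mu z - Dtr mu w)) / Dtr mu z.
  by rewrite /Btr; field; apply/andP.
rewrite cabsM cabsV ler_pdivrMr; last lra.
apply: le_trans (cabsB _ _) _; rewrite cabsM.
have := Ntr_lip zq wq; have := Dtr_lip zq wq; have := Btr_bound wq.
have := cabs_ge0 (z - w); have := cabs_ge0 (Btr mu w); have := cabs_ge0 (Dtr mu z - Dtr mu w).
move: (cabs (z - w)) (cabs (Btr mu w)) (cabs (Dtr mu z - Dtr mu w)) => x b d d0 b0 x0 b2 dx nx.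
have : b * d <= 2 * (2 * x) by apply: ler_pM.
nra.
Qed.

Lemma Btr_polyapprox : polyapprox (1 / 4) (Btr mu).
Proof.
have q01 : 0 <= (1 / 4 : R) < 1 by apply/andP; split; lra.
apply: polyapproxM; first exact: ctr_polyapprox cont_circle q01.
apply: polyapproxV; first exact: ctr_polyapprox c1 q01.
move=> z zq; apply: le_trans (Dtr_bound zq) _; lra.
Qed.

End quarter_disc.
End transforms_of_probabilities.

(** * The c-free transforms as explicit local inverses *)

Section germs.
Context {R : realType}.
Local Notation C := R[i].
Local Notation T := (circle R).
Implicit Types (mu nu : probability T R) (z w : C) (F G : C -> C).

Lemma analytic_near0_at0 F : analytic_near0 F -> derivable F 0 1.
Proof. by move=> /nbhs_singleton. Qed.

Lemma near0_comp G (P : C -> Prop) : derivable G 0 1 -> G 0 = 0 ->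
  (\forall z \near (0 : C), P z) -> \forall z \near (0 : C), P (G z).
Proof.
move=> dG G0 /nbhs0_cabsP[e e0 eP].
have [d d0 dP] := derivable_continuous_cabs dG e0.
apply/nbhs0_cabsP; exists d => // z zd; apply: eP.
by have := dP z; rewrite G0 !subr0; exact.
Qed.

Lemma derivable_comp1 F G z : derivable G z 1 -> derivable F (G z) 1 ->
  derivable (fun x => F (G x)) z 1.
Proof.
move=> /derivable1_diffP dG /derivable1_diffP dF; apply/derivable1_diffP.
exact: (@differentiable_comp _ _ _ _ G F z dG dF).
Qed.

Lemma derivable_id1 z : derivable (fun x : C => x) z 1.
Proof. exact: derivable_id. Qed.

(** Two analytic right inverses fixing 0 stay in the disc where [F] is injective, hence agree near
    0. Exhibiting one also keeps [locinv] off its default value. *)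
Lemma locinv_unique F G (s : R) : 0 < s ->
  (forall u v, cabs u <= s -> cabs v <= s -> F u = F v -> u = v) ->
  analytic_near0 G -> G 0 = 0 -> (\forall z \near (0 : C), F (G z) = z) ->
  \forall z \near (0 : C), locinv F z = G z.
Proof.
move=> s0 inj aG G0 FG.
have [aH H0 FH] : [/\ analytic_near0 (locinv F), locinv F 0 = 0 &
    \forall z \near (0 : C), F (locinv F z) = z].
  by rewrite /locinv; case: xgetP => [H -> //|/(_ G)[]].
have small := near0_disc s0.
have sH := near0_comp (analytic_near0_at0 aH) H0 small.
have sG := near0_comp (analytic_near0_at0 aG) G0 small.
apply: filterS (filterI (filterI FG FH) (filterI sG sH)) => z [[a b] [c d]].
by apply: inj; rewrite ?ltW// a b.
Qed.

(** [36] is 4 times the Lipschitz constant 9 of [Btr] on the disc of radius [1 / 4], as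
    [strict_on_mul] demands for [z B(z)]. *)
Definition mrad nu : R := cabs (mean nu) / 36.

Lemma mrad_gt0 nu : nonzero_mean nu -> 0 < mrad nu.
Proof. by move=> h; rewrite divr_gt0// cabs_gt0; apply/eqP. Qed.

Lemma mrad_le nu : mrad nu <= 1 / 36.
Proof. by rewrite /mrad; have := mean_le1 nu; lra. Qed.

Lemma strict_zB nu : strict_on (fun z => z * Btr nu z) (mean nu) (mrad nu).
Proof.
have h := mrad_le nu; apply: (@strict_on_mul _ _ 9) => // [u v us vs||].
- by apply: Btr_lip; lra.
- exact: Btr0.
by rewrite /mrad; lra.
Qed.

Lemma strict_zN nu : strict_on (fun z => z * Ntr nu z) (mean nu) (mrad nu).
Proof.
have h := mrad_le nu; have := cabs_ge0 (mean nu) => m0.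
apply: (@strict_on_mul _ _ 2) => // [u v us vs||].
- by apply: Ntr_lip; lra.
- exact: Ntr0.
by rewrite /mrad; lra.
Qed.

(** The substitution [z (1 + m_nu(z))] through which both R-transforms are defined. *)
Definition zD nu z : C := z * Dtr nu z.

Lemma strict_zD nu : strict_on (zD nu) 1 (1 / 36).
Proof.
apply: (@strict_on_mul _ _ 2) => // [u v us vs||].
- by apply: Dtr_lip; lra.
- exact: Dtr0.
by rewrite cabs1; lra.
Qed.

Definition zDinv nu : C -> C := discinv (zD nu) (1 / 36).
Definition zNinv nu : C -> C := discinv (fun z => z * Ntr nu z) (mrad nu).
Definition etainv nu : C -> C := discinv (fun z => z * Btr nu z) (mrad nu).

Let r36 : 0 < 1 / 36 :> R. Proof. lra. Qed.
Let one0 : (1 : C) != 0. Proof. exact: oner_neq0. Qed.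

Lemma zD0 nu : zD nu 0 = 0. Proof. exact: mul0r. Qed.

Lemma zDinv_spec nu w : cabs w <= 1 / 72 -> cabs (zDinv nu w) <= 1 / 36 /\ zD nu (zDinv nu w) = w.
Proof.
move=> w1; apply: (discinv_spec one0 r36 (strict_zD nu) (zD0 nu)).
by rewrite cabs1; lra.
Qed.

Lemma zDinv_bound nu w : cabs w <= 1 / 72 -> cabs (zDinv nu w) <= 2 * cabs w.
Proof.
move=> w1; have := @discinv_bound _ _ _ _ one0 r36 (strict_zD nu) (zD0 nu) w.
by rewrite cabs1 -/(zDinv nu w); lra.
Qed.

Lemma zDinvK nu u : cabs u <= 1 / 36 -> zDinv nu (zD nu u) = u.
Proof. exact: (discinvK one0 (strict_zD nu)). Qed.

Lemma zD_derivable nu z : cabs z < 1 -> derivable (zD nu) z 1.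
Proof. by move=> z1; apply: derivableM; [exact: derivable_id1|exact: Dtr_derivable]. Qed.

Lemma zDinv_derivable nu w : cabs w < 1 / 72 -> derivable (zDinv nu) w 1.
Proof.
move=> w1; have b := zDinv_bound nu (ltW w1).
apply: (discinv_derivable one0 r36 (strict_zD nu) (zD0 nu)).
- by rewrite cabs1; lra.
- by rewrite -/(zDinv nu w); lra.
- by apply: zD_derivable; rewrite -/(zDinv nu w); lra.
Qed.

Lemma cR_candidate_derivable mu nu w : cabs w < 1 / 72 ->
  derivable (fun w => Btr mu (zDinv nu w)) w 1.
Proof.
move=> w1; apply: derivable_comp1; first exact: zDinv_derivable.
by apply: Btr_derivable; have := zDinv_bound nu (ltW w1); lra.
Qed.

Let r72 : 0 < 1 / 72 :> R. Proof. lra. Qed.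

Lemma cR_candidate_analytic mu nu : analytic_near0 (fun w => w * Btr mu (zDinv nu w)).
Proof.
apply: filterS (near0_disc r72) => w w1.
by apply: derivableM; [exact: derivable_id1|exact: cR_candidate_derivable].
Qed.

Lemma one_m nu z : cabs z < 1 -> 1 + m_transform nu z = Dtr nu z.
Proof. by move=> z1; rewrite m_transformE// DtrE. Qed.

(** With [w = z D_nu(z)] the equation reads [cR(w) D_mu(z) = z N_mu(z) D_nu(z)], that is
    [cR(w) = w B_mu(z)]. The first case shows that every solution has this form, the second that one
    exists, which excludes the default of [xget]. *)
Lemma cR_near mu nu :
  \forall w \near (0 : C), cR_transform mu nu w = w * Btr mu (zDinv nu w).
Proof.
rewrite /cR_transform; case: xgetP => [F -> [_]|/(_ (fun w => w * Btr mu (zDinv nu w)))].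
  move=> /nbhs0_cabsP[d d0 dP]; apply/nbhs0_cabsP.
  exists (Num.min (1 / 72) (d / 2)) => [|w]; first by rewrite lt_min r72 divr_gt0.
  rewrite lt_min => /andP[w1 w2].
  have [zs zw] := zDinv_spec nu (ltW w1); have zb := zDinv_bound nu (ltW w1).
  set z := zDinv nu w in zs zw zb *.
  have z1 : cabs z < 1 by lra.
  have := dP z; rewrite !one_m// m_transformE// -/(zD nu z) zw => E.
  have D0 := Dtr_neq0 mu z1; apply: (mulIf D0); rewrite E; last lra.
  rewrite /Btr -zw /zD; field; exact: D0.
case; split; first exact: cR_candidate_analytic.
apply: filterS (near0_disc r36) => z zs.
have z1 : cabs z < 1 by lra.
rewrite !one_m// -/(zD nu z) zDinvK ?(ltW zs)// m_transformE//.
by rewrite /Btr /zD; field; exact: Dtr_neq0.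
Qed.

Lemma R_near nu :
  \forall w \near (0 : C), R_transform nu w = w * Btr nu (zDinv nu w).
Proof.
rewrite /R_transform; case: xgetP => [F -> [_]|/(_ (fun w => w * Btr nu (zDinv nu w)))].
  move=> /nbhs0_cabsP[d d0 dP]; apply/nbhs0_cabsP.
  exists (Num.min (1 / 72) (d / 2)) => [|w]; first by rewrite lt_min r72 divr_gt0.
  rewrite lt_min => /andP[w1 w2].
  have [zs zw] := zDinv_spec nu (ltW w1); have zb := zDinv_bound nu (ltW w1).
  set z := zDinv nu w in zs zw zb *.
  have z1 : cabs z < 1 by lra.
  have := dP z; rewrite !one_m// m_transformE// -/(zD nu z) zw => ->; last lra.
  by rewrite /Btr -[in RHS]zw /zD; field; exact: Dtr_neq0.
case; split; first exact: cR_candidate_analytic.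
apply: filterS (near0_disc r36) => z zs.
have z1 : cabs z < 1 by lra.
rewrite !one_m// -/(zD nu z) zDinvK ?(ltW zs)// m_transformE//.
by rewrite /Btr /zD; field; exact: Dtr_neq0.
Qed.

Section nonzero.
Variable nu : probability T R.
Hypothesis nu0 : nonzero_mean nu.

Let a0 : mean nu != 0. Proof. exact/eqP. Qed.
Let s0 : 0 < mrad nu. Proof. exact: mrad_gt0. Qed.
Let ca0 : 0 < cabs (mean nu). Proof. by rewrite cabs_gt0. Qed.

(** Radius on which [discinv] inverts both [z N_nu] and [z B_nu]: half the slope at 0 times the
    radius of the source disc. *)
Definition invrad : R := cabs (mean nu) * mrad nu / 2.

Lemma invrad_gt0 : 0 < invrad. Proof. by rewrite divr_gt0// mulr_gt0. Qed.

Lemma zNinv_spec y : cabs y <= invrad ->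
  cabs (zNinv nu y) <= mrad nu /\ zNinv nu y * Ntr nu (zNinv nu y) = y.
Proof. by move=> yr; exact: (discinv_spec a0 s0 (@strict_zN nu) (mul0r _) yr). Qed.

Lemma zNinv_lt y : cabs y < invrad -> cabs (zNinv nu y) < mrad nu.
Proof.
move=> yr; have := discinv_bound a0 s0 (@strict_zN nu) (mul0r _) (ltW yr).
rewrite -/(zNinv nu y) => h; rewrite -(@ltr_pM2l _ (cabs (mean nu) / 2)) ?divr_gt0//.
by rewrite /invrad in yr; lra.
Qed.

Lemma zNinv_derivable y : cabs y < invrad -> derivable (zNinv nu) y 1.
Proof.
move=> yr; have h := zNinv_lt yr.
apply: (discinv_derivable a0 s0 (@strict_zN nu) (mul0r _) yr) => //.
apply: derivableM; first exact: derivable_id1.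
by apply: Ntr_derivable; rewrite -/(zNinv nu y); have := mrad_le nu; lra.
Qed.

Lemma zNinv0 : zNinv nu 0 = 0.
Proof. exact: (discinv0 a0 s0 (@strict_zN nu) (mul0r _)). Qed.

Lemma zDN_derivable y : cabs y < invrad -> derivable (fun y => zD nu (zNinv nu y)) y 1.
Proof.
move=> yr; apply: derivable_comp1; first exact: zNinv_derivable.
by apply: zD_derivable; have := zNinv_lt yr; have := mrad_le nu; lra.
Qed.

Lemma zDN0 : zD nu (zNinv nu 0) = 0. Proof. by rewrite zNinv0 zD0. Qed.

Lemma zDN_derivable0 : derivable (fun y => zD nu (zNinv nu y)) 0 1.
Proof. by apply: zDN_derivable; rewrite cabs0 invrad_gt0. Qed.

Lemma strict_cR : strict_on (fun w => w * Btr nu (zDinv nu w)) (mean nu) (cabs (mean nu) / 72).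
Proof.
have m1 := mean_le1 nu.
apply: (@strict_on_mul _ _ 18) => // [u v us vs||]; last by have := ca0; lra.
  have u1 : cabs u <= 1 / 72 by lra.
  have v1 : cabs v <= 1 / 72 by lra.
  have [su _] := zDinv_spec nu u1; have [sv _] := zDinv_spec nu v1.
  have := @Btr_lip _ nu (zDinv nu u) (zDinv nu v).
  have : cabs 1 / 2 * cabs (zDinv nu u - zDinv nu v) <= cabs (u - v).
    by apply: (discinv_lip one0 r36 (strict_zD nu) (zD0 nu)); rewrite cabs1; lra.
  rewrite cabs1 => h1 h2; apply: le_trans (h2 _ _) _; lra.
by rewrite /zDinv (discinv0 one0 r36 (strict_zD nu) (zD0 nu)) Btr0.
Qed.

(** [R_nu] sends [z D_nu(z)] to [z N_nu(z)], so its inverse sends [z N_nu(z)] back to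
    [z D_nu(z)]. *)
Lemma locinv_R_near :
  \forall y \near (0 : C), locinv (R_transform nu) y = zD nu (zNinv nu y).
Proof.
have /nbhs0_cabsP[d d0 dP] := R_near nu.
pose s := Num.min (d / 2) (cabs (mean nu) / 72).
have sd : s < d by rewrite gt_min; apply/orP; left; lra.
have sm : s <= cabs (mean nu) / 72 by rewrite ge_min lexx orbT.
have s_gt0 : 0 < s by rewrite lt_min !divr_gt0.
apply: (@locinv_unique _ _ s) => //.
- move=> u v us vs; rewrite !dP ?(le_lt_trans _ sd)//.
  by apply: (strict_on_inj a0 (strict_onW sm strict_cR)).
- by apply: filterS (near0_disc invrad_gt0) => y; exact: zDN_derivable.
- exact: zDN0.
have := near0_comp zDN_derivable0 zDN0 (R_near nu).
apply: filterS2 (near0_disc invrad_gt0) => y yr ->.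
have [ys yN] := zNinv_spec (ltW yr); set u := zNinv nu y in ys yN *.
rewrite zDinvK; last by have := mrad_le nu; lra.
rewrite -[RHS]yN /zD /Btr; field; apply: Dtr_neq0.
by have := mrad_le nu; lra.
Qed.

Lemma cT_near mu : \forall y \near (0 : C), cT_transform mu nu y = Btr mu (zNinv nu y).
Proof.
have cRn := near0_comp zDN_derivable0 zDN0 (cR_near mu nu).
apply: filterS (filterI (filterI (near0_disc invrad_gt0) locinv_R_near) cRn) => y [[yr yL] yR].
have [ys yN] := zNinv_spec (ltW yr).
have -> : cT_transform mu nu y = Defs.divz (cR_transform mu nu) (zD nu (zNinv nu y)) by rewrite -yL.
rewrite (@divzE _ _ (fun w => Btr mu (zDinv nu w)) _ (cR_near mu nu) _ yR).
  by rewrite zDinvK//; have := mrad_le nu; lra.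
by apply: cR_candidate_derivable; rewrite cabs0.
Qed.

Lemma etainv_spec u : cabs u <= invrad ->
  cabs (etainv nu u) <= mrad nu /\ etainv nu u * Btr nu (etainv nu u) = u.
Proof. by move=> ur; exact: (discinv_spec a0 s0 (@strict_zB nu) (mul0r _) ur). Qed.

Lemma etainvK z : cabs z <= mrad nu -> etainv nu (z * Btr nu z) = z.
Proof. exact: (discinvK a0 (@strict_zB nu)). Qed.

Lemma etainv_lip z w : cabs z <= invrad -> cabs w <= invrad ->
  cabs (mean nu) / 2 * cabs (etainv nu z - etainv nu w) <= cabs (z - w).
Proof. exact: (discinv_lip a0 s0 (@strict_zB nu) (mul0r _)). Qed.

Lemma etainv0 : etainv nu 0 = 0.
Proof. exact: (discinv0 a0 s0 (@strict_zB nu) (mul0r _)). Qed.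

Lemma etainv_polyapprox : polyapprox invrad (etainv nu).
Proof.
apply: (discinv_polyapprox a0 s0 (@strict_zB nu) (mul0r _)).
apply: polyapproxM; first exact: polyapprox_id.
move=> e /(Btr_polyapprox nu)[P hP]; exists P => z zs; apply: hP.
by apply: le_trans zs _; have := mrad_le nu; lra.
Qed.

Lemma mobius_derivable0 : derivable (fun u : C => u / (1 - u)) 0 1.
Proof.
apply: derivableM; first exact: derivable_id1.
apply: derivableV; first by rewrite subr0 oner_neq0.
by apply: derivableB; [exact: derivable_cst|exact: derivable_id1].
Qed.

Lemma near0_mobius (P : C -> Prop) : (\forall y \near (0 : C), P y) ->
  \forall u \near (0 : C), P (u / (1 - u)).
Proof. by move=> h; apply: (near0_comp mobius_derivable0) h; rewrite mul0r. Qed.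

(** If [u = eta_nu(g)] then [u / (1 - u) = m_nu(g) = g N_nu(g)], so [zNinv] takes it to [g], the
    value of [eta_nu^-1] at [u]. *)
Lemma Sigma_near mu : \forall u \near (0 : C),
  cT_transform mu nu (u / (1 - u)) = Btr mu (etainv nu u).
Proof.
have := near0_mobius (cT_near mu).
apply: filterS2 (near0_disc invrad_gt0) => u ur ->.
have [gs gB] := etainv_spec (ltW ur); set g := etainv nu u in gs gB *.
have g1 : cabs g < 1 by have := mrad_le nu; lra.
have D0 := Dtr_neq0 nu g1.
have u1 : 1 - u != 0.
  rewrite -gB /Btr mulrA -[1](divff D0) -mulrBl DtrE// addrK mul1r invr_eq0 -DtrE//.
have -> : u / (1 - u) = g * Ntr nu g.
  apply: (mulIf u1); rewrite divfK// mulrBr mulr1.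
  have : u * Dtr nu g = g * Ntr nu g by rewrite -gB /Btr mulrA divfK.
  by rewrite DtrE// => E; rewrite -{1}E; ring.
by congr (Btr mu _); exact: (discinvK a0 (@strict_zN nu) gs).
Qed.

End nonzero.
End germs.

(** * Weak convergence and convergence of transforms near 0 *)

Section weak_convergence_by_transforms.
Context {R : realType}.
Local Notation C := R[i].
Local Notation T := (circle R).

Let c1 : continuous (fun _ : T => 1 : C). Proof. exact: (@contC T C 1). Qed.

Lemma absint_mass (m : {finite_measure set T -> \bar R}) : absint m (fun=> 1) = mass m.
Proof.
rewrite /absint; under eq_Rintegral do rewrite cabs1.
by rewrite Rintegral_mass mul1r.
Qed.

(** Removing the Taylor terms below order [p] and dividing by [t ^ p] leaves a Cauchy transform
    whose value at 0 is the moment; its Lipschitz bound on the disc of radius [1 / 2] gives the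
    constant 4. *)
Lemma moment_of_ctr (m : {finite_measure set T -> \bar R}) p (t : R) :
  0 < t <= 1 / 2 ->
  cabs (t%:C ^- p * (ctr m (fun=> 1) t%:C - \sum_(j < p) t%:C ^+ j * moment m j) -
        moment m p) <= 4 * mass m * t.
Proof.
move=> /andP[t0 t2]; have tc : cabs t%:C = t by rewrite cabsR gtr0_norm.
have t1 : cabs t%:C < 1 by rewrite tc; lra.
have one_mul j : (fun u : T => 1 * (u : C) ^+ j) = fun u => (u : C) ^+ j.
  by apply: funext => u; rewrite mul1r.
have tp0 : t%:C ^+ p != 0 by rewrite expf_neq0// -cabs_gt0 tc.
rewrite (ctr_expand m p c1 t1).
under eq_bigr do rewrite one_mul.
rewrite /moment [X in _ * X - _]addrAC subrr add0r mulKf//.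
have cp : continuous (fun u : T => (u : C) ^+ p) by exact: (contX (n := p) cont_circle).
have -> : cintegral m (fun z : T => (z : C) ^+ p) = ctr m (fun u : T => (u : C) ^+ p) 0.
  by congr cintegral; apply: funext => u; rewrite mul0r subr0 divr1.
rewrite one_mul.
have h2 : cabs t%:C <= 1 / 2 by rewrite tc.
have h0 : cabs (0 : C) <= 1 / 2 by rewrite cabs0; lra.
have half : (1 / 2 : R) < 1 by lra.
have := ctr_lip m cp h2 h0 half; rewrite subr0 tc.
have -> : absint m (fun u : T => (u : C) ^+ p) = mass m.
  rewrite -absint_mass -(absint_pow m (fun=> 1) p); congr absint.
  by apply: funext => u; rewrite mul1r.
by have -> : (1 - 1 / 2 : R) ^- 2 = 4 by field.
Qed.

Lemma ctr_at0 (m : {finite_measure set T -> \bar R}) : ctr m (fun=> 1) 0 = (mass m)%:C.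
Proof.
rewrite -[RHS]mul1r -cintegral_cst; congr cintegral.
by apply: funext => u; rewrite mul0r subr0 divr1.
Qed.

Section filtered.
Context {I : Type} (F : set_system I) {FF : ProperFilter F}.

(** Strong induction on [p]: once lower moments converge, the transform at one small real [t] gives
    the moment of order [p] up to [O(t)], uniformly along the filter since the masses are eventually
    bounded. *)
Lemma cvg_moments_of_ctr (m_ : I -> {finite_measure set T -> \bar R})
    (m : {finite_measure set T -> \bar R}) (r : R) : 0 < r ->
  (forall z : C, cabs z < r -> ctr (m_ i) (fun=> 1) z @[i --> F] --> ctr m (fun=> 1) z) ->
  forall p, moment (m_ i) p @[i --> F] --> moment m p.
Proof.
move=> r0 cz p; elim/ltn_ind: p => p IH.
have M0 := mass_ge0 m; pose M := mass m + 1; have Mgt : 0 < M by rewrite ltr_wpDl.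
have mM : \forall i \near F, mass (m_ i) <= M.
  have h0 : cabs (0 : C) < r by rewrite cabs0.
  have /cvg_cabsP/(_ _ ltr01) := cz 0 h0; apply: filterS => i.
  by rewrite !ctr_at0 -rmorphB /= cabsR ltr_norml /M; lra.
apply/cvg_cabsP => e e0.
pose t := Num.min (1 / 2) (Num.min (r / 2) (e / (16 * M))).
have t0 : 0 < t by rewrite !lt_min !divr_gt0// mulr_gt0.
have t2 : 0 < t <= 1 / 2 by rewrite t0 ge_min lexx.
have tr : t < r.
  rewrite !gt_min; apply/orP; right; apply/orP; left; lra.
have tM : t * (16 * M) <= e.
  by rewrite -ler_pdivlMr ?mulr_gt0// !ge_min lexx !orbT.
have tcr : cabs t%:C < r by rewrite cabsR gtr0_norm.
have Ecvg : t%:C ^- p * (ctr (m_ i) (fun=> 1) t%:C - \sum_(j < p) t%:C ^+ j * moment (m_ i) j)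
    @[i --> F] --> t%:C ^- p * (ctr m (fun=> 1) t%:C - \sum_(j < p) t%:C ^+ j * moment m j).
  apply: cvgMl_tmp; apply: cvgB; first exact: cz.
  apply: (cvg_bigsum (u := fun (j : 'I_p) i => t%:C ^+ j * moment (m_ i) j)) => j.
  by apply: cvgMl_tmp; exact: IH.
have e2 : 0 < e / 2 by rewrite divr_gt0.
have mb : mass m <= M by rewrite /M lerDl.
have h1 := moment_of_ctr m p t2.
have /cvg_cabsP/(_ _ e2) := Ecvg; apply: filterS2 mM => i mi.
have h2 := moment_of_ctr (m_ i) p t2.
set E := _ * (_ - _) in h1 *; set Ei := _ * (_ - _) in h2 * => EE.
have := cabs_tri E (moment m p) (moment (m_ i) p).
have := cabs_tri Ei E (moment (m_ i) p).
rewrite [cabs (moment m p - E)]cabsC.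
have : 4 * mass m * t <= 4 * M * t by rewrite ler_pM2r// ler_pM2l.
have : 4 * mass (m_ i) * t <= 4 * M * t by rewrite ler_pM2r// ler_pM2l.
lra.
Qed.

Lemma Dtr_Btr (mu : probability T R) (z : C) : cabs z < 1 ->
  1 - z * Btr mu z != 0 /\ Dtr mu z = (1 - z * Btr mu z)^-1.
Proof.
move=> z1; have D0 := Dtr_neq0 mu z1.
have E : Dtr mu z * (1 - z * Btr mu z) = 1.
  rewrite /Btr (_ : _ * _ = Dtr mu z - z * Ntr mu z); last by field.
  by rewrite DtrE// addrK.
have N0 : 1 - z * Btr mu z != 0.
  by apply: contra_eq_neq E => ->; rewrite mulr0 eq_sym oner_eq0.
by split => //; apply: (mulIf N0); rewrite E mulVf.
Qed.

(** [B] determines the Cauchy transform as [1 / (1 - z B(z))], hence the moments. *)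
Lemma cvg_Rintegral_of_Btr (mu_ : I -> probability T R) (mu : probability T R) (r : R) :
  0 < r <= 1 ->
  (forall z : C, cabs z < r -> Btr (mu_ i) z @[i --> F] --> Btr mu z) ->
  forall f : T -> R, continuous f -> \int[mu_ i]_z f z @[i --> F] --> \int[mu]_z f z.
Proof.
move=> /andP[r0 r1] Bz.
apply: cvg_Rintegral_of_moments; apply: (cvg_moments_of_ctr r0) => z zr.
have z1 : cabs z < 1 by exact: lt_le_trans r1.
have [N0 DE] := Dtr_Btr mu z1.
have -> : (fun i => ctr (mu_ i) (fun=> 1) z) = fun i => (1 - z * Btr (mu_ i) z)^-1.
  by apply: funext => i; have [_ <-] := Dtr_Btr (mu_ i) z1.
have -> : ctr mu (fun=> 1) z = (1 - z * Btr mu z)^-1 by rewrite -DE.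
apply: cvgV => //; apply: cvgB; first exact: cvg_cst.
by apply: cvgMl_tmp; exact: Bz.
Qed.

Lemma cvg_Btr (mu_ : I -> probability T R) (mu : probability T R) :
  (forall f : T -> R, continuous f -> \int[mu_ i]_z f z @[i --> F] --> \int[mu]_z f z) ->
  forall z : C, cabs z < 1 -> Btr (mu_ i) z @[i --> F] --> Btr mu z.
Proof.
move=> mf z z1; apply: cvgM.
  exact: (cvg_cintegral mf (cont_ctr cont_circle z1)).
apply: cvgV; first exact: Dtr_neq0.
exact: (cvg_cintegral mf (cont_ctr c1 z1)).
Qed.

End filtered.
End weak_convergence_by_transforms.

(** * Products over rows of an infinitesimal array *)

Section scalar_estimates.
Context {R : realType}.
Local Notation C := R[i].
Implicit Types (x y u : R) (z w : C).

Lemma ge0_of_derive (f f' : R -> R) (b : R) :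
  (forall x, is_derive x 1 f (f' x)) -> (forall x, 0 <= x <= b -> 0 <= f' x) ->
  forall x, 0 <= x <= b -> f 0 <= f x.
Proof.
move=> df f'0 x /andP[x0 xb].
apply: (@ger0_derive1_ndecr _ f 0 b) => //.
- move=> y yb; rewrite derive1E (@derive_val _ _ _ _ _ _ _ (df y)); apply: f'0.
  by move: yb; rewrite in_itv /= => /andP[/ltW -> /ltW ->].
- by apply: derivable_within_continuous => y _; case: (df y).
Qed.

Lemma sin_le_id x : 0 <= x -> sin x <= x.
Proof.
move=> x0; rewrite -subr_ge0 -[leLHS](_ : (fun t => t - sin t) 0 = 0); last by rewrite /= sin0 subr0.
have df (y : R) : is_derive y 1 (fun t => t - sin t) (1 - cos y) by exact: is_deriveB.
by apply: (ge0_of_derive df (b := x)); rewrite ?x0 ?lexx// => y _; rewrite subr_ge0 cos_le1.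
Qed.

Lemma abs_sin_le x : `|sin x| <= `|x|.
Proof.
have [x0|x0] := ltP 1 `|x|; first by rewrite (le_trans (sin_max x))// ltW.
wlog : x x0 / 0 <= x => [W|xp].
  have [|/ltW xn] := leP 0 x; first exact: W.
  by have := W (- x); rewrite sinN !normrN; apply; rewrite // oppr_ge0.
rewrite (ger0_norm xp) in x0 *; rewrite ger0_norm ?sin_le_id//.
by apply: sin_ge0_pi; rewrite xp (le_trans x0)// (le_trans _ (pi_ge2 _))// ler1n.
Qed.

Lemma cos_double x : 1 - cos x = 2 * sin (x / 2) ^+ 2.
Proof.
have {1}-> : x = (x / 2) *+ 2 by rewrite mulr2n -splitr.
by rewrite cos_mulr2n sin2cos2 -mulr_natl; ring.
Qed.

Lemma one_sub_cos_le x : 1 - cos x <= x ^+ 2 / 2.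
Proof.
rewrite cos_double; have := abs_sin_le (x / 2).
rewrite -(@ler_pXn2r _ 2)// ?nnegrE// !real_normK ?num_real//; nra.
Qed.

(** For [u >= 0] the right side minus the left has derivative [sin u + cos u - 1], nonnegative on
    [[0, pi / 2]]. This trades an angle for its sine at the cost of a [1 - cos] term. *)
Lemma id_sub_sin_le u : `|u| <= pi / 2 -> `|u - sin u| <= 1 - cos u.
Proof.
wlog : u / 0 <= u => [W u2|u0].
  have [|/ltW un] := leP 0 u; first by move/W; apply.
  have := W (- u); rewrite oppr_ge0 normrN sinN cosN opprK => /(_ un u2).
  by rewrite -normrN opprD opprK.
rewrite ger0_norm// => u2; rewrite ger0_norm ?subr_ge0 ?sin_le_id//.
rewrite -subr_ge0; pose f (t : R) := 1 - cos t - (t - sin t).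
rewrite -[leLHS](_ : f 0 = 0); last by rewrite /f cos0 sin0; ring.
have df (y : R) : is_derive y 1 f (0 - - sin y - (1 - cos y)) by exact: is_deriveB.
apply: (ge0_of_derive df (b := pi / 2)); rewrite ?u0// => y /andP[y0 y2].
have s0 : 0 <= sin y.
  by apply: sin_ge0_pi; rewrite y0 (le_trans y2)// ler_pdivrMr// ler_peMr ?pi_ge0// ler1n.
have k0 : 0 <= cos y.
  by apply: cos_ge0_pihalf; rewrite y2 (le_trans _ y0)// oppr_le0 divr_ge0// pi_ge0.
by have := cos2Dsin2 y; nra.
Qed.

Lemma expR_ge1D x : 1 + x <= expR x.
Proof.
have [->|x0] := eqVneq x 0; first by rewrite expR0 addr0.
by apply: ltW; exact: expR_gt1Dx.
Qed.

Lemma expR_taylor1 x : `|x| <= 1 / 2 -> `|expR x - 1 - x| <= 2 * x ^+ 2.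
Proof.
rewrite ler_norml => /andP[x1 x2]; have h1 := expR_ge1D x; have h2 := expR_ge1D (- x).
have e0 := expR_gt0 x; have e1 : expR x * expR (- x) = 1 by rewrite -expRD subrr expR0.
rewrite ger0_norm; last lra.
have : expR x * (1 - x) <= 1 by rewrite -[leRHS]e1 ler_pM2l//; lra.
nra.
Qed.

Lemma cexpD z w : cexp (z + w) = cexp z * cexp w.
Proof.
rewrite /cexp cReD cImD expRD cosD sinD.
by apply: complex_eqP => /=; ring.
Qed.

Lemma cexp0 : cexp (0 : C) = 1.
Proof. by rewrite /cexp /= expR0 cos0 sin0 mul1r. Qed.

Lemma cexp_neq0 z : cexp z != 0.
Proof.
have : cexp z * cexp (- z) = 1 by rewrite -cexpD subrr cexp0.
by apply: contra_eq_neq => ->; rewrite mul0r eq_sym oner_eq0.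
Qed.

Lemma cexp_sum (I : Type) (r : seq I) (F : I -> C) :
  cexp (\sum_(i <- r) F i) = \prod_(i <- r) cexp (F i).
Proof. by elim: r => [|i r IH]; rewrite ?big_nil ?cexp0// !big_cons cexpD IH. Qed.

Lemma cexp_i x : cexp (0 +i* x) = (expi x : C).
Proof. by rewrite /cexp /= expR0 mul1r. Qed.

Lemma cabs_cexp z : cabs (cexp z) = expR (Re z).
Proof.
by rewrite /cexp cabsM (cabs_circle (expi (Im z))) mulr1 cabsR ger0_norm//.
Qed.

Lemma cexp_le z : cabs (cexp z) <= expR (cabs z).
Proof. by rewrite cabs_cexp ler_expR Re_le_cabs. Qed.

Lemma pihalf_gt1 : 1 < pi / 2 :> R.
Proof.
rewrite lt_neqAle pihalf_ge1 andbT; apply/eqP => E.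
by have := @cos1_gt0 R; rewrite E cos_pihalf ltxx.
Qed.

Lemma cexp_taylor1 z : cabs z <= 1 / 2 -> cabs (cexp z - 1 - z) <= 8 * cabs z ^+ 2.
Proof.
move=> zs; have zr := le_trans (cabs_Re z) zs; have zi := le_trans (cabs_Im z) zs.
apply: le_trans (cabs_le_ReIm _) _.
rewrite !cReD !cReN !cImD !cImN /cexp cReM cImM /= !mul0r subr0 addr0 oppr0 addr0.
rewrite cabs_sqr; move: (Re z) (Im z) zr zi => x y xs ys.
have ex := expR_taylor1 xs; have cy := one_sub_cos_le y; have cy0 := cos_le1 y.
have sy := abs_sin_le y; have p1 := pihalf_gt1.
have y1 : `|y| <= pi / 2 by lra.
have dy := id_sub_sin_le y1.
have xx : `|x| ^+ 2 = x ^+ 2 by rewrite real_normK// num_real.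
have yy : `|y| ^+ 2 = y ^+ 2 by rewrite real_normK// num_real.
have x0 := normr_ge0 x; have y0 := normr_ge0 y.
have e2 : `|expR x - 1| <= 2 * `|x|.
  rewrite (_ : expR x - 1 = expR x - 1 - x + x); last by ring.
  rewrite (le_trans (ler_normD _ _))//; nra.
have e3 : expR x <= 2 by move: e2; rewrite ler_norml => /andP[_]; lra.
have eg := expR_gt0 x.
have hr : `|expR x * cos y - 1 - x| <= 2 * x ^+ 2 + y ^+ 2.
  rewrite (_ : _ - _ - _ = (expR x - 1 - x) - expR x * (1 - cos y)); last by ring.
  rewrite (le_trans (ler_normB _ _))// lerD//.
  rewrite ger0_norm; last by rewrite mulr_ge0 ?subr_ge0 ?(ltW eg).
  nra.
have hi : `|expR x * sin y - y| <= 2 * (`|x| * `|y|) + y ^+ 2 / 2.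
  rewrite (_ : _ - _ = (expR x - 1) * sin y - (y - sin y)); last by ring.
  rewrite (le_trans (ler_normB _ _))// lerD//; last exact: le_trans dy cy.
  rewrite normrM mulrA; apply: ler_pM => //.
nra.
Qed.

(** Telescoping, one factor exchanged at a time; the bounds [expR (c i)] keep partial products under
    control however many factors there are. *)
Lemma prod_diff (I : Type) (r : seq I) (A B : I -> C) (c : I -> R) :
  (forall i, 0 <= c i) -> (forall i, cabs (A i) <= expR (c i)) ->
  (forall i, cabs (B i) <= expR (c i)) ->
  cabs (\prod_(i <- r) A i - \prod_(i <- r) B i) <=
  (\sum_(i <- r) cabs (A i - B i)) * expR (\sum_(i <- r) c i).
Proof.
move=> c0 Ac Bc; elim: r => [|i r IH].
  by rewrite !big_nil subrr cabs0 mul0r.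
rewrite !big_cons expRD.
have -> : A i * \prod_(j <- r) A j - B i * \prod_(j <- r) B j =
    (A i - B i) * \prod_(j <- r) A j + B i * (\prod_(j <- r) A j - \prod_(j <- r) B j) by ring.
apply: le_trans (cabsD _ _) _; rewrite !cabsM.
have PA : cabs (\prod_(j <- r) A j) <= expR (\sum_(j <- r) c j).
  elim: (r) => [|j s IHs]; first by rewrite !big_nil cabs1 expR0.
  by rewrite !big_cons cabsM expRD; apply: ler_pM; rewrite ?cabs_ge0.
have S0 : 0 <= \sum_(j <- r) cabs (A j - B j) by apply: sumr_ge0 => j _; exact: cabs_ge0.
have e1 : 1 <= expR (c i) by rewrite -expR0 ler_expR.
have h1 : cabs (A i - B i) * cabs (\prod_(j <- r) A j) <=
    cabs (A i - B i) * (expR (c i) * expR (\sum_(j <- r) c j)).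
  rewrite ler_wpM2l ?cabs_ge0// (le_trans PA)// ler_peMl// expR_ge0.
have h2 : cabs (B i) * cabs (\prod_(j <- r) A j - \prod_(j <- r) B j) <=
    expR (c i) * ((\sum_(j <- r) cabs (A j - B j)) * expR (\sum_(j <- r) c j)).
  by apply: ler_pM; rewrite ?cabs_ge0.
apply: le_trans (lerD h1 h2) _.
by rewrite mulrDl [X in _ + X <= _]mulrCA.
Qed.

End scalar_estimates.

(** * Centering of a single measure *)

Section centering.
Context {R : realType}.
Local Notation C := R[i].
Local Notation T := (circle R).
Implicit Types (mu : probability T R) (u : T) (z w : C).

(** [dist1] measures infinitesimality; [sdev] is the mass contributed by [mu] to [sigma_n], and
    [tdev] its contribution to the angle of [gamma_n] besides that of [b_center]. *)
Definition dist1 mu : R := absint mu (fun u => (u : C) - 1).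
Definition sdev mu : R := \int[centered mu]_u (1 - Re u).
Definition tdev mu : R := \int[centered mu]_u Im u.

Lemma cont_sub1 : continuous (fun u => (u : C) - 1).
Proof. exact: (contB cont_circle (@contC _ _ 1)). Qed.

Lemma cont_oneRe : continuous (fun u => 1 - Re u).
Proof. exact: (contB (@contC _ _ 1) (continuous_Re cont_circle)). Qed.

Lemma dist1_ge0 mu : 0 <= dist1 mu. Proof. exact: absint_ge0. Qed.

Lemma cont_rot (V : topologicalType) (b : T) (f : T -> V) :
  continuous f -> continuous (fun u => f (rot b u)).
Proof. by move=> cf u; apply: (continuous_comp (@rot_continuous R b u)); exact: cf. Qed.

Lemma Rintegral_centered mu (f : T -> R) : continuous f ->
  \int[centered mu]_u f u = \int[mu]_u f (rot (b_center mu) u).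
Proof.
move=> cf; rewrite /Rintegral /centered integral_distribution//.
  by apply/measurable_EFinP; exact: continuous_circle_measurable.
exact: (continuous_integrable mu (cont_rot (b := b_center mu) cf)).
Qed.

Lemma cintegral_centered mu (f : T -> C) : continuous f ->
  cintegral (centered mu) f = cintegral mu (fun u => f (rot (b_center mu) u)).
Proof.
move=> cf; rewrite /cintegral.
rewrite (Rintegral_centered mu (continuous_Re cf)).
by rewrite (Rintegral_centered mu (continuous_Im cf)).
Qed.

Lemma rotK (b u : T) : (b : C) * (rot b u : C) = u.
Proof. by rewrite /= mulrC divfK// circle_neq0. Qed.

(** Put [u = b v], with [v] distributed by the centered measure: [z u] becomes [(b z) v], and the
    numerator gives off a factor [b]. *)
Lemma Btr_centered mu z : cabs z < 1 ->
  Btr mu z = (b_center mu : C) * Btr (centered mu) ((b_center mu : C) * z).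
Proof.
move=> z1; set b := b_center mu.
have bz1 : cabs ((b : C) * z) < 1 by rewrite cabsM cabs_circle mul1r.
have c1 : continuous (fun _ : T => 1 : C) by exact: (@contC T C 1).
have E u : 1 - (b : C) * z * (rot b u : C) = 1 - z * (u : C).
  by rewrite mulrAC rotK [(u : C) * z]mulrC.
have DE : Dtr (centered mu) ((b : C) * z) = Dtr mu z.
  rewrite /Dtr /ctr cintegral_centered; last exact: (cont_ctr c1 bz1).
  by congr cintegral; apply: funext => u; rewrite E.
have NE : (b : C) * Ntr (centered mu) ((b : C) * z) = Ntr mu z.
  rewrite /Ntr /ctr cintegral_centered; last exact: (cont_ctr cont_circle bz1).
  rewrite -cintegralZ; last first.
    exact: (cont_rot (b := b) (cont_ctr cont_circle bz1)).
  by congr cintegral; apply: funext => u; rewrite E mulrA rotK.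
by rewrite /Btr mulrA NE DE.
Qed.

Lemma mean_centered mu : mean mu = (b_center mu : C) * mean (centered mu).
Proof.
have h : cabs (0 : C) < 1 by rewrite cabs0.
by rewrite -!Btr0 (Btr_centered mu h) mulr0.
Qed.

Lemma mean_centeredE mu : mean (centered mu) = (1 - sdev mu) +i* tdev mu.
Proof.
rewrite /mean /cintegral /tdev /sdev; congr (_ +i* _).
rewrite RintegralB//; last 2 first.
- exact: (continuous_integrable (centered mu) (@contC T R 1)).
- exact: (continuous_integrable (centered mu) (continuous_Re cont_circle)).
by rewrite Rintegral_mass mass_prob mul1r subKr.
Qed.

Lemma sdev_ge0 mu : 0 <= sdev mu.
Proof.
by apply: Rintegral_ge0 => u _; have /andP[_] := circle_Re_itv u; rewrite subr_ge0.
Qed.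

Let E1 : set T := [set u | `|arg u| < 1].

Let mE1 : measurable E1.
Proof.
rewrite (_ : E1 = setT `&` (@arg R) @^-1` `]-1, 1[%classic).
  exact: measurable_arg.
by apply/seteqP; split => x /=; rewrite /E1 /= in_itv /= ltr_norml// => -[].
Qed.

Definition balpha mu : R := \int[mu]_(u in E1) arg u.

Lemma b_centerE mu : b_center mu = expi (balpha mu). Proof. by []. Qed.

Let farg u : R := arg u * \1_E1 u.

Let farg_bound u : `|farg u| <= 1.
Proof.
rewrite /farg indicE; have [uE|uE] := boolP (u \in E1); last by rewrite mulr0 normr0.
by rewrite mulr1 ltW//; move: uE; rewrite inE.
Qed.

Let mind : measurable_fun setT (\1_E1 : T -> R).
Proof. exact: measurable_realfun.measurable_indic. Qed.

Let mfarg : measurable_fun setT farg.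
Proof. exact: (measurable_funM measurable_arg mind). Qed.

Let ifarg mu : mu.-integrable setT (EFin \o farg).
Proof. exact: (bounded_measurable_integrable mu mfarg farg_bound). Qed.

Lemma balphaE mu : balpha mu = \int[mu]_u farg u.
Proof.
rewrite /balpha Rintegral_mkcond; congr (Rintegral mu _); apply: funext => u.
by rewrite patchE /farg indicE; case: ifP => _; rewrite ?mulr1 ?mulr0.
Qed.

Lemma sin_arg u : sin (arg u) = Im u /\ cos (arg u) = Re u.
Proof. by have := argK u => /(congr1 (@cval R)) /= <-. Qed.

Lemma farg_le u : `|farg u| <= 2 * cabs ((u : C) - 1).
Proof.
rewrite /farg indicE; have [uE|uE] := boolP (u \in E1); last first.
  by rewrite mulr0 normr0 mulr_ge0 ?cabs_ge0.
rewrite mulr1; have {uE}a1 : `|arg u| < 1 by move: uE; rewrite inE.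
have a2 : `|arg u| <= pi / 2 by have := @pihalf_gt1 R; lra.
have h1 := id_sub_sin_le a2; have h2 := one_sub_cos_le (arg u).
have h3 : `|Im u| <= cabs ((u : C) - 1).
  by rewrite (_ : Im u = Im ((u : C) - 1)) ?cabs_Im// cImD /= oppr0 addr0.
have [s _] := sin_arg u; rewrite -s in h3.
have h4 : `|arg u| <= `|arg u - sin (arg u)| + `|sin (arg u)|.
  by rewrite -{1}[arg u](subrK (sin (arg u))) ler_normD.
have h5 : arg u ^+ 2 <= `|arg u|.
  by rewrite -real_normK ?num_real// expr2 ler_piMl// ltW.
lra.
Qed.

Lemma balpha_le mu : `|balpha mu| <= 2 * dist1 mu.
Proof.
rewrite balphaE; apply: le_trans (le_normr_Rintegral measurableT (ifarg mu)) _.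
rewrite /dist1 /absint -RintegralZl//; last first.
  exact: (continuous_integrable mu (continuous_cabs cont_sub1)).
apply: le_Rintegral => //.
- by have := integrable_abse (ifarg mu); apply: eq_integrable => // x _.
- exact: (continuous_integrable mu (contM (@contC T R 2) (continuous_cabs cont_sub1))).
- by move=> u _; exact: farg_le.
Qed.

Lemma b_center_le mu : cabs ((b_center mu : C) - 1) <= 2 * dist1 mu.
Proof.
apply: le_trans (balpha_le mu); rewrite b_centerE; set a := balpha mu.
rewrite -(@ler_pXn2r _ 2)// ?nnegrE ?cabs_ge0// circle_sub1_sqr real_normK ?num_real//=.
by have := one_sub_cos_le a; lra.
Qed.

Lemma dist1_centered mu : dist1 (centered mu) <= 3 * dist1 mu.
Proof.
rewrite {1}/dist1 /absint (Rintegral_centered mu (continuous_cabs cont_sub1)).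
set b := b_center mu.
have -> : 3 * dist1 mu = \int[mu]_u (cabs ((u : C) - 1) + 2 * dist1 mu).
  rewrite RintegralD//; last 2 first.
  - exact: (continuous_integrable mu (continuous_cabs cont_sub1)).
  - exact: (continuous_integrable mu (@contC T R _)).
  by rewrite Rintegral_mass mass_prob mulr1 -/(absint mu _) -/(dist1 mu); lra.
apply: le_Rintegral => //.
- exact: (continuous_integrable mu (cont_rot (b := b) (continuous_cabs cont_sub1))).
- exact: (continuous_integrable mu (contD (continuous_cabs cont_sub1) (@contC T R _))).
move=> u _; rewrite -[leLHS]mul1r -[X in X * _](cabs_circle b) -cabsM mulrBr rotK mulr1.
apply: le_trans (cabs_tri 1 _ _) _; rewrite lerD2l cabsC.
exact: b_center_le.
Qed.

Lemma sdev_le_dist1 mu : sdev mu <= 3 * dist1 mu.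
Proof.
apply: le_trans (dist1_centered mu); apply: le_Rintegral => //.
- exact: (continuous_integrable (centered mu) cont_oneRe).
- exact: (continuous_integrable (centered mu) (continuous_cabs cont_sub1)).
move=> u _; rewrite cabsC.
by apply: le_trans (Re_le_cabs _); rewrite cReD cReN.
Qed.

(** For [|a|] below this, [|arg u| < 1] forces [|arg u - a| <= pi / 2], and [|arg u| >= 1] forces
    [|arg u - a| >= 1 / 2]: the two cases of [centering_pointwise]. *)
Definition center_threshold : R := Num.min (1 / 2) (pi / 2 - 1).
Definition center_const : R := 1 + 2 / (1 - cos (1 / 2)).

Lemma cos_half_lt1 : cos (1 / 2) < 1 :> R.
Proof.
have p := @pi_ge2 R; rewrite -[ltRHS]cos0.
have h1 : (1 / 2 : R) \in `[0, pi] by rewrite in_itv /=; apply/andP; split; lra.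
have h0 : (0 : R) \in `[0, pi] by rewrite in_itv /=; apply/andP; split; lra.
by rewrite (ltr_cos h0 h1); lra.
Qed.

Lemma center_threshold_gt0 : 0 < center_threshold.
Proof. by rewrite lt_min subr_gt0 pihalf_gt1 andbT; lra. Qed.

Lemma center_const_ge1 : 1 <= center_const.
Proof. by rewrite lerDl divr_ge0// subr_ge0 ltW// cos_half_lt1. Qed.

Lemma cos_far (v : R) : 1 / 2 <= `|v| <= pi + 1 / 2 -> cos v <= cos (1 / 2).
Proof.
rewrite -(cos_norm v); move: `|v| => x /andP[x1 x2].
have pi2 := @pi_ge2 R.
have c0 : 0 <= cos (1 / 2) :> R by apply: cos_ge0_pihalf; have := @pihalf_gt1 R; lra.
have [xp|px] := leP x pi.
  move: x1; rewrite le_eqVlt => /predU1P[->//|x1]; apply: ltW.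
  by rewrite ltr_cos// in_itv /=; apply/andP; split; lra.
have -> : x = (x - pi) + pi by rewrite subrK.
rewrite cosDpi; apply: le_trans c0; rewrite oppr_le0.
by apply: cos_ge0_pihalf; have := @pihalf_gt1 R; lra.
Qed.

(** Put [v = arg u - a]. Inside [E1] the left side is [|v - sin v|], at most [1 - cos v]; outside it
    is at most 2, while [1 - cos v] is at least [1 - cos (1 / 2)]. *)
Lemma centering_pointwise (a : R) u : `|a| <= center_threshold ->
  `|sin (arg u - a) - (farg u - a * \1_E1 u)| + `|a| * (1 - \1_E1 u) <=
  center_const * (1 - cos (arg u - a)).
Proof.
rewrite le_min => /andP[a1 a2]; have cc := center_const_ge1.
have k0 := cos_le1 (arg u - a); have ar := arg_bounds u.
rewrite /farg indicE; have [uE|uE] := boolP (u \in E1).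
  rewrite !mulr1 subrr mulr0 addr0 -[leLHS]normrN opprB.
  have {uE}u1 : `|arg u| < 1 by move: uE; rewrite inE.
  apply: le_trans (id_sub_sin_le _) _.
    by rewrite (le_trans (ler_normB _ _))//; lra.
  by rewrite ler_peMl// subr_ge0.
rewrite !(mulr0, subr0, mulr1).
have {uE}u1 : 1 <= `|arg u|.
  by rewrite leNgt; apply/negP => h; move/negP : uE; apply; rewrite inE.
have hu : `|arg u| <= pi by rewrite ler_norml; apply/andP; split; lra.
have f1 : 1 / 2 <= `|arg u - a|.
  by have := lerB_dist (arg u) a; lra.
have f2 : `|arg u - a| <= pi + 1 / 2.
  by rewrite (le_trans (ler_normB _ _))//; lra.
have far : cos (arg u - a) <= cos (1 / 2) by apply: cos_far; rewrite f1.
have sm := sin_max (arg u - a); have hh := cos_half_lt1.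
apply: (@le_trans _ _ 2); first lra.
apply: (@le_trans _ _ (2 / (1 - cos (1 / 2)) * (1 - cos (arg u - a)))).
  by rewrite mulrAC ler_pdivlMr ?subr_gt0//; lra.
by rewrite ler_wpM2r ?subr_ge0// /center_const lerDr.
Qed.

(* Centering makes the first-order term [tdev] negligible against the          *)
(* second-order one: the integral of [arg - a] over [|arg| < 1] is             *)
(* [a * mu (|arg| >= 1)].                                                      *)
Lemma tdev_le mu : `|balpha mu| <= center_threshold ->
  `|tdev mu| <= center_const * sdev mu.
Proof.
move=> ath; set a := balpha mu in ath *.
have rE u : (rot (b_center mu) u : C) = (expi (arg u - a) : C).
  by rewrite expiD expiN argK.
have tE : tdev mu = \int[mu]_u sin (arg u - a).
  rewrite /tdev (Rintegral_centered mu (continuous_Im cont_circle)).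
  by congr (Rintegral mu _); apply: funext => u; rewrite rE.
have sE : sdev mu = \int[mu]_u (1 - cos (arg u - a)).
  rewrite /sdev (Rintegral_centered mu cont_oneRe).
  by congr (Rintegral mu _); apply: funext => u; rewrite rE.
have csin : continuous (fun u => sin (arg u - a)).
  have := cont_rot (b := b_center mu) (continuous_Im cont_circle).
  by under eq_fun do rewrite rE.
have ccos : continuous (fun u => 1 - cos (arg u - a)).
  have := cont_rot (b := b_center mu) cont_oneRe.
  by under eq_fun do rewrite rE.
have isin := continuous_integrable mu csin.
have iE1 : mu.-integrable setT (EFin \o (\1_E1 : T -> R)).
  apply: (bounded_measurable_integrable mu (M := 1)) => // z.
  by rewrite indicE; case: (_ \in _); rewrite ?normr1 ?normr0.
pose g u := sin (arg u - a) - (farg u - a * \1_E1 u) + a * (1 - \1_E1 u).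
have gE u : g u = sin (arg u - a) + (a - farg u) by rewrite /g; ring.
have ia : mu.-integrable setT (EFin \o (fun u => a - farg u)).
  have := integrableB measurableT (continuous_integrable mu (@contC T R a)) (ifarg mu).
  by apply: eq_integrable => // u _ /=; rewrite EFinB.
have ig : mu.-integrable setT (EFin \o g).
  have := integrableD measurableT isin ia.
  by apply: eq_integrable => // u _ /=; rewrite gE EFinD.
have -> : tdev mu = \int[mu]_u g u.
  rewrite tE; under [RHS]eq_Rintegral do rewrite gE.
  rewrite (RintegralD measurableT isin ia).
  rewrite (RintegralB measurableT (continuous_integrable mu (@contC T R a)) (ifarg mu)).
  by rewrite -balphaE -/a Rintegral_mass mass_prob mulr1 subrr addr0.
apply: le_trans (le_normr_Rintegral measurableT ig) _.
rewrite sE -RintegralZl//; last exact: (continuous_integrable mu ccos).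
apply: le_Rintegral => //.
- by have := integrable_abse ig; apply: eq_integrable => // x _.
- exact: (continuous_integrable mu (contM (@contC T R _) ccos)).
move=> u _; apply: le_trans (centering_pointwise u ath).
rewrite /g (le_trans (ler_normD _ _))// lerD2l normrM ler_wpM2l//.
by rewrite indicE; case: (_ \in _); rewrite ?subrr ?subr0 ?normr0 ?normr1.
Qed.

End centering.

(** * First-order expansion of B and products along a row *)

Section row_estimates.
Context {R : realType}.
Local Notation C := R[i].
Local Notation T := (circle R).
Implicit Types (mu : probability T R) (u : T) (z w : C).

Let hker u : C := (1 - Re u)%:C.

Let cabs2 : cabs (2 : C) = 2.
Proof. by rewrite (_ : (2 : C) = (2 : R)%:C) ?cabsR ?ger0_norm// rmorph_nat. Qed.

Let c1 : continuous (fun _ : T => 1 : C). Proof. exact: (@contC T C 1). Qed.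

Lemma cont_real (f : T -> R) : continuous f -> continuous (fun u => (f u)%:C).
Proof. by move=> cf; apply/continuous_ReIm; split => //=; exact: contC. Qed.

Let chker : continuous hker. Proof. exact: (cont_real cont_oneRe). Qed.

Lemma absint_hker mu : absint (centered mu) hker = sdev mu.
Proof.
rewrite /absint /sdev; congr (Rintegral _ _); apply: funext => u.
by rewrite cabsR ger0_norm// subr_ge0; have /andP[] := circle_Re_itv u.
Qed.

(* The two parts of [log (1 / B_mu)] to first order, for the centered measure: *)
(* [int (1 + u w) / (1 - u w) (1 - Re u)] and [- i int Im u].                  *)
Definition hpart mu w : C := 2 * ctr (centered mu) hker w - (sdev mu)%:C.
Definition hfun mu w : C := hpart mu w - (0 +i* tdev mu).

(** Here [B = N / D = 1 - hfun / qfun] for the centered measure, with [qfun] close to 1. *)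
Let qfun mu w : C := (1 - w) * Dtr (centered mu) w.

(** Holds because [u^* = u^-1] on the circle. Integrated, it shows that [(1 - w) (D - N)] is of
    order [sdev], given the bound on [tdev]. *)
Lemma circle_identity u w : cabs w < 1 ->
  (1 - w) * (1 - (u : C)) / (1 - w * (u : C)) =
  2 * (hker u / (1 - w * (u : C))) - hker u - (0 +i* Im u).
Proof.
move=> w1; have d0 := denom_neq0 u w1; have u0 := circle_neq0 u.
have half (x : C) : x = (x + x) / 2 by field.
have hE : hker u = (1 + 1 - ((u : C) + (u : C)^-1)) / 2.
  rewrite [LHS]half; congr (_ / _).
  by rewrite circle_conj /hker; case: (cval u) => x y; apply: complex_eqP => /=; ring.
have iE : (0 +i* Im u : C) = ((u : C) - (u : C)^-1) / 2.
  rewrite [LHS]half; congr (_ / _).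
  by rewrite circle_conj; case: (cval u) => x y; apply: complex_eqP => /=; ring.
by rewrite hE iE; field; apply/andP.
Qed.

Lemma hfunE mu w : cabs w < 1 ->
  (1 - w) * (Dtr (centered mu) w - Ntr (centered mu) w) = hfun mu w.
Proof.
move=> w1; set m := centered mu.
have cD := cont_ctr c1 w1; have cN := cont_ctr cont_circle w1; have ch := cont_ctr chker w1.
have cI : continuous (fun u => (0 +i* Im u : C)).
  by apply/continuous_ReIm; split => /=; [exact: contC|exact: (continuous_Im cont_circle)].
have c2h : continuous (fun u => 2 * (hker u / (1 - w * (u : C)))).
  exact: (contM (@contC T C 2) ch).
rewrite /Dtr /Ntr /ctr -(cintegralB m cD cN).
rewrite -(cintegralZ m (1 - w) (contB cD cN)).
rewrite (_ : (fun _ => _) = fun u => 2 * (hker u / (1 - w * (u : C))) - hker u - (0 +i* Im u)).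
  rewrite (cintegralB m (contB c2h chker) cI) (cintegralB m c2h chker) (cintegralZ m 2 ch).
  rewrite /hfun /hpart; congr (_ - _ - _).
    by rewrite /cintegral /hker /= Rintegral_mass mul0r.
  by rewrite /cintegral /= Rintegral_mass mul0r.
apply: funext => u; rewrite -circle_identity//.
by have d0 := denom_neq0 u w1; field.
Qed.

Lemma hpart_bound mu w (r : R) : cabs w <= r -> r < 1 ->
  cabs (hpart mu w) <= (2 / (1 - r) + 1) * sdev mu.
Proof.
move=> wr r1; have := ctr_bound (centered mu) chker wr r1; rewrite absint_hker => h.
apply: le_trans (cabsB _ _) _; rewrite cabsM cabsR ger0_norm ?sdev_ge0//.
rewrite cabs2.
apply: (@le_trans _ _ (2 * ((1 - r)^-1 * sdev mu) + sdev mu)).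
  by rewrite lerD2r ler_pM2l.
by rewrite le_eqVlt; apply/orP; left; apply/eqP; ring.
Qed.

Lemma hpart_lip mu w z (r : R) : cabs w <= r -> cabs z <= r -> r < 1 ->
  cabs (hpart mu w - hpart mu z) <= 2 * (1 - r) ^- 2 * sdev mu * cabs (w - z).
Proof.
move=> wr zr r1; have := ctr_lip (centered mu) chker wr zr r1; rewrite absint_hker => h.
rewrite /hpart opprB addrA addrNK -mulrBr cabsM.
rewrite cabs2.
by rewrite -!mulrA ler_pM2l// mulrA.
Qed.

Lemma hfun_lip mu w z (r : R) : cabs w <= r -> cabs z <= r -> r < 1 ->
  cabs (hfun mu w - hfun mu z) <= 2 * (1 - r) ^- 2 * sdev mu * cabs (w - z).
Proof.
move=> wr zr r1; apply: le_trans (hpart_lip mu wr zr r1).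
by rewrite /hfun opprB addrA addrNK.
Qed.

Lemma hfun_bound mu w (r : R) : cabs w <= r -> r < 1 -> `|balpha mu| <= center_threshold ->
  cabs (hfun mu w) <= (2 / (1 - r) + 1 + center_const) * sdev mu.
Proof.
move=> wr r1 /tdev_le tC; apply: le_trans (cabsB _ _) _.
rewrite mulrDl lerD ?hpart_bound//; apply: le_trans tC.
by apply: le_trans (cabs_le_ReIm _) _; rewrite /= normr0 add0r.
Qed.

Let q_bound mu w (r : R) : cabs w <= r -> r < 1 ->
  cabs (qfun mu w - 1) <= 3 / (1 - r) * dist1 mu.
Proof.
move=> wr r1; have w1 := le_lt_trans wr r1; have r0 : 0 < 1 - r by rewrite subr_gt0.
have := ctr_bound (centered mu) cont_sub1 wr r1; rewrite -/(dist1 _) => h.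
have -> : qfun mu w - 1 = w * ctr (centered mu) (fun u => (u : C) - 1) w.
  have -> : ctr (centered mu) (fun u => (u : C) - 1) w =
      Ntr (centered mu) w - Dtr (centered mu) w.
    rewrite /ctr -(cintegralB _ (cont_ctr cont_circle w1) (cont_ctr c1 w1)).
    by congr cintegral; apply: funext => u; rewrite mulrBl.
  by rewrite /qfun DtrE//; ring.
rewrite cabsM (@le_trans _ _ (1 * ((1 - r)^-1 * dist1 (centered mu))))//.
  by apply: ler_pM; rewrite ?cabs_ge0// ltW.
rewrite mul1r (_ : 3 / (1 - r) * dist1 mu = (1 - r)^-1 * (3 * dist1 mu)); last by ring.
by rewrite ler_pM2l ?invr_gt0//; exact: dist1_centered.
Qed.

Let q_lower mu w (r : R) : cabs w <= r -> r < 1 -> 3 / (1 - r) * dist1 mu <= 1 / 2 ->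
  1 / 2 <= cabs (qfun mu w).
Proof.
move=> wr r1 d2; have := q_bound mu wr r1; have := cabs_lower 1 (1 - qfun mu w).
by rewrite subKr cabs1 cabsC; lra.
Qed.

Let Btr_q mu w (r : R) : cabs w <= r -> r < 1 -> 3 / (1 - r) * dist1 mu <= 1 / 2 ->
  Btr (centered mu) w = 1 - hfun mu w / qfun mu w.
Proof.
move=> wr r1 d2; have w1 := le_lt_trans wr r1.
have q2 := q_lower wr r1 d2.
have q0 : qfun mu w != 0 by rewrite -cabs_gt0; lra.
have : qfun mu w != 0 by []. 
rewrite {1}/qfun mulf_eq0 negb_or => /andP[w0 D0].
rewrite -hfunE// /Btr /qfun; field; exact/andP.
Qed.

Let bz mu z : C := (b_center mu : C) * z.
Let cabs_bz mu z : cabs (bz mu z) = cabs z.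
Proof. by rewrite cabsM cabs_circle mul1r. Qed.

(* Constants depend on the radius [r] only; [d] bounds [dist1] along the row.  *)
Definition rowbd (r : R) : R := 2 / (1 - r) + 1 + center_const.
(** The three terms ensure in turn that [|balpha|] is below [center_threshold], that [qfun] is
    within [1 / 2] of 1, and that [hfun] is at most [1 / 2]. *)
Definition rowd (r : R) : R :=
  Num.min (center_threshold / 2) (Num.min ((1 - r) / 6) ((6 * rowbd r)^-1)).

Lemma rowbd_ge1 r : r < 1 -> 1 <= rowbd r.
Proof.
move=> r1; rewrite /rowbd; have := @center_const_ge1 R.
have : 0 <= 2 / (1 - r) by rewrite divr_ge0// subr_ge0 ltW.
lra.
Qed.

Lemma rowd_gt0 r : r < 1 -> 0 < rowd r.
Proof.
move=> r1; have K1 := rowbd_ge1 r1; rewrite !lt_min !divr_gt0 ?center_threshold_gt0 ?subr_gt0//=.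
by rewrite invr_gt0; lra.
Qed.

Section one_measure.
Variables (r : R) (mu : probability T R).
Hypotheses (r01 : 0 <= r < 1) (dr : dist1 mu <= rowd r).

Let r1 : r < 1. Proof. by case/andP: r01. Qed.
Let r0 : 0 < 1 - r. Proof. by rewrite subr_gt0. Qed.
Let K := rowbd r.
Let K1 : 1 <= K. Proof. exact: rowbd_ge1. Qed.

Lemma row_threshold : `|balpha mu| <= center_threshold.
Proof.
have h : dist1 mu <= center_threshold / 2 by move: dr; rewrite /rowd le_min => /andP[].
by apply: le_trans (balpha_le mu) _; lra.
Qed.

Let d2 : 3 / (1 - r) * dist1 mu <= 1 / 2.
Proof.
move: dr; rewrite /rowd !le_min => /and3P[_ + _].
by rewrite mulrAC ler_pdivrMr//; lra.
Qed.

Let Ks : K * sdev mu <= 1 / 2.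
Proof.
have s3 := sdev_le_dist1 mu.
move: dr; rewrite /rowd !le_min => /and3P[_ _ dK].
have K6 : 0 < 6 * rowbd r by have := K1; rewrite /K; lra.
have : 6 * rowbd r * dist1 mu <= 1 by rewrite -[leRHS](divff (lt0r_neq0 K6)) ler_pM2l.
by have := K1; rewrite /K => k1; have := sdev_ge0 mu; nra.
Qed.

Lemma h_bound z : cabs z <= r -> cabs (hfun mu z) <= K * sdev mu.
Proof. by move=> zr; apply: hfun_bound => //; exact: row_threshold. Qed.

Lemma Btr_rowE z : cabs z <= r ->
  Btr mu z = (b_center mu : C) * (1 - hfun mu (bz mu z) / qfun mu (bz mu z)).
Proof.
move=> zr; have bzr : cabs (bz mu z) <= r by rewrite cabs_bz.
rewrite Btr_centered; last exact: le_lt_trans r1.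
by rewrite -/(bz mu z) (Btr_q bzr r1 d2).
Qed.

Lemma Btr_row_bound z : cabs z <= r -> cabs (Btr mu z) <= expR (2 * K * sdev mu).
Proof.
move=> zr; have bzr : cabs (bz mu z) <= r by rewrite cabs_bz.
rewrite Btr_rowE// cabsM cabs_circle mul1r; apply: le_trans (expR_ge1D _).
apply: le_trans (cabsB _ _) _; rewrite cabs1 lerD2l cabsM cabsV.
have q2 := q_lower bzr r1 d2; have h := h_bound bzr.
by rewrite ler_pdivrMr; last lra; have := cabs_ge0 (hfun mu (bz mu z)); nra.
Qed.

Lemma cexp_row_bound z : cabs z <= r -> cabs (cexp (- hfun mu z)) <= expR (2 * K * sdev mu).
Proof.
move=> zr; apply: le_trans (cexp_le _) _; rewrite cabsN ler_expR.
by have := h_bound zr; have := cabs_ge0 (hfun mu z); lra.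
Qed.

Definition rowbd2 : R := 6 * K / (1 - r) + 4 * (1 - r) ^- 2 + 24 * K ^+ 2.

(** [B] is [b (1 - h(b z) / q)]. Replacing [q] by 1, [b z] by [z] and [1 - h] by [exp(- h)] costs a
    multiple of [sdev * dist1] each time; for the last, the error [sdev ^ 2] is absorbed by
    [sdev <= 3 dist1]. *)
Lemma Btr_row_exp z : cabs z <= r ->
  cabs (Btr mu z - (b_center mu : C) * cexp (- hfun mu z)) <= rowbd2 * (sdev mu * dist1 mu).
Proof.
move=> zr; have bzr : cabs (bz mu z) <= r by rewrite cabs_bz.
rewrite Btr_rowE// -mulrBr cabsM cabs_circle mul1r.
have q2 := q_lower bzr r1 d2; have hb := h_bound bzr; have hz := h_bound zr.
have s0 := sdev_ge0 mu; have dd0 := dist1_ge0 mu; have s3 := sdev_le_dist1 mu.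
have q0 : qfun mu (bz mu z) != 0 by rewrite -cabs_gt0; lra.
set h1 := hfun mu (bz mu z) in hb *; set h := hfun mu z in hz *; set q := qfun _ _ in q2 q0 *.
have -> : 1 - h1 / q - cexp (- h) =
    h1 * (q - 1) / q + (h - h1) - (cexp (- h) - 1 - - h) by field.
have e1 : cabs (h1 * (q - 1) / q) <= 6 * K / (1 - r) * (sdev mu * dist1 mu).
  rewrite cabsM cabsV ler_pdivrMr; last lra.
  rewrite cabsM.
  have qb : cabs (q - 1) <= 3 / (1 - r) * dist1 mu by exact: q_bound.
  apply: (@le_trans _ _ (K * sdev mu * (3 / (1 - r) * dist1 mu))).
    by apply: ler_pM; rewrite ?cabs_ge0.
  rewrite (_ : K * sdev mu * _ = 6 * K / (1 - r) * (sdev mu * dist1 mu) * (1 / 2)); last first.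
    by field; rewrite gt_eqF.
  apply: ler_wpM2l => //; rewrite !mulr_ge0// ?invr_ge0 ?(ltW r0)//; have := K1; lra.
have e2 : cabs (h - h1) <= 4 * (1 - r) ^- 2 * (sdev mu * dist1 mu).
  apply: le_trans (hfun_lip mu zr bzr r1) _.
  have zb : cabs (z - bz mu z) <= 2 * dist1 mu.
    rewrite -{1}[z]mul1r /bz -mulrBl cabsM cabsC.
    apply: (@le_trans _ _ (2 * dist1 mu * 1)); last by rewrite mulr1.
    by apply: ler_pM; rewrite ?cabs_ge0 ?b_center_le// (le_trans zr)// ltW.
  apply: (@le_trans _ _ (2 * (1 - r) ^- 2 * sdev mu * (2 * dist1 mu))).
    by apply: ler_wpM2l => //; rewrite !mulr_ge0// invr_ge0 exprn_ge0// ltW.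
  by rewrite le_eqVlt; apply/orP; left; apply/eqP; ring.
have e3 : cabs (cexp (- h) - 1 - - h) <= 24 * K ^+ 2 * (sdev mu * dist1 mu).
  apply: le_trans (cexp_taylor1 _) _; first by rewrite cabsN (le_trans hz).
  rewrite cabsN; have h0 := cabs_ge0 h; have k1 := K1.
  apply: (@le_trans _ _ (8 * (K * sdev mu) ^+ 2)).
    by rewrite ler_pM2l// lerXn2r// nnegrE// mulr_ge0//; lra.
  have ss : sdev mu ^+ 2 <= 3 * (sdev mu * dist1 mu) by nra.
  by rewrite exprMn; have := ler_wpM2l (sqr_ge0 K) ss; lra.
apply: le_trans (cabsB _ _) _; apply: le_trans (lerD (cabsD _ _) (lexx _)) _.
by apply: le_trans (lerD (lerD e1 e2) e3) _; rewrite /rowbd2 -!mulrDl.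
Qed.

(** The squared modulus is [(1 - s) ^ 2 + t ^ 2] with [|t| <= C s], at most [1 - s] once
    [(1 + C ^ 2) s <= 1], hence at most [exp(- s)]. *)
Lemma mean_row_bound : (1 + center_const ^+ 2) * (3 * dist1 mu) <= 1 ->
  cabs (mean mu) <= expR (- sdev mu / 2).
Proof.
move=> dc; rewrite mean_centered cabsM cabs_circle mul1r.
rewrite -(@ler_pXn2r _ 2)// ?nnegrE ?cabs_ge0 ?expR_ge0//.
rewrite cabs_sqr mean_centeredE /= expr2 [leRHS]expr2 -expRD -splitr.
apply: le_trans (expR_ge1D _).
have tC := tdev_le row_threshold; have s0 := sdev_ge0 mu; have s3 := sdev_le_dist1 mu.
have tt : tdev mu ^+ 2 <= center_const ^+ 2 * sdev mu ^+ 2.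
  rewrite -exprMn -real_normK ?num_real// lerXn2r// nnegrE// mulr_ge0//.
  by have := @center_const_ge1 R; lra.
have : (1 + center_const ^+ 2) * sdev mu <= 1.
  by apply: le_trans dc; rewrite ler_pM2l//; have := sqr_ge0 (@center_const R); lra.
nra.
Qed.

End one_measure.

Definition rowbd3 : R := 8 + 16 * rowbd (1 / 4).

Let q4 : (1 / 4 : R) < 1. Proof. lra. Qed.
Let q04 : 0 <= (1 / 4 : R) < 1. Proof. by apply/andP; split; lra. Qed.

(** Since [B = b (1 - h / q)] and [h] has bound and Lipschitz constant of order [sdev], so has [B].
    Unlike in [Btr_lip], the constants can thus be summed over a row of any length. *)
Lemma Btr_row_lip mu z w : dist1 mu <= rowd (1 / 4) -> cabs z <= 1 / 4 -> cabs w <= 1 / 4 ->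
  cabs (Btr mu z - Btr mu w) <= rowbd3 * sdev mu * cabs (z - w).
Proof.
move=> dr zq wq; have bzq : cabs (bz mu z) <= 1 / 4 by rewrite cabs_bz.
have bwq : cabs (bz mu w) <= 1 / 4 by rewrite cabs_bz.
have d2 : 3 / (1 - 1 / 4) * dist1 mu <= 1 / 2.
  have : dist1 mu <= (1 - 1 / 4) / 6 by move: dr; rewrite /rowd !le_min => /and3P[].
  by rewrite mulrAC ler_pdivrMr; lra.
have qz := q_lower bzq q4 d2; have qw := q_lower bwq q4 d2.
rewrite !(Btr_rowE q04 dr)// -mulrBr cabsM cabs_circle mul1r.
have hw := h_bound q04 dr bwq; have hl := hfun_lip mu bzq bwq q4.
have ql : cabs (qfun mu (bz mu w) - qfun mu (bz mu z)) <= 4 * cabs (bz mu z - bz mu w).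
  have -> : qfun mu (bz mu w) - qfun mu (bz mu z) =
    - ((1 - bz mu w) * (Dtr (centered mu) (bz mu z) - Dtr (centered mu) (bz mu w)) -
       (bz mu z - bz mu w) * Dtr (centered mu) (bz mu z)) by rewrite /qfun; ring.
  rewrite cabsN; apply: le_trans (cabsB _ _) _; rewrite !cabsM.
  have D1 := Dtr_lip (centered mu) bzq bwq; have D2 := Dtr_bound (centered mu) bzq.
  have D3 : cabs (Dtr (centered mu) (bz mu z)) <= 4 / 3.
    by have := cabs_lower (Dtr (centered mu) (bz mu z)) 1; rewrite cabs1 cabsC; lra.
  have D4 : cabs (1 - bz mu w) <= 5 / 4 by have := cabsB 1 (bz mu w); rewrite cabs1; lra.
  have x0 := cabs_ge0 (bz mu z - bz mu w).
  have p1 := ler_pM (cabs_ge0 _) (cabs_ge0 _) D4 D1.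
  have p2 := ler_wpM2l x0 D3.
  lra.
have xE : cabs (bz mu z - bz mu w) = cabs (z - w) by rewrite /bz -mulrBr cabsM cabs_circle mul1r.
rewrite xE in hl ql.
have x0 := cabs_ge0 (z - w); have s0 := sdev_ge0 mu; have k1 := rowbd_ge1 q4.
have qz0 : qfun mu (bz mu z) != 0 by rewrite -cabs_gt0; lra.
have qw0 : qfun mu (bz mu w) != 0 by rewrite -cabs_gt0; lra.
set hz := hfun mu (bz mu z) in hl *; set hw' := hfun mu (bz mu w) in hl hw *.
set a := qfun mu (bz mu z) in ql qz qz0 *; set b := qfun mu (bz mu w) in ql qw qw0 *.
have -> : 1 - hz / a - (1 - hw' / b) = - ((hz - hw') / a + hw' * (b - a) / (a * b)).
  by field; apply/andP.
rewrite cabsN; apply: le_trans (cabsD _ _) _.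
have e1 : cabs ((hz - hw') / a) <= 8 * sdev mu * cabs (z - w).
  rewrite cabsM cabsV ler_pdivrMr; last lra.
  have : 2 * (1 - 1 / 4 : R) ^- 2 = 32 / 9 by field.
  move=> E; rewrite E in hl.
  have := ler_pM (_ : 0 <= 8 * sdev mu * cabs (z - w)) _ (lexx _) qz.
  have sx : 0 <= sdev mu * cabs (z - w) by rewrite mulr_ge0.
  by move=> /(_ _ _); rewrite -!mulrA => h; have := h _ _; lra.
have e2 : cabs (hw' * (b - a) / (a * b)) <= 16 * rowbd (1 / 4) * sdev mu * cabs (z - w).
  rewrite cabsM cabsV cabsM ler_pdivrMr; last by rewrite cabsM mulr_gt0//; lra.
  have p := ler_pM (cabs_ge0 _) (cabs_ge0 _) hw ql.
  have ab : 1 / 4 <= cabs (a * b).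
    by rewrite cabsM; have := ler_pM (_ : 0 <= 1 / 2 :> R) (_ : 0 <= 1 / 2 :> R) qz qw; lra.
  apply: le_trans p _.
  have X0 : 0 <= 16 * rowbd (1 / 4) * sdev mu * cabs (z - w) by rewrite !mulr_ge0//; lra.
  by have := ler_wpM2l X0 ab; lra.
by apply: le_trans (lerD e1 e2) _; rewrite /rowbd3 !mulrDl.
Qed.

Section one_row.
Variables (k : nat) (mu : 'I_k -> probability T R) (r d : R).
Hypotheses (r01 : 0 <= r < 1) (mud : forall j, dist1 (mu j) <= d) (dr : d <= rowd r).

Definition rowS : R := \sum_(j < k) sdev (mu j).

Lemma rowS_ge0 : 0 <= rowS.
Proof. by apply: sumr_ge0 => j _; exact: sdev_ge0. Qed.

Let mudr j : dist1 (mu j) <= rowd r. Proof. exact: le_trans dr. Qed.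
Let r1 : r < 1. Proof. by case/andP: r01. Qed.

(** Each factor is off by a multiple of [d * sdev], so the total is of order [d * rowS] and not of
    order [k d]. *)
Lemma row_product z : cabs z <= r ->
  cabs (\prod_(j < k) Btr (mu j) z -
        \prod_(j < k) ((b_center (mu j) : C) * cexp (- hfun (mu j) z))) <=
  rowbd2 r * d * rowS * expR (2 * rowbd r * rowS).
Proof.
move=> zr; have K1 := rowbd_ge1 r1.
have c0 (j : 'I_k) : 0 <= 2 * rowbd r * sdev (mu j) by rewrite !mulr_ge0 ?sdev_ge0//; lra.
have Ac (j : 'I_k) := Btr_row_bound r01 (mudr j) zr.
have Bc (j : 'I_k) : cabs ((b_center (mu j) : C) * cexp (- hfun (mu j) z)) <=
    expR (2 * rowbd r * sdev (mu j)).
  by rewrite cabsM cabs_circle mul1r; exact: (cexp_row_bound r01 (mudr j) zr).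
apply: le_trans (prod_diff _ c0 Ac Bc) _; rewrite -mulr_sumr -/rowS.
rewrite ler_wpM2r ?expR_ge0// /rowS mulr_sumr; apply: ler_sum => j _.
apply: le_trans (Btr_row_exp r01 (mudr j) zr) _.
have K20 : 0 <= rowbd2 r.
  have r0 : 0 < 1 - r by rewrite subr_gt0.
  have t1 : 0 <= 6 * rowbd r / (1 - r) by rewrite divr_ge0 ?(ltW r0)//; lra.
  have t2 : 0 <= 4 * (1 - r) ^- 2 by rewrite mulr_ge0// invr_ge0 exprn_ge0// ltW.
  by rewrite /rowbd2 !addr_ge0// mulr_ge0// sqr_ge0.
rewrite -mulrA; apply: ler_wpM2l => //; rewrite mulrC.
by apply: ler_wpM2r => //; exact: sdev_ge0.
Qed.

Lemma row_mean : (1 + center_const ^+ 2) * (3 * d) <= 1 ->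
  cabs (\prod_(j < k) mean (mu j)) <= expR (- rowS / 2).
Proof.
move=> dc; rewrite cabs_prod /rowS -sumrN mulr_suml.
have E : expR (\sum_(j < k) (- sdev (mu j) / 2)) = \prod_(j < k) expR (- sdev (mu j) / 2).
  by elim/big_rec2: _ => [|j x y _ <-]; rewrite ?expR0 ?expRD.
rewrite E; apply: ler_prod => j _; rewrite cabs_ge0 /=.
apply: (mean_row_bound (mudr j)); apply: le_trans dc.
by rewrite ler_pM2l ?ler_pM2l//; have := sqr_ge0 (@center_const R); lra.
Qed.

Lemma row_shift (w : 'I_k -> C) (e : R) z : d <= rowd (1 / 4) ->
  cabs z <= 1 / 4 -> (forall j, cabs (w j) <= 1 / 4) -> (forall j, cabs (w j - z) <= e) ->
  cabs (\prod_(j < k) Btr (mu j) (w j) - \prod_(j < k) Btr (mu j) z) <=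
  rowbd3 * e * rowS * expR (2 * rowbd (1 / 4) * rowS).
Proof.
move=> d4 zq wq wz; have K1 := rowbd_ge1 q4.
have mud4 j : dist1 (mu j) <= rowd (1 / 4) by exact: le_trans d4.
have c0 (j : 'I_k) : 0 <= 2 * rowbd (1 / 4) * sdev (mu j) by rewrite !mulr_ge0 ?sdev_ge0//; lra.
have Ac (j : 'I_k) := Btr_row_bound q04 (mud4 j) (wq j).
have Bc (j : 'I_k) := Btr_row_bound q04 (mud4 j) zq.
apply: le_trans (prod_diff _ c0 Ac Bc) _; rewrite -mulr_sumr -/rowS.
rewrite ler_wpM2r ?expR_ge0// /rowS mulr_sumr; apply: ler_sum => j _.
apply: le_trans (Btr_row_lip (mud4 j) (wq j) zq) _.
rewrite mulrAC; apply: ler_wpM2r; first exact: sdev_ge0.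
by apply: ler_wpM2l => //; rewrite /rowbd3; lra.
Qed.

(** The imaginary constants [tdev] join the angles of the [b_center] to form [gamma_row]; what
    remains of [hfun] is [hpart]. *)
Lemma row_exp_gamma (lam : T) z :
  (lam : C) * \prod_(j < k) ((b_center (mu j) : C) * cexp (- hfun (mu j) z)) =
  (gamma_row lam mu : C) * cexp (- \sum_(j < k) hpart (mu j) z).
Proof.
rewrite /gamma_row !expiD !expi_sum argK -sumrN cexp_sum -!mulrA; congr (_ * _).
rewrite -big_split -big_split; apply: eq_bigr => j _.
have -> : - hfun (mu j) z = (0 +i* tdev (mu j)) + - hpart (mu j) z by rewrite /hfun opprB.
by rewrite cexpD cexp_i argK.
Qed.

End one_row.
End row_estimates.

(** * The measures sigma_n and Herglotz integrals *)

Section density.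
Local Open Scope ereal_scope.
Context d (O : measurableType d) (R : realType).

Lemma ge0_integral_sigma_additive (m : {measure set O -> \bar R}) (g : O -> \bar R) :
  measurable_fun setT g -> (forall x, 0 <= g x) ->
  semi_sigma_additive (fun A => \int[m]_(x in A) g x).
Proof.
move=> mg g0 F mF tF mUF.
rewrite [X in _ --> X](_ : _ = lim (\sum_(0 <= i < n) \int[m]_(x in F i) g x @[n --> \oo])).
  by apply: is_cvg_ereal_nneg_natsum => k _; exact: integral_ge0.
by rewrite ge0_integral_bigcup//; exact: measurable_funTS.
Qed.

(** [g] and the Radon-Nikodym derivative of [s] have the same integrals over measurable sets, so
    they agree almost everywhere. *)
Lemma integral_density (m s : {finite_measure set O -> \bar R}) (g f : O -> \bar R) :
  m.-integrable setT g ->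
  (forall A, measurable A -> s A = \int[m]_(x in A) g x) ->
  s.-integrable setT f -> \int[s]_x f x = \int[m]_x (f x * g x).
Proof.
move=> ig sE ifs; have mf := measurable_int _ ifs; have mg := measurable_int _ ig.
have dom : charge_of_finite_measure s `<< m.
  apply/null_content_dominatesP => A mA mA0; rewrite [LHS]sE//.
  by apply: null_set_integral => //; exact: measurable_funTS.
rewrite -(Radon_Nikodym_change_of_variables dom)//.
have iRN := Radon_Nikodym_integrable dom.
have mRN := measurable_int _ iRN.
apply: ae_eq_integral => //; try exact: emeasurable_funM.
apply: ae_eqe_mul2l => /=.
apply: integral_ae_eq => // A _ mA.
by rewrite -sE// -Radon_Nikodym_integral.
Qed.

End density.

Section sigma_row.
Context {R : realType}.
Local Notation C := R[i].
Local Notation T := (circle R).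
Implicit Types (z : C).

Lemma one_sub_Re_ge0 (u : T) : 0 <= 1 - Re u.
Proof. by rewrite subr_ge0; have /andP[] := circle_Re_itv u. Qed.

Variables (k : nat) (mu : 'I_k -> probability T R).

Let g (u : T) : \bar R := (1 - Re u)%:E.

Let mg : measurable_fun setT g.
Proof. by apply/measurable_EFinP; exact: continuous_circle_measurable cont_oneRe. Qed.

Let g0 u : (0 <= g u)%E. Proof. by rewrite lee_fin one_sub_Re_ge0. Qed.

Let ig j : (centered (mu j)).-integrable setT g.
Proof. exact: (continuous_integrable _ cont_oneRe). Qed.

Let sigma_row0 : sigma_row mu set0 = 0%E.
Proof. by rewrite /sigma_row big1// => j _; rewrite integral_set0. Qed.

Let sigma_row_ge0 A : (0 <= sigma_row mu A)%E.
Proof. by apply: sume_ge0 => j _; apply: integral_ge0 => u _; exact: g0. Qed.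

Let sigma_row_sigma_additive : semi_sigma_additive (sigma_row mu).
Proof.
move=> F mF tF mUF.
rewrite [X in _ --> X](_ : _ =
    (limn (fun n => \sum_(0 <= i < n) sigma_row mu (F i)))%E).
  by apply: is_cvg_ereal_nneg_natsum => i _; exact: sigma_row_ge0.
rewrite nneseries_sum//; last by move=> *; apply: integral_ge0 => u _; exact: g0.
apply: eq_bigr => j _; apply/esym.
exact: (cvg_lim _ (ge0_integral_sigma_additive (m := centered (mu j)) mg g0 mF tF mUF)).
Qed.

HB.instance Definition _ := isMeasure.Build _ _ _ (sigma_row mu)
  sigma_row0 sigma_row_ge0 sigma_row_sigma_additive.

Let sigma_rowT : sigma_row mu setT = (rowS mu)%:E.
Proof.
rewrite /sigma_row /rowS -sumEFin; apply: eq_bigr => j _.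
exact: (EFin_Rintegral (centered (mu j)) cont_oneRe).
Qed.

Lemma sigma_row_finite : exists m : {finite_measure set T -> \bar R},
  [/\ m = sigma_row mu :> (set T -> \bar R), mass m = rowS mu &
    forall f : T -> R, continuous f ->
      \int[m]_u f u = \sum_(j < k) \int[centered (mu j)]_u (f u * (1 - Re u))].
Proof.
have [m mE] : exists m : {finite_measure set T -> \bar R}, m = sigma_row mu :> (set T -> \bar R).
  by apply: (@finite_measure_of R _ T (sigma_row mu)); rewrite /= sigma_rowT ltry.
exists m; split => //; first by rewrite /mass mE sigma_rowT.
have ge0E (f : T -> R) : continuous f -> (forall u, 0 <= f u) ->
    \int[m]_u f u = \sum_(j < k) \int[centered (mu j)]_u (f u * (1 - Re u)).
  move=> cf f0; have cfg := contM cf cont_oneRe.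
  (* [msum] takes a family indexed by [nat]; indices from [k] on get a Dirac mass and are never
     summed. *)
  pose m_ i : probability T R :=
    if insub i is Some j then centered (mu j) else \d_(circle1 : T).
  have m_E (j : 'I_k) : m_ j = centered (mu j) by rewrite /m_ valK.
  pose s := msum m_ k.
  have sI (h : T -> R) A : continuous h -> (forall u, 0 <= h u) -> measurable A ->
      (\int[s]_(u in A) (h u)%:E = \sum_(j < k) \int[centered (mu j)]_(u in A) (h u)%:E)%E.
    move=> ch h0 mA; rewrite /s ge0_integral_measure_sum//; last 2 first.
    - by move=> u _; rewrite lee_fin.
    - by apply/measurable_funTS/measurable_EFinP; exact: continuous_circle_measurable.
    by apply: eq_bigr => j _; rewrite m_E.
  have [M ME] : exists M : {finite_measure set T -> \bar R}, M = s :> (set T -> \bar R).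
    apply: (@finite_measure_of R _ T s).
    by apply: lte_sum_pinfty => i _; rewrite ltey_eq fin_num_measure.
  have igM : M.-integrable setT g by exact: (continuous_integrable _ cont_oneRe).
  have dens A : measurable A -> m A = (\int[M]_(u in A) g u)%E.
    by move=> mA; rewrite ME (sI _ _ cont_oneRe one_sub_Re_ge0 mA) mE.
  have ifm := continuous_integrable m cf.
  have -> : Rintegral m setT f = fine (\int[M]_u ((f u)%:E * g u))%E.
    by rewrite /Rintegral (integral_density igM dens ifm).
  have fg0 u : 0 <= f u * (1 - Re u) by rewrite mulr_ge0// one_sub_Re_ge0.
  rewrite ME (sI _ _ cfg fg0 measurableT).
  by rewrite (eq_bigr _ (fun j _ => EFin_Rintegral (centered (mu j)) cfg)) sumEFin.
(* A signed [f] is the difference of the nonnegative functions [f + B] and [B]. *)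
move=> f cf; have [B B0 fB] := continuous_circle_bounded cf.
have cB := @contC T R B; have cfB := contD cf cB.
have cBR := contM cB cont_oneRe.
have fB0 u : 0 <= f u + B by have := fB u; rewrite ler_norml => /andP[]; lra.
rewrite -[LHS](addrK (\int[m]_u B)).
rewrite -(RintegralD measurableT (continuous_integrable m cf) (continuous_integrable m cB)).
rewrite (ge0E _ cfB fB0) (ge0E _ cB (fun=> ltW B0)) -sumrB; apply: eq_bigr => j _.
rewrite -RintegralB//; last 2 first.
- exact: (continuous_integrable (centered (mu j)) (contM cfB cont_oneRe)).
- exact: (continuous_integrable (centered (mu j)) cBR).
by congr (Rintegral _ _); apply: funext => u; ring.
Qed.

(** The density [1 - Re u] of each [hpart] is absorbed in the measure; by [herglotzE] the right side
    is then the Herglotz integral of [sigma_row]. *)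
Lemma sigma_row_hpart : exists m : {finite_measure set T -> \bar R},
  [/\ m = sigma_row mu :> (set T -> \bar R), mass m = rowS mu &
    forall z, cabs z < 1 -> \sum_(j < k) hpart (mu j) z =
      2 * ctr m (fun=> 1) z - (rowS mu)%:C].
Proof.
have [m [mE mS mI]] := sigma_row_finite; exists m; split => // z z1.
rewrite /hpart sumrB -mulr_sumr; congr (2 * _ - _); last by rewrite /rowS rmorph_sum.
have c1 : continuous (fun _ : T => 1 : C) by exact: (@contC T C 1).
have cz := cont_ctr c1 z1.
have cRe := continuous_Re cz; have cIm := continuous_Im cz.
rewrite /ctr /cintegral (mI _ cRe) (mI _ cIm).
rewrite (_ : _ +i* _ = \sum_(j < k)
  ((\int[centered (mu j)]_u (Re (1 / (1 - z * (u : C))) * (1 - Re u))) +i*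
   (\int[centered (mu j)]_u (Im (1 / (1 - z * (u : C))) * (1 - Re u)))%R)); last first.
  by apply: complex_eqP; rewrite raddf_sum.
apply: eq_bigr => j _; congr (_ +i* _); congr (Rintegral _ _); apply: funext => u.
  by rewrite mul1r; case: (_^-1) => a b /=; ring.
by rewrite mul1r; case: (_^-1) => a b /=; ring.
Qed.

End sigma_row.

Section herglotz.
Context {R : realType}.
Local Notation C := R[i].
Local Notation T := (circle R).

Lemma herglotzE (m : {finite_measure set T -> \bar R}) (z : C) : cabs z < 1 ->
  herglotz m z = 2 * ctr m (fun=> 1) z - (mass m)%:C.
Proof.
move=> z1; have c1 : continuous (fun _ : T => 1 : C) by exact: (@contC T C 1).
have cz := cont_ctr c1 z1.
rewrite /ctr -(cintegralZ m 2 cz) -[(mass m)%:C]mul1r -cintegral_cst.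
rewrite -(cintegralB m (contM (@contC T C 2) cz) c1).
congr cintegral; apply: funext => u.
have h := denom_neq0 u z1; rewrite [(u : C) * z]mulrC; field.
exact: h.
Qed.

End herglotz.

(** * Infinitesimal arrays and iterated convolutions *)

Section arrays.
Context {R : realType}.
Local Notation C := R[i].
Local Notation T := (circle R).
Local Notation prob := (probability T R).
Implicit Types (mu nu rho : prob) (z : C).

Lemma measurable_far (e : R) : measurable [set u : T | e%:C <= `|(u : C) - 1|].
Proof.
have -> : [set u : T | e%:C <= `|(u : C) - 1|] =
    setT `&` (fun u : T => cabs ((u : C) - 1)) @^-1` `[e, +oo[%classic.
  by apply/seteqP; split => u /=; rewrite normE_cabs lecR in_itv /= andbT // => -[].
exact: (continuous_circle_measurable (continuous_cabs cont_sub1)).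
Qed.

(** [|u - 1|] is below [e] off the far set and at most 2 on it. *)
Lemma dist1_le mu (e : R) :
  0 <= e -> dist1 mu <= e + 2 * fine (mu [set u : T | e%:C <= `|(u : C) - 1|]).
Proof.
move=> e0; set A := [set u : T | _].
have mA : measurable A by exact: measurable_far.
have iA : mu.-integrable setT (EFin \o (fun u => 2 * \1_A u)).
  apply: (bounded_measurable_integrable mu (M := 2)).
    by apply: measurable_funM => //; exact: measurable_realfun.measurable_indic.
  by move=> u; rewrite indicE; case: (_ \in _); rewrite ?mulr1 ?mulr0 ?normr0// ger0_norm.
have -> : e + 2 * fine (mu A) = \int[mu]_u (e + 2 * \1_A u).
  rewrite (RintegralD measurableT (continuous_integrable mu (@contC T R e)) iA).
  rewrite Rintegral_mass mass_prob mulr1; congr (_ + _).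
  rewrite RintegralZl//; last first.
    apply: (bounded_measurable_integrable mu (M := 1)).
      exact: measurable_realfun.measurable_indic.
    by move=> u; rewrite indicE; case: (_ \in _); rewrite ?normr1 ?normr0.
  by rewrite /Rintegral integral_indic// setIT.
apply: le_Rintegral => //.
- exact: (continuous_integrable mu (continuous_cabs cont_sub1)).
- have := integrableD measurableT (continuous_integrable mu (@contC T R e)) iA.
  by apply: eq_integrable => // u _ /=; rewrite EFinD.
move=> u _; rewrite indicE; have [uA|uA] := boolP (u \in A).
  by have := cabsB (u : C) 1; rewrite cabs_circle cabs1 mulr1; lra.
rewrite mulr0 addr0 leNgt; apply/negP => /ltW eu; move/negP : uA; apply.
by rewrite inE /A /= normE_cabs lecR.
Qed.

Lemma infinitesimal_dist1 (kn : nat -> nat) (mu : forall n, 'I_(kn n) -> prob) (e : R) :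
  infinitesimal mu -> 0 < e -> \forall n \near \oo, forall k, dist1 (mu n k) <= e.
Proof.
move=> inf e0; have e2 : 0 < e / 2 by rewrite divr_gt0.
have e4 : 0 < e / 4 by rewrite divr_gt0.
have /fine_cvgP[_ /cvgrPdist_lt /(_ _ e4)] := inf _ e2.
have /fine_cvgP[fin _] := inf _ e2.
move: fin; apply: filterS2 => n fin h k.
apply: le_trans (dist1_le (mu n k) (ltW e2)) _.
have h1 : fine (mu n k [set u : T | (e / 2)%:C <= `|(u : C) - 1|]) <= e / 4.
  apply: le_trans _ (ltW h); rewrite sub0r normrN (le_trans _ (ler_norm _))//.
  apply: fine_le => //; last by apply: le_bigmax_cond.
  by apply: fin_num_measure; exact: measurable_far.
rewrite [leRHS](_ : e = e / 2 + 2 * (e / 4)); last by field.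
by rewrite lerD2l ler_pM2l.
Qed.

Lemma Btr_dirac (lam : T) z : cabs z < 1 -> Btr (\d_lam : prob) z = lam.
Proof.
move=> z1; have c1 : continuous (fun _ : T => 1 : C) by exact: (@contC T C 1).
have dE (f : T -> C) : continuous f -> cintegral (\d_lam : prob) f = f lam.
  move=> cf; rewrite /cintegral /Rintegral !integral_dirac//; last 2 first.
  - by apply/measurable_EFinP; exact: continuous_circle_measurable (continuous_Im cf).
  - by apply/measurable_EFinP; exact: continuous_circle_measurable (continuous_Re cf).
  by rewrite !diracT !mul1e /=; case: (f lam).
rewrite /Btr /Ntr /Dtr /ctr !dE; [|exact: cont_ctr c1 z1|exact: cont_ctr cont_circle z1].
by rewrite div1r invrK divfK// denom_neq0.
Qed.

Lemma nonzero_mean_dirac (lam : T) : nonzero_mean (\d_lam : prob).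
Proof.
rewrite /nonzero_mean -Btr0 Btr_dirac ?cabs0//; apply/eqP; exact: circle_neq0.
Qed.

Lemma bool_conv_prod (mu0 rho : prob) k (mu : 'I_k -> prob) z :
  iterated is_bool_conv mu0 [seq mu j | j <- enum 'I_k] rho -> cabs z < 1 ->
  Btr rho z = Btr mu0 z * \prod_(j < k) Btr (mu j) z.
Proof.
move=> it z1; rewrite -big_enum /=; elim: (enum _) mu0 it => [|j s IH] mu0 /=.
  by move=> ->; rewrite big_nil mulr1.
move=> [r mr /IH ->]; rewrite big_cons mulrA -!B_transformE// mr//.
by rewrite normE_cabs -(rmorph1 (real_complex R)) ltcR.
Qed.

Lemma cfree_conv_prod (p q : prob * prob) k (mu nu : 'I_k -> prob) : nonzero_mean p.2 ->
  iterated is_cfree_conv p [seq (mu j, nu j) | j <- enum 'I_k] q ->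
  nonzero_mean q.2 /\ \forall y \near (0 : C), cT_transform q.1 q.2 y =
    cT_transform p.1 p.2 y * \prod_(j < k) cT_transform (mu j) (nu j) y.
Proof.
move=> p0 it; suff [q0 qT] : nonzero_mean q.2 /\ \forall y \near (0 : C), cT_transform q.1 q.2 y =
    cT_transform p.1 p.2 y * \prod_(j <- enum 'I_k) cT_transform (mu j) (nu j) y.
  by split => //; move: qT; apply: filterS => y ->; rewrite big_enum.
elim: (enum _) p p0 it => [p p0 ->|j s IH p p0 [r [r0 _ rT] /(IH _ r0)[q0 qT]]]; split => //.
  by apply/nbhs0_cabsP; exists 1 => // y _; rewrite big_nil mulr1.
by move: rT qT; apply: filterS2 => y rE qE; rewrite qE rE /= big_cons mulrA.
Qed.

(** The c-free equation is known near 0 only, on a disc of unspecified size. Both sides are uniform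
    limits of polynomials on the disc of radius [r], so the identity theorem carries it there. *)
Lemma Sigma_product (lam lam' : T) (q : prob * prob) k (mu nu : 'I_k -> prob) (r : R) :
  iterated is_cfree_conv ((\d_lam : prob), (\d_lam' : prob))
    [seq (mu j, nu j) | j <- enum 'I_k] q ->
  (forall j, nonzero_mean (nu j)) ->
  nonzero_mean q.2 -> r <= invrad q.2 -> (forall j, r <= invrad (nu j)) -> r <= 1 / 4 ->
  forall z, cabs z < r ->
  Btr q.1 (etainv q.2 z) = (lam : C) * \prod_(j < k) Btr (mu j) (etainv (nu j) z).
Proof.
move=> it nu0 q0 rq rnu r4 z zr.
have l0 := @nonzero_mean_dirac lam'.
have [_ /near0_mobius qT] := @cfree_conv_prod ((\d_lam : prob), (\d_lam' : prob)) q _ _ _ l0 it.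
have Bpoly (m n : prob) : nonzero_mean n -> r <= invrad n ->
    polyapprox r (fun z => Btr m (etainv n z)).
  move=> n0 rn; apply: (@polyapprox_comp _ r (1 / 4)); first exact: Btr_polyapprox.
    by move=> e /(etainv_polyapprox n0)[P PE]; exists P => w wr; apply: PE; exact: le_trans rn.
  move=> w wr; have [h _] := etainv_spec n0 (le_trans wr rn).
  by have := mrad_le n; lra.
pose f z : C := Btr q.1 (etainv q.2 z) - (lam : C) * \prod_(j < k) Btr (mu j) (etainv (nu j) z).
suff : f z = 0 by move/eqP; rewrite subr_eq0 => /eqP.
apply: (@polyapprox_eq0 _ r f _ _ z zr).
  apply: polyapproxB; first exact: Bpoly.
  apply: polyapproxZ; apply: polyapprox_prod => j; exact: Bpoly.
have nuS : \forall u \near (0 : C), forall j,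
    cT_transform (mu j) (nu j) (u / (1 - u)) = Btr (mu j) (etainv (nu j) u).
  by apply: (@filter_forall _ _ _ (nbhs (0 : C))) => j; exact: Sigma_near.
have ld : \forall u \near (0 : C), cT_transform (\d_lam : prob) (\d_lam' : prob) (u / (1 - u)) = lam.
  apply: filterS2 (Sigma_near l0 (\d_lam : prob)) (near0_disc (invrad_gt0 l0)) => u -> ul.
  apply: Btr_dirac; have [h _] := etainv_spec l0 (ltW ul).
  by have := mrad_le (\d_lam' : prob); lra.
apply: filterS2 (filterI qT (Sigma_near q0 q.1)) (filterI nuS ld) => u [qE qS] [nE lE].
rewrite /f -qS qE /= lE (eq_bigr _ (fun j _ => nE j)) subrr //.
Qed.

End arrays.

(** * Limits of boolean products *)

Section complex_limits.
Context {R : realType}.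
Local Notation C := R[i].
Context {I : Type} (F : set_system I) {FF : Filter F}.
Implicit Types (f g : I -> C) (l : C).

Lemma cvg_cexp f l : f @ F --> l -> cexp (f i) @[i --> F] --> cexp l.
Proof.
move=> /cvg_cabsP fl; apply/cvg_cabsP => e e0.
have k0 : 0 < cabs (cexp l) by rewrite cabs_gt0 cexp_neq0.
pose d := Num.min (1 / 2) (e / (5 * cabs (cexp l))).
have d0 : 0 < d by rewrite lt_min !divr_gt0// mulr_gt0.
apply: filterS (fl _ d0) => i; rewrite lt_min cabsC => /andP[h1 h2].
rewrite -[f i](subrK l) cexpD -{1}[cexp l]mul1r -mulrBl cabsM cabsC.
set x := f i - l in h1 h2 *; have t := cexp_taylor1 (ltW h1).
have h3 : cabs (cexp x - 1) <= 5 * cabs x.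
  have := cabs_tri x (cexp x - 1) 0; rewrite !subr0 => h; have := cabs_ge0 x; nra.
apply: (@le_lt_trans _ _ (5 * cabs x * cabs (cexp l))); first by rewrite ler_pM2r.
by rewrite mulrAC mulrC -ltr_pdivlMr// mulr_gt0.
Qed.

Lemma cvg_cabs f l : f @ F --> l -> cabs (f i) @[i --> F] --> cabs l.
Proof.
move=> /cvg_cabsP fl; apply/cvgrPdist_lt => e e0.
apply: filterS (fl _ e0) => i; apply: le_lt_trans.
have h1 := cabs_lower l (f i); have h2 := cabs_lower (f i) l.
by rewrite [cabs (f i - l)]cabsC in h2; rewrite ler_norml; apply/andP; split; lra.
Qed.

Lemma cvg_real (f : I -> R) (l : R) : f @ F --> l -> (f i)%:C @[i --> F] --> l%:C.
Proof. by move=> fl; apply: cvg_of_ReIm => //=; exact: cvg_cst. Qed.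

Lemma cvg_asymptotic f g l : f @ F --> l -> (f i - g i) @[i --> F] --> (0 : C) -> g @ F --> l.
Proof.
move=> /cvg_cabsP fl /cvg_cabsP fg; apply/cvg_cabsP => e e0.
have e2 : 0 < e / 2 by rewrite divr_gt0.
apply: filterS2 (fl _ e2) (fg _ e2) => i; rewrite sub0r cabsN => h1 h2.
by have := cabs_tri (f i) l (g i); lra.
Qed.

Lemma cvg_subC f g : (f i - g i) @[i --> F] --> (0 : C) -> (g i - f i) @[i --> F] --> (0 : C).
Proof.
move=> /cvg_cabsP fg; apply/cvg_cabsP => e /fg; apply: filterS => i.
by rewrite !sub0r !cabsN cabsC.
Qed.

(** A substitute for the logarithm near 1. *)
Lemma cexp_small_inv (x : C) : cabs x <= 1 / 16 -> cabs x <= 2 * cabs (cexp x - 1).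
Proof.
move=> x16; have x2 : cabs x <= 1 / 2 by lra.
have t := cexp_taylor1 x2; have := cabs_tri (cexp x - 1) x 0.
by rewrite !subr0 [cabs (x - _)]cabsC; have := cabs_ge0 x; nra.
Qed.

End complex_limits.

(** The shape of the errors in [row_product] and [row_shift]: [x] is the sum of the [sdev], bounded
    by [M], and [d] can be made small. *)
Lemma small_bound (R : realType) (A B d x M e : R) : 0 <= x -> x <= M -> 0 <= B -> 0 <= d -> 0 < e ->
  d <= e / (`|A| * M * expR (B * M) + 1) / 2 -> A * d * x * expR (B * x) < e.
Proof.
move=> x0 xM B0 d0 e0; set K := _ + 1; have M0 : 0 <= M by exact: le_trans xM.
have K0 : 0 < K by rewrite ltr_wpDl// !mulr_ge0// expR_ge0.
move=> dK; have {}dK : d * K < e.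
  have := ler_wpM2r (ltW K0) dK.
  by rewrite (_ : e / K / 2 * K = e / 2); [lra|field; rewrite gt_eqF].
apply: le_lt_trans dK.
apply: (@le_trans _ _ (d * (`|A| * M * expR (B * M)))); last by rewrite ler_wpM2l// lerDl.
rewrite [A * d]mulrC -!mulrA; apply: ler_wpM2l => //.
apply: le_trans (ler_norm _) _; rewrite normrM ler_wpM2l//.
rewrite normrM (ger0_norm x0) ger0_norm ?expR_ge0//.
by apply: ler_pM; rewrite ?expR_ge0// ler_expR ler_wpM2l.
Qed.

Section row_limits.
Context {R : realType}.
Local Notation C := R[i].
Local Notation T := (circle R).
Local Notation prob := (probability T R).
Variables (kn : nat -> nat) (lam : nat -> T) (mu : forall n, 'I_(kn n) -> prob)
  (rho : nat -> prob) (s : nat -> {finite_measure set T -> \bar R}).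
Hypothesis inf : infinitesimal mu.
Hypothesis rhoE : forall n z, cabs z < 1 ->
  Btr (rho n) z = (lam n : C) * \prod_(j < kn n) Btr (mu j) z.
Hypothesis sS : forall n, mass (s n) = rowS (@mu n).
Hypothesis sH : forall n z, cabs z < 1 -> \sum_(j < kn n) hpart (mu j) z =
  2 * ctr (s n) (fun=> 1) z - (rowS (@mu n))%:C.

Let S n := rowS (@mu n).
Let gam n := gamma_row (lam n) (@mu n).
Let H n z := \sum_(j < kn n) hpart (mu j) z.

(** By [row_mean] the product of the means is at most [exp(- S / 2)] in modulus, whence
    [S <= - 2 ln c]. *)
Lemma rowS_bounded (c : R) : 0 < c ->
  (\forall n \near \oo, c <= cabs ((lam n : C) * \prod_(j < kn n) mean (mu j))) ->
  exists M, \forall n \near \oo, S n <= M.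
Proof.
move=> c0 hc; exists (- 2 * ln c).
have K0 : 0 < 1 + @center_const R ^+ 2 by have := sqr_ge0 (@center_const R); lra.
pose d := Num.min (rowd (1 / 4 : R)) ((1 + @center_const R ^+ 2)^-1 / 3).
have d0 : 0 < d by rewrite lt_min rowd_gt0 ?divr_gt0 ?invr_gt0//; lra.
have dr : d <= rowd (1 / 4) by rewrite ge_min lexx.
have dc : (1 + @center_const R ^+ 2) * (3 * d) <= 1.
  by rewrite mulrC -ler_pdivlMr// mulrC -ler_pdivlMr// div1r ge_min lexx orbT.
have r01 : 0 <= (1 / 4 : R) < 1 by apply/andP; split; lra.
apply: filterS2 hc (infinitesimal_dist1 inf d0) => n cn mud.
have := row_mean mud dr dc; rewrite cabsM cabs_circle mul1r in cn.
move=> /(le_trans cn); rewrite -{1}(lnK (x := c)) ?posrE// ler_expR -/(S n); lra.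
Qed.

Section along_filter.
Context (F : set_system nat) {FF : ProperFilter F}.
Hypothesis Foo : \oo `<=` F.

(** [row_product] at radius [|z|], with [d] as small as desired by infinitesimality. The filter is
    general because limits are also taken along ultrafilters. *)
Lemma rho_approx (M : R) z : (\forall n \near F, S n <= M) -> cabs z < 1 ->
  (Btr (rho n) z - (gam n : C) * cexp (- H n z)) @[n --> F] --> (0 : C).
Proof.
move=> SM z1; pose r := cabs z; have r01 : 0 <= r < 1 by rewrite cabs_ge0.
apply/cvg_cabsP => e e0.
pose d := Num.min (rowd r) (e / (`|rowbd2 r| * `|M| * expR (2 * rowbd r * `|M|) + 1) / 2).
have d0 : 0 < d by rewrite lt_min rowd_gt0 ?divr_gt0 ?divr_gt0.
have dr : d <= rowd r by rewrite ge_min lexx.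
apply: filterS2 SM (Foo (infinitesimal_dist1 inf d0)) => n Sn mud.
rewrite sub0r cabsN rhoE// -row_exp_gamma -mulrBr cabsM cabs_circle mul1r.
apply: le_lt_trans (row_product r01 mud dr (lexx _)) _; rewrite -/(S n).
have rK : 1 <= rowbd r by apply: rowbd_ge1.
apply: (@small_bound _ _ _ _ _ `|M|) => //; rewrite ?(ltW d0)//.
- exact: rowS_ge0.
- by rewrite (le_trans Sn) ?ler_norm.
- by rewrite mulr_ge0//; lra.
- by rewrite ge_min lexx orbT.
Qed.

Variables (gamma : T) (sigma : {finite_measure set T -> \bar R}).

Lemma rho_limit :
  (forall f : T -> R, continuous f -> \int[s n]_u f u @[n --> F] --> \int[sigma]_u f u) ->
  (gam n : C) @[n --> F] --> (gamma : C) ->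
  forall z, cabs z < 1 ->
    Btr (rho n) z @[n --> F] --> (gamma : C) * cexp (- herglotz sigma z).
Proof.
move=> sI gl z z1; have c1 : continuous (fun _ : T => 1 : C) by exact: (@contC T C 1).
have Sl : S n @[n --> F] --> mass sigma.
  have := sI _ (@contC T R 1); under eq_fun do rewrite Rintegral_mass mul1r sS.
  by rewrite Rintegral_mass mul1r.
have SM : \forall n \near F, S n <= mass sigma + 1.
  have /cvgrPdist_lt/(_ _ ltr01) := Sl; apply: filterS => n.
  by rewrite ltr_norml => /andP[h1 h2]; lra.
have Hl : H n z @[n --> F] --> herglotz sigma z.
  have -> : H^~ z = fun n => 2 * ctr (s n) (fun=> 1) z - (S n)%:C.
    by apply: funext => n; exact: sH.
  rewrite (herglotzE _ z1).
  have h : ctr (s n) (fun=> 1) z @[n --> F] --> ctr sigma (fun=> 1) z.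
    exact: (cvg_cintegral sI (cont_ctr c1 z1)).
  by apply: cvgB (cvg_real Sl); exact: cvgMl_tmp.
have El : (gam n : C) * cexp (- H n z) @[n --> F] --> (gamma : C) * cexp (- herglotz sigma z).
  exact: (cvgM gl (cvg_cexp (cvgN Hl))).
have Eh : ((gam n : C) * cexp (- H n z) - Btr (rho n) z) @[n --> F] --> (0 : C).
  exact: (cvg_subC (rho_approx SM z1)).
exact: (cvg_asymptotic El Eh).
Qed.

End along_filter.

Lemma herglotz0 (m : {finite_measure set T -> \bar R}) : herglotz m 0 = (mass m)%:C.
Proof. by rewrite herglotzE ?cabs0// ctr_at0; ring. Qed.

Lemma ctr_drift (m : {finite_measure set T -> \bar R}) z : cabs z <= 1 / 4 ->
  cabs (2 * ctr m (fun=> 1) z - 2 * (mass m)%:C) <= 4 * mass m * cabs z.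
Proof.
move=> z4; rewrite -mulrBr cabsM -ctr_at0.
have c1 : continuous (fun _ : T => 1 : C) by exact: (@contC T C 1).
have h0 : cabs (0 : C) <= 1 / 4 by rewrite cabs0; lra.
have q1 : (1 / 4 : R) < 1 by lra.
have := ctr_lip m c1 z4 h0 q1; rewrite subr0 absint_mass.
have -> : (1 - 1 / 4 : R) ^- 2 = 16 / 9 by field.
have -> : cabs (2 : C) = 2 by rewrite (_ : (2 : C) = (2 : R)%:C) ?cabsR ?ger0_norm// rmorph_nat.
have m0 := mulr_ge0 (mass_ge0 m) (cabs_ge0 z).
by rewrite -!mulrA; lra.
Qed.

(** The modulus at 0 bounds [S_n] and then gives [S_n -> m]; dividing by the exponential gives
    [gamma_n -> gamma]. At other [z] only exponentials of Herglotz integrals are known to converge.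
    After subtraction of the values at 0, the exponents for [sigma_n] and [sigma] differ by at most
    [1 / 16] when [z] is small, and [cexp_small_inv] applies. *)
Lemma rho_limit_inv (gamma : T) (sigma : {finite_measure set T -> \bar R}) :
  (forall z, cabs z < 1 ->
    Btr (rho n) z @[n --> \oo] --> (gamma : C) * cexp (- herglotz sigma z)) ->
  ((gam n : C) @[n --> \oo] --> (gamma : C)) /\
  forall f : T -> R, continuous f -> \int[s n]_u f u @[n --> \oo] --> \int[sigma]_u f u.
Proof.
move=> rl; have z01 : cabs (0 : C) < 1 by rewrite cabs0.
pose m := mass sigma; have em : 0 < expR (- m) by exact: expR_gt0.
have rl0 : Btr (rho n) 0 @[n --> \oo] --> (gamma : C) * cexp (- m%:C).
  by have := rl _ z01; rewrite herglotz0.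
have labs : cabs ((gamma : C) * cexp (- m%:C)) = expR (- m).
  by rewrite cabsM cabs_circle mul1r cabs_cexp cReN.
have [M SM] : exists M, \forall n \near \oo, S n <= M.
  apply: (@rowS_bounded (expR (- m) / 2)); first by rewrite divr_gt0.
  have e2 : 0 < expR (- m) / 2 by rewrite divr_gt0.
  have cl : cabs (Btr (rho n) 0) @[n --> \oo] --> expR (- m).
    by rewrite -labs; exact: (cvg_cabs rl0).
  move/cvgrPdist_lt/(_ _ e2) : cl.
  apply: filterS => n; rewrite rhoE// ltr_norml => /andP[_].
  rewrite (eq_bigr _ (fun j _ => Btr0 (mu j))); lra.
have El z : cabs z < 1 -> (gam n : C) * cexp (- H n z) @[n --> \oo] -->
    (gamma : C) * cexp (- herglotz sigma z).
  by move=> z1; apply: (cvg_asymptotic (rl z z1)); exact: (rho_approx (@subset_refl _ _) SM z1).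
have H0 n : H n 0 = (S n)%:C.
  by rewrite /H sH ?cabs0// ctr_at0 sS; ring.
have E0 : (gam n : C) * cexp (- (S n)%:C) @[n --> \oo] --> (gamma : C) * cexp (- m%:C).
  by have := El 0 z01; rewrite herglotz0; under eq_fun do rewrite H0.
have Sl : S n @[n --> \oo] --> m.
  have ce : expR (- S n) @[n --> \oo] --> expR (- m).
    rewrite -labs (_ : (fun n => _) = fun n => cabs ((gam n : C) * cexp (- (S n)%:C))).
      exact: (cvg_cabs E0).
    by apply: funext => n; rewrite cabsM cabs_circle mul1r cabs_cexp cReN.
  have E : (fun n => - ln (expR (- S n))) = S by apply: funext => n; rewrite expRK opprK.
  rewrite -[X in _ --> X]opprK -{1}[- m]expRK -[X in X @ _]E.
  exact: (cvgN (continuous_cvg _ (continuous_ln em) ce)).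
have gl : (gam n : C) @[n --> \oo] --> (gamma : C).
  rewrite (_ : (fun n => _) = fun n => (gam n : C) * cexp (- (S n)%:C) * cexp (S n)%:C).
    rewrite -[X in _ --> X](_ : (gamma : C) * cexp (- m%:C) * cexp m%:C = gamma).
      exact: (cvgM E0 (cvg_cexp (cvg_real Sl))).
    by rewrite -mulrA -cexpD addNr cexp0 mulr1.
  by apply: funext => n; rewrite -mulrA -cexpD addNr cexp0 mulr1.
split => //; have m0 : 0 <= m := mass_ge0 sigma.
(* By [ctr_drift] the two differences in [x] below total at most [4 (|M| + m) |z|], hence at most
   [1 / 16]. *)
pose r1 := Num.min (1 / 4) (1 / (64 * (`|M| + m + 1))).
have q0 : 0 < 64 * (`|M| + m + 1) by have := normr_ge0 M; lra.
have r10 : 0 < r1 by rewrite lt_min !divr_gt0.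
apply: cvg_Rintegral_of_moments; apply: (cvg_moments_of_ctr r10) => z.
rewrite lt_min => /andP[z4 zq]; have z1 : cabs z < 1 by lra.
pose x n := (2 * ctr sigma (fun=> 1) z - 2 * m%:C) - (2 * ctr (s n) (fun=> 1) z - 2 * (S n)%:C).
have xs : \forall n \near \oo, cabs (x n) <= 1 / 16.
  apply: filterS SM => n Sn; rewrite /x; apply: le_trans (cabsB _ _) _.
  have d1 := ctr_drift sigma (ltW z4); have d2 := ctr_drift (s n) (ltW z4).
  rewrite sS -/(S n) in d2; rewrite -/m in d1.
  have {}zq : cabs z * (64 * (`|M| + m + 1)) < 1 by rewrite -ltr_pdivlMr.
  have SM' : S n <= `|M| by rewrite (le_trans Sn) ?ler_norm.
  have := cabs_ge0 z; have := mulr_ge0 m0 (cabs_ge0 z).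
  have := ler_wpM2r (cabs_ge0 z) SM'.
  nra.
have xl : x n @[n --> \oo] --> (0 : C).
  have ex : cexp (x n) @[n --> \oo] --> (1 : C).
    pose h := herglotz sigma z.
    have xE n : cexp (x n) = (gam n : C) * cexp (- H n z) * cexp (S n)%:C * (gam n : C)^-1 *
        cexp (h - m%:C).
      have -> : x n = - H n z + (S n)%:C + (h - m%:C).
        by rewrite /x /h herglotzE// -/m /H sH// -/(S n); ring.
      move: (h - m%:C) => k; rewrite 2!cexpD.
      by field; exact: circle_neq0.
    have lE : (gamma : C) * cexp (- h) * cexp m%:C * (gamma : C)^-1 * cexp (h - m%:C) = 1.
      rewrite (_ : _ * _ = cexp (- h) * cexp m%:C * cexp (h - m%:C)).
        by rewrite -!cexpD (_ : _ + _ = 0) ?cexp0//; ring.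
      by field; exact: circle_neq0.
    rewrite -[X in _ --> X]lE (_ : (fun n => _) = fun n => (gam n : C) * cexp (- H n z) *
      cexp (S n)%:C * (gam n : C)^-1 * cexp (h - m%:C)); last exact: funext.
    apply: cvgM; last exact: cvg_cst.
    apply: cvgM; last exact: (cvgV (circle_neq0 gamma) gl).
    by apply: cvgM; [exact: El|exact: (cvg_cexp (cvg_real Sl))].
  apply/cvg_cabsP => e e0; have e2 : 0 < e / 2 by rewrite divr_gt0.
  move/cvg_cabsP/(_ _ e2) : ex; apply: filterS2 xs => n xn; rewrite cabsC sub0r cabsN => h.
  by have := cexp_small_inv xn; lra.
rewrite (_ : (fun n => _) = fun n =>
    2^-1 * ((2 * ctr sigma (fun=> 1) z - 2 * m%:C) - x n + 2 * (S n)%:C)); last first.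
  by apply: funext => n; rewrite /x; field.
rewrite [X in _ --> X](_ : _ =
    2^-1 * ((2 * ctr sigma (fun=> 1) z - 2 * m%:C) - 0 + 2 * m%:C)); last by field.
apply: cvgMl_tmp; apply: cvgD; last by apply: cvgMl_tmp; exact: cvg_real.
apply/cvg_cabsP => e e0; move/cvg_cabsP/(_ _ e0) : xl; apply: filterS => n.
by rewrite -cabsN; congr (cabs _ < _); ring.
Qed.

End row_limits.

(** * Limits of c-free products *)

Section compactness_of_laws.
Context {R : realType}.
Local Notation C := R[i].
Local Notation T := (circle R).
Local Notation prob := (probability T R).

(** The limit given by [helly] has mass 1, so normalizing leaves it unchanged and makes it a
    probability. *)
Lemma helly_prob (U : set_system nat) {UU : UltraFilter U} (p_ : nat -> prob) :
  exists p : prob, forall f : T -> R, continuous f ->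
    \int[p_ n]_u f u @[n --> U] --> \int[p]_u f u.
Proof.
have [|m mf] := @helly R U UU (fun n => p_ n : {finite_measure set T -> \bar R}) 1.
  by move=> n; rewrite mass_prob.
have m1 : mass m = 1.
  have h := mf _ (@contC T R 1).
  have E : (fun n => \int[p_ n]_u (1 : R)) = fun=> 1.
    by apply: funext => n; rewrite Rintegral_mass mass_prob mulr1.
  rewrite E Rintegral_mass mul1r in h.
  have h1 : (fun _ : nat => 1 : R) @ U --> (1 : R) by exact: cvg_cst.
  exact: (cvg_unique _ h h1).
have mT : m setT = 1%E by rewrite -[LHS]fineK ?fin_num_measure// -/(mass m) m1.
pose p : prob := mnormalize m (\d_(circle1 : T)).
have pm : p = m :> (set T -> \bar R).
  apply: funext => A; rewrite /p /= /mnormalize /=.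
  have -> : Measure.sort m setT = 1%E by exact: mT.
  by rewrite onee_eq0 /= invr1 mule1.
exists p => f cf; rewrite /Rintegral.
have -> : (\int[p]_u (f u)%:E = \int[m]_u (f u)%:E)%E by rewrite -pm.
exact: mf.
Qed.

Lemma circle_ultra_cvg (U : set_system nat) {UU : UltraFilter U} (g : nat -> T) :
  exists l : T, (g n : C) @[n --> U] --> (l : C).
Proof.
have [a ga] := @ultra_cvg_bounded R U UU (fun n => Re (g n)) 1
  (fun n => le_trans (cabs_Re _) (eq_ind_r (fun x => x <= 1) (lexx _) (cabs_circle (g n)))).
have [b gb] := @ultra_cvg_bounded R U UU (fun n => Im (g n)) 1
  (fun n => le_trans (cabs_Im _) (eq_ind_r (fun x => x <= 1) (lexx _) (cabs_circle (g n)))).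
have gl : (g n : C) @[n --> U] --> a +i* b by exact: cvg_of_ReIm.
have l1 : `|a +i* b| == 1.
  have h : cabs (g n : C) @[n --> U] --> cabs (a +i* b) by exact: (cvg_cabs gl).
  have E : (fun n => cabs (g n : C)) = fun=> 1 by apply: funext => n; rewrite cabs_circle.
  have h1 : (fun _ : nat => 1 : R) @ U --> (1 : R) by exact: cvg_cst.
  by rewrite E in h; rewrite normE_cabs (cvg_unique _ h h1).
by exists (Circle l1).
Qed.

Lemma eventually_bounded (S : nat -> R) (M : R) : (\forall n \near \oo, S n <= M) ->
  exists M', forall n, S n <= M'.
Proof.
move=> [N _ NM].
have [K SK] : exists K, forall n, (n < N)%N -> S n <= K.
  elim: N {NM} => [|N [K SK]]; first by exists 0.
  exists (Num.max K (S N)) => n; rewrite ltnS leq_eqVlt => /predU1P[->|/SK nK].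
    by rewrite le_max lexx orbT.
  by rewrite le_max nK.
exists (Num.max K M) => n; rewrite le_max; have [/SK ->//|nN] := ltnP n N.
by rewrite NM ?orbT.
Qed.

End compactness_of_laws.

(** * Inverses of eta on a common disc *)

Section inverse_limits.
Context {R : realType}.
Local Notation C := R[i].
Local Notation T := (circle R).
Local Notation prob := (probability T R).
Implicit Types (mu nu : prob).

Lemma Btr_sub1 mu (z : C) : cabs z <= 1 / 4 -> cabs (Btr mu z - 1) <= 2 * dist1 mu.
Proof.
move=> z4; have z1 : cabs z < 1 by lra.
have c1 : continuous (fun _ : T => 1 : C) by exact: (@contC T C 1).
have D0 := Dtr_neq0 mu z1; have q1 : (1 / 4 : R) < 1 by lra.
have E : Btr mu z - 1 = ctr mu (fun u => (u : C) - 1) z / Dtr mu z.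
  rewrite (_ : ctr mu _ z = Ntr mu z - Dtr mu z); first by rewrite /Btr; field.
  rewrite /Ntr /Dtr /ctr -(cintegralB mu (cont_ctr cont_circle z1) (cont_ctr c1 z1)).
  by congr cintegral; apply: funext => u; rewrite mulrBl.
have := ctr_bound mu cont_sub1 z4 q1; rewrite -/(dist1 mu).
have -> : (1 - 1 / 4 : R)^-1 = 4 / 3 by field.
have DL : 2 / 3 <= cabs (Dtr mu z) := Dtr_lower mu z4.
rewrite E cabsM cabsV ler_pdivrMr; last by lra.
by have := dist1_ge0 mu; nra.
Qed.

(** With [w = eta^-1(z)] one has [z = w B(w)], so [w - z = w (1 - B(w))], and [B] is within
    [2 dist1] of 1. *)
Lemma etainv_shift nu (z : C) : nonzero_mean nu -> cabs z <= invrad nu ->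
  cabs (etainv nu z - z) <= dist1 nu.
Proof.
move=> nu0 zr; have [h1 h2] := etainv_spec nu0 zr; have h3 := mrad_le nu.
have w4 : cabs (etainv nu z) <= 1 / 4 by lra.
have b := Btr_sub1 nu w4.
rewrite -{2}h2 -{1}[etainv nu z]mulr1 -mulrBr cabsM [cabs (1 - _)]cabsC.
by have := dist1_ge0 nu; have := cabs_ge0 (etainv nu z); have := cabs_ge0 (Btr nu (etainv nu z) - 1); nra.
Qed.

Lemma mean_sub1 mu : cabs (mean mu - 1) <= 2 * dist1 mu.
Proof. by rewrite -Btr0; apply: Btr_sub1; rewrite cabs0. Qed.

End inverse_limits.

Section free_side.
Context {R : realType}.
Local Notation C := R[i].
Local Notation T := (circle R).
Local Notation prob := (probability T R).

(** The Lipschitz constant of [Btr] on the disc of radius [1 / 4] does not depend on the measure, so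
    a moving point may be replaced by its limit. *)
Lemma Btr_shift_limit (F : set_system nat) {FF : Filter F} (p : nat -> prob) (w_ : nat -> C) w :
  w_ @ F --> w -> cabs w < 1 / 4 ->
  (Btr (p n) (w_ n) - Btr (p n) w) @[n --> F] --> (0 : C).
Proof.
move=> /cvg_cabsP wl w4; apply/cvg_cabsP => e e0.
have e9 : 0 < Num.min (e / 9) (1 / 4 - cabs w) by rewrite lt_min divr_gt0//= subr_gt0.
apply: filterS (wl _ e9) => n; rewrite lt_min => /andP[h1 h2].
have h3 := cabs_lower (w_ n) w; rewrite cabsC in h1 h2.
have w4' : cabs (w_ n) <= 1 / 4 by lra.
rewrite sub0r cabsN; apply: le_lt_trans (Btr_lip (p n) w4' (ltW w4)) _.
by lra.
Qed.

Variables (nu : prob) (nu_ : nat -> prob).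
Hypothesis nu0 : nonzero_mean nu.
Hypothesis nu_0 : forall n, nonzero_mean (nu_ n).
Hypothesis nuI : forall f : T -> R, continuous f ->
  \int[nu_ n]_u f u @[n --> \oo] --> \int[nu]_u f u.

Let a : R := cabs (mean nu).

(** [invrad p] is [|mean p| ^ 2 / 72], so this radius is admissible for every [p] with
    [|mean p| >= a / 2]. *)
Definition unifrad : R := a ^+ 2 / 288.

Let a0 : 0 < a. Proof. by rewrite cabs_gt0; exact/eqP. Qed.
Let a1 : a <= 1. Proof. exact: mean_le1. Qed.

Lemma unifrad_gt0 : 0 < unifrad. Proof. by rewrite divr_gt0// exprn_gt0. Qed.

Lemma unifrad_le : unifrad <= 1 / 288.
Proof. by rewrite ler_pM2r ?invr_gt0// expr_le1// ltW. Qed.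

Lemma invrad_lower (p : prob) : a / 2 <= cabs (mean p) -> unifrad <= invrad p.
Proof. by move=> h; rewrite /unifrad /invrad /mrad; have := a0; nra. Qed.

Lemma mean_lower : \forall n \near \oo, a / 2 <= cabs (mean (nu_ n)).
Proof.
have h : mean (nu_ n) @[n --> \oo] --> mean nu by exact: (cvg_cintegral nuI cont_circle).
have h2 : cabs (mean (nu_ n)) @[n --> \oo] --> a by exact: (cvg_cabs h).
have a2 : 0 < a / 2 by have := a0; lra.
move/cvgrPdist_lt/(_ _ a2) : h2; apply: filterS => n.
by rewrite ltr_norml => /andP[_]; lra.
Qed.

Lemma invrad_near1 (p : prob) : dist1 p <= 1 / 4 -> unifrad <= invrad p.
Proof.
move=> h; apply: invrad_lower; have := mean_sub1 p; have := cabs_lower 1 (mean p).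
by rewrite cabs1 [cabs (1 - _)]cabsC; have := a1; lra.
Qed.

Lemma etainv_small z : cabs z < unifrad -> cabs (etainv nu z) <= a / 144.
Proof.
move=> zr; have i0 := invrad_gt0 nu0.
have zi : cabs z <= invrad nu.
  by apply: (le_trans (ltW zr)); apply: invrad_lower; rewrite -/a; have := a0; lra.
have := @etainv_lip R nu nu0 z 0 zi; rewrite cabs0 (etainv0 nu0) !subr0 -/a => /(_ (ltW i0)).
by move: zr; rewrite /unifrad; have := a0; nra.
Qed.

(** Push the limit [w] forward: [z' = w B_n(w)] tends to [w B(w) = z], the [n]-th inverse takes [z']
    exactly to [w], and the inverses are Lipschitz uniformly in [n]. *)
Lemma etainv_cvg z : cabs z < unifrad -> etainv (nu_ n) z @[n --> \oo] --> etainv nu z.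
Proof.
move=> zr; have w144 := etainv_small zr; set w := etainv nu z in w144 *.
have zi : cabs z <= invrad nu.
  by apply: (le_trans (ltW zr)); apply: invrad_lower; rewrite -/a; have := a0; lra.
have [_ wz] := etainv_spec nu0 zi; rewrite -/w in wz.
have w1 : cabs w < 1 by have := a1; lra.
have h : w * Btr (nu_ n) w @[n --> \oo] --> z.
  by rewrite -[X in _ --> X]wz; apply: cvgMl_tmp; exact: (cvg_Btr nuI w1).
apply/cvg_cabsP => e e0.
have d0 : 0 < Num.min (e * (a / 4)) (unifrad - cabs z).
  by rewrite lt_min subr_gt0 zr andbT mulr_gt0// divr_gt0.
move/cvg_cabsP/(_ _ d0) : h; apply: filterS2 mean_lower => n mn; rewrite lt_min => /andP[h1 h2].
set z' := w * Btr (nu_ n) w in h1 h2.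
have rn := invrad_lower mn.
have z'r : cabs z' <= invrad (nu_ n).
  by have := cabs_lower z' z; rewrite cabsC; lra.
have zr' : cabs z <= invrad (nu_ n) by lra.
have wE : etainv (nu_ n) z' = w.
  by apply: (etainvK (@nu_0 n)); rewrite /mrad; have := a0; lra.
have := etainv_lip (@nu_0 n) zr' z'r; rewrite wE [cabs (w - _)]cabsC.
have := cabs_ge0 (etainv (nu_ n) z - w); have := a0; nra.
Qed.

Lemma g_limit (F : set_system nat) {FF : ProperFilter F} (p_ : nat -> prob) (p : prob) z :
  \oo `<=` F -> (forall f : T -> R, continuous f ->
    \int[p_ n]_u f u @[n --> F] --> \int[p]_u f u) ->
  cabs z < unifrad -> Btr (p_ n) (etainv (nu_ n) z) @[n --> F] --> Btr p (etainv nu z).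
Proof.
move=> Foo pI zr; have w144 := etainv_small zr.
have w1 : cabs (etainv nu z) < 1 by have := a1; lra.
have w4 : cabs (etainv nu z) < 1 / 4 by have := a1; lra.
have wl : etainv (nu_ n) z @[n --> F] --> etainv nu z.
  by apply: cvg_trans (etainv_cvg zr); exact: cvg_app.
have h1 : (Btr (p_ n) (etainv nu z) - Btr (p_ n) (etainv (nu_ n) z)) @[n --> F] --> (0 : C).
  exact: (cvg_subC (Btr_shift_limit p_ wl w4)).
exact: (cvg_asymptotic (cvg_Btr pI w1) h1).
Qed.

End free_side.

(** * The equivalences and the formula for the limit *)

Section main.
Context {R : realType}.
Local Notation C := R[i].
Local Notation T := (circle R).
Local Notation prob := (probability T R).

Variables (nu_free : prob) (kn : nat -> nat) (lam lam' : nat -> T)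
  (mu nu : forall n, 'I_(kn n) -> prob) (mu_ nu_ rho_ : nat -> prob).
Hypothesis nu_free0 : nonzero_mean nu_free.
Hypothesis nu0 : forall n k, nonzero_mean (@nu n k).
Hypothesis mu_inf : infinitesimal mu.
Hypothesis nu_inf : infinitesimal nu.
Hypothesis cfree : forall n, iterated is_cfree_conv
  ((\d_(lam n) : prob), (\d_(lam' n) : prob))
  [seq (@mu n k, @nu n k) | k <- enum 'I_(kn n)] (mu_ n, nu_ n).
Hypothesis boolc : forall n, iterated is_bool_conv (\d_(lam n) : prob)
  [seq @mu n k | k <- enum 'I_(kn n)] (rho_ n).
Hypothesis nuW : weak_cvg nu_ nu_free.

Let nuI (f : T -> R) : continuous f -> \int[nu_ n]_u f u @[n --> \oo] --> \int[nu_free]_u f u.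
Proof. by move: f; apply/(weak_cvgP nu_ nu_free). Qed.

Let nu_0 n : nonzero_mean (nu_ n).
Proof.
by have [] := @cfree_conv_prod _ ((\d_(lam n) : prob), (\d_(lam' n) : prob)) (mu_ n, nu_ n)
  _ _ _ (@nonzero_mean_dirac R (lam' n)) (cfree n).
Qed.

Let rhoE n z : cabs z < 1 -> Btr (rho_ n) z = (lam n : C) * \prod_(j < kn n) Btr (@mu n j) z.
Proof. by move=> z1; rewrite (bool_conv_prod (boolc n) z1) Btr_dirac. Qed.

Let r0 := unifrad nu_free.
Let S n := rowS (@mu n).
Let g n z := Btr (mu_ n) (etainv (nu_ n) z).

(** Eventually the means of [nu_n] are at least half the limit in modulus and those of the [nu_nk]
    are near 1, so one radius [r0] serves all the inverses. *)
Lemma g_product : \forall n \near \oo, forall z, cabs z < r0 ->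
  g n z = (lam n : C) * \prod_(j < kn n) Btr (@mu n j) (etainv (@nu n j) z).
Proof.
have q0 : 0 < 1 / 4 :> R by lra.
apply: filterS2 (mean_lower nu_free0 nuI) (infinitesimal_dist1 nu_inf q0) => n mn dn z zr.
apply: (@Sigma_product R _ _ (mu_ n, nu_ n) _ _ _ r0 (cfree n)) => //=.
- exact: invrad_lower.
- by move=> j; apply: invrad_near1 => //; exact: nu0.
- by have := unifrad_le nu_free0; rewrite -/r0; lra.
Qed.

(** The c-free product evaluates its factors at [eta_{nu_nk}^-1(z)], within [dist1] of [z];
    [row_shift] compares it with the boolean product at [z]. *)
Lemma g_rho (M : R) z : (\forall n \near \oo, S n <= M) -> cabs z < r0 ->
  (g n z - Btr (rho_ n) z) @[n --> \oo] --> (0 : C).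
Proof.
move=> SM zr; apply/cvg_cabsP => e e0.
have r288 : r0 <= 1 / 288 := unifrad_le nu_free0.
have K1 : 1 <= rowbd (1 / 4 : R) by apply: rowbd_ge1; lra.
pose d1 : R := Num.min (1 / 8) (e / (`|rowbd3| * `|M| * expR (2 * rowbd (1 / 4) * `|M|) + 1) / 2).
have d10 : 0 < d1 by rewrite lt_min ?divr_gt0 ?divr_gt0//= andbT; lra.
have d20 : 0 < rowd (1 / 4 : R) by rewrite rowd_gt0//; lra.
have r01 : 0 <= (1 / 4 : R) < 1 by apply/andP; split; lra.
apply: filterS2 (filterI SM g_product) (filterI (infinitesimal_dist1 nu_inf d10)
  (infinitesimal_dist1 mu_inf d20)) => n [Sn gE] [nud mud].
have d18 : d1 <= 1 / 8 by rewrite ge_min lexx.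
rewrite sub0r cabsN gE// rhoE; last by lra.
rewrite -mulrBr cabsM cabs_circle mul1r.
have sh j : cabs (etainv (@nu n j) z - z) <= d1.
  apply: le_trans (nud j); apply: etainv_shift => //.
  apply: (le_trans (ltW zr)); apply: invrad_near1 => //.
  by apply: le_trans (nud j) _; lra.
have w4 j : cabs (etainv (@nu n j) z) <= 1 / 4.
  by have := cabs_lower (etainv (@nu n j) z) z; have := sh j; lra.
have z4 : cabs z <= 1 / 4 by lra.
apply: le_lt_trans (row_shift mud (lexx _) z4 w4 sh) _; rewrite -/(S n).
apply: (@small_bound _ _ _ _ _ `|M|) => //; rewrite ?(ltW d10)//.
- exact: rowS_ge0.
- by rewrite (le_trans Sn) ?ler_norm.
- by rewrite mulr_ge0//; lra.
- by rewrite ge_min lexx orbT.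
Qed.

Lemma mu_mean : \forall n \near \oo,
  mean (mu_ n) = (lam n : C) * \prod_(j < kn n) mean (@mu n j).
Proof.
apply: filterS g_product => n /(_ 0); rewrite cabs0 => /(_ (unifrad_gt0 nu_free0)).
rewrite /g (etainv0 (@nu_0 n)) Btr0 => ->; congr (_ * _); apply: eq_bigr => j _.
by rewrite (etainv0 (@nu0 n j)) Btr0.
Qed.

Lemma is_bool_idP (gamma : T) (sigma : {finite_measure set T -> \bar R}) (nb : prob) :
  is_bool_id gamma sigma nb <->
  forall z, cabs z < 1 -> Btr nb z = (gamma : C) * cexp (- herglotz sigma z).
Proof.
have E z : (`|z| < 1 :> C) = (cabs z < 1) by rewrite normE_cabs -(rmorph1 (real_complex R)) ltcR.
by split => h z z1; [rewrite -h ?E// B_transformE|rewrite E in z1; rewrite B_transformE// h].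
Qed.

Lemma sigma_rows : exists s : nat -> {finite_measure set T -> \bar R}, forall n,
  [/\ s n = sigma_row (@mu n) :> (set T -> \bar R), mass (s n) = S n &
    forall z, cabs z < 1 -> \sum_(j < kn n) hpart (@mu n j) z =
      2 * ctr (s n) (fun=> 1) z - (S n)%:C].
Proof. by have [s sE] := choice (fun n => sigma_row_hpart (@mu n)); exists s. Qed.

(** A limit of [rho_n] along an ultrafilter has the required transform, which produces [nb];
    convergence of the transforms along [\oo] then gives weak convergence to it. *)
Lemma boolean_of_array (gamma : T) (sigma : {finite_measure set T -> \bar R}) :
  weak_cvg (fun n => sigma_row (@mu n)) sigma ->
  (gamma_row (lam n) (@mu n) : C) @[n --> \oo] --> (gamma : C) ->
  exists nb, is_bool_id gamma sigma nb /\ weak_cvg rho_ nb.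
Proof.
move=> sW gl; have [s sE] := sigma_rows.
have sI (f : T -> R) : continuous f -> \int[s n]_u f u @[n --> \oo] --> \int[sigma]_u f u.
  move: f; apply/(weak_cvgP s sigma).
  by rewrite (_ : (fun n => s n : set T -> \bar R) = fun n => sigma_row (@mu n))//;
    apply: funext => n; have [] := sE n.
have sS n : mass (s n) = S n by have [] := sE n.
have sH n z : cabs z < 1 -> \sum_(j < kn n) hpart (@mu n j) z =
  2 * ctr (s n) (fun=> 1) z - (S n)%:C by have [_ _] := sE n; apply.
have rl z : cabs z < 1 ->
    Btr (rho_ n) z @[n --> \oo] --> (gamma : C) * cexp (- herglotz sigma z).
  exact: (rho_limit mu_inf rhoE sS sH (@subset_refl _ _) sI gl).
have [U [UU Uoo]] := @ultraFilterLemma nat \oo _.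
have [p pI] := @helly_prob R U UU rho_.
have pE z : cabs z < 1 -> Btr p z = (gamma : C) * cexp (- herglotz sigma z).
  move=> z1; have h1 : Btr (rho_ n) z @[n --> U] --> Btr p z by exact: cvg_Btr.
  have h2 : Btr (rho_ n) z @[n --> U] --> (gamma : C) * cexp (- herglotz sigma z).
    by apply: cvg_trans (rl z z1); exact: cvg_app.
  exact: (cvg_unique _ h1 h2).
exists p; split; first exact/is_bool_idP.
apply/(weak_cvgP rho_ p); apply: (@cvg_Rintegral_of_Btr R nat \oo _ rho_ p 1).
  by rewrite ltr01 lexx.
by move=> z z1; rewrite (pE z z1); exact: (rl z z1).
Qed.

Lemma array_of_boolean (gamma : T) (sigma : {finite_measure set T -> \bar R}) (nb : prob) :
  is_bool_id gamma sigma nb -> weak_cvg rho_ nb ->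
  weak_cvg (fun n => sigma_row (@mu n)) sigma /\
  (gamma_row (lam n) (@mu n) : C) @[n --> \oo] --> (gamma : C).
Proof.
move=> /is_bool_idP nbE /(weak_cvgP rho_ nb) nbI; have [s sE] := sigma_rows.
have sS n : mass (s n) = S n by have [] := sE n.
have sH n z : cabs z < 1 -> \sum_(j < kn n) hpart (@mu n j) z =
  2 * ctr (s n) (fun=> 1) z - (S n)%:C by have [_ _] := sE n; apply.
have [|gl sI] := rho_limit_inv mu_inf rhoE sS sH (gamma := gamma) (sigma := sigma).
  by move=> z z1; rewrite -(nbE z z1); exact: (cvg_Btr nbI z1).
split => //; rewrite (_ : (fun n => sigma_row (@mu n)) = fun n => s n : set T -> \bar R).
  exact/(weak_cvgP s sigma).
by apply: funext => n; have [] := sE n.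
Qed.

Lemma rowS_bounded_of_mean (m : nat -> prob) (p : prob) : nonzero_mean p ->
  (forall f : T -> R, continuous f -> \int[m n]_u f u @[n --> \oo] --> \int[p]_u f u) ->
  (\forall n \near \oo, mean (m n) = (lam n : C) * \prod_(j < kn n) mean (@mu n j)) ->
  exists M, \forall n \near \oo, S n <= M.
Proof.
move=> p0 mI mE.
have c0 : 0 < cabs (mean p) / 2 by rewrite divr_gt0// cabs_gt0; exact/eqP.
apply: (@rowS_bounded R kn lam mu mu_inf _ c0); have := mean_lower p0 mI.
by move: mE; apply: filterS2 => n E h; rewrite -E; exact: h.
Qed.

Lemma rho_of_mu (p : prob) (M : R) z : (\forall n \near \oo, S n <= M) ->
  (forall f : T -> R, continuous f -> \int[mu_ n]_u f u @[n --> \oo] --> \int[p]_u f u) ->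
  cabs z < r0 -> Btr (rho_ n) z @[n --> \oo] --> Btr p (etainv nu_free z).
Proof.
move=> SM pI zr.
have gl : g n z @[n --> \oo] --> Btr p (etainv nu_free z).
  exact: (g_limit nu_free0 nu_0 nuI (@subset_refl _ _) pI zr).
exact: (cvg_asymptotic gl (g_rho SM zr)).
Qed.

(** [gamma], [sigma] and [nb] are limits along one ultrafilter. Near 0 the transforms of [rho_n]
    already converge along [\oo], to [B_p o eta^-1], which must therefore be [B_nb]. *)
Lemma boolean_of_free (p : prob) : nonzero_mean p -> weak_cvg mu_ p ->
  exists gamma sigma nb, is_bool_id gamma sigma nb /\ weak_cvg rho_ nb.
Proof.
move=> p0 /(weak_cvgP mu_ p) pI.
have [M SM] := rowS_bounded_of_mean p0 pI mu_mean.
have [M' SM'] := eventually_bounded SM.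
have [s sE] := sigma_rows.
have sS n : mass (s n) = S n by have [] := sE n.
have sH n z : cabs z < 1 -> \sum_(j < kn n) hpart (@mu n j) z =
  2 * ctr (s n) (fun=> 1) z - (S n)%:C by have [_ _] := sE n; apply.
have [U [UU Uoo]] := @ultraFilterLemma nat \oo _.
have [|sigma sI] := @helly R U UU s M'; first by move=> n; rewrite sS.
have [gamma gl] := @circle_ultra_cvg R U UU (fun n => gamma_row (lam n) (@mu n)).
have [nb nbI] := @helly_prob R U UU rho_.
have nbE z : cabs z < 1 -> Btr nb z = (gamma : C) * cexp (- herglotz sigma z).
  move=> z1; have h1 : Btr (rho_ n) z @[n --> U] --> Btr nb z by exact: cvg_Btr.
  have h2 : Btr (rho_ n) z @[n --> U] --> (gamma : C) * cexp (- herglotz sigma z).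
    exact: (rho_limit mu_inf rhoE sS sH Uoo sI gl).
  exact: (cvg_unique _ h1 h2).
exists gamma, sigma, nb; split; first exact/is_bool_idP.
apply/(weak_cvgP rho_ nb); apply: (@cvg_Rintegral_of_Btr R nat \oo _ rho_ nb r0).
  by rewrite unifrad_gt0//=; have := unifrad_le nu_free0; rewrite -/r0; lra.
move=> z zr; have z1 : cabs z < 1 by have := unifrad_le nu_free0; rewrite -/r0; lra.
have h := rho_of_mu SM pI zr.
have h1 : Btr (rho_ n) z @[n --> U] --> Btr nb z by exact: cvg_Btr.
have h2 : Btr (rho_ n) z @[n --> U] --> Btr p (etainv nu_free z).
  by apply: cvg_trans h; exact: cvg_app.
by rewrite (cvg_unique _ h1 h2).
Qed.

Lemma rho_mean n : mean (rho_ n) = (lam n : C) * \prod_(j < kn n) mean (@mu n j).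
Proof.
by rewrite -Btr0 rhoE ?cabs0//; congr (_ * _); apply: eq_bigr => j _; rewrite Btr0.
Qed.

Lemma free_of_boolean (nb : prob) : nonzero_mean nb -> weak_cvg rho_ nb ->
  exists p, nonzero_mean p /\ weak_cvg mu_ p.
Proof.
move=> nb0 /(weak_cvgP rho_ nb) nbI.
have [|M SM] := rowS_bounded_of_mean nb0 nbI; first by apply: nearW; exact: rho_mean.
have r0p : 0 < r0 := unifrad_gt0 nu_free0.
have r288 : r0 <= 1 / 288 := unifrad_le nu_free0.
have gl z : cabs z < r0 -> g n z @[n --> \oo] --> Btr nb z.
  move=> zr; have z1 : cabs z < 1 by lra.
  exact: (cvg_asymptotic (cvg_Btr nbI z1) (cvg_subC (g_rho SM zr))).
have [U [UU Uoo]] := @ultraFilterLemma nat \oo _.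
have [p pI] := @helly_prob R U UU mu_.
have pE z : cabs z < r0 -> Btr p (etainv nu_free z) = Btr nb z.
  move=> zr; have h1 : g n z @[n --> U] --> Btr p (etainv nu_free z).
    exact: (g_limit nu_free0 nu_0 nuI Uoo pI zr).
  have h2 : g n z @[n --> U] --> Btr nb z.
    by apply: cvg_trans (gl z zr); exact: cvg_app.
  exact: (cvg_unique _ h1 h2).
have p0 : nonzero_mean p.
  have := pE 0; rewrite cabs0 etainv0// !Btr0 => /(_ r0p) E.
  by rewrite /nonzero_mean E.
exists p; split => //; apply/(weak_cvgP mu_ p).
(* Every [w] in this disc is [eta^-1(z)] for [z = w B(w)], with [|z| < r0] because [|B| <= 2];
   convergence at [z] thus gives convergence of the transforms of [mu_n] at [w]. *)
pose r1 := Num.min (mrad nu_free) (r0 / 2).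
have r10 : 0 < r1 by rewrite lt_min mrad_gt0// divr_gt0.
apply: (@cvg_Rintegral_of_Btr R nat \oo _ mu_ p r1).
  by rewrite r10 ge_min; apply/orP; left; have := mrad_le nu_free; lra.
move=> w; rewrite lt_min => /andP[wm wr].
have w4 : cabs w < 1 / 4 by lra.
pose z := w * Btr nu_free w.
have zr : cabs z < r0.
  have b := Btr_bound nu_free (ltW w4).
  by rewrite cabsM; have := cabs_ge0 w; nra.
have wE : etainv nu_free z = w by apply: (etainvK nu_free0); exact: ltW.
have wl : etainv (nu_ n) z @[n --> \oo] --> w.
  by rewrite -[X in _ --> X]wE; exact: (etainv_cvg nu_free0 nu_0 nuI zr).
have h : (g n z - Btr (mu_ n) w) @[n --> \oo] --> (0 : C).
  exact: (Btr_shift_limit mu_ wl w4).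
have -> : Btr p w = Btr nb z by rewrite -(pE z zr) wE.
exact: (cvg_asymptotic (gl z zr) h).
Qed.

(** The transforms of [rho_n] at [z] tend both to [B_p(eta^-1(z))], which is the Sigma-transform,
    and to [B_nb(z)]. *)
Lemma Sigma_limit (p nb : prob) : nonzero_mean p -> weak_cvg mu_ p -> weak_cvg rho_ nb ->
  \forall z \near (0 : C), Sigma_transform p nu_free z = B_transform nb z.
Proof.
move=> p0 /(weak_cvgP mu_ p) pI /(weak_cvgP rho_ nb) nbI.
have [M SM] := rowS_bounded_of_mean p0 pI mu_mean.
have r0p : 0 < r0 := unifrad_gt0 nu_free0.
have r288 : r0 <= 1 / 288 := unifrad_le nu_free0.
apply: filterS2 (Sigma_near nu_free0 p) (near0_disc r0p) => z zS zr.
have z1 : cabs z < 1 by lra.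
rewrite /Sigma_transform zS B_transformE//.
have h1 : Btr (rho_ n) z @[n --> \oo] --> Btr p (etainv nu_free z).
  exact: (rho_of_mu SM pI zr).
have h2 : Btr (rho_ n) z @[n --> \oo] --> Btr nb z by exact: (cvg_Btr nbI z1).
exact: (cvg_unique _ h1 h2).
Qed.

End main.

Theorem theorem5p6 (R : realType)
    (gamma' : circle R) (sigma' : {finite_measure set (circle R) -> \bar R})
    (nu_free : probability (circle R) R)
    (kn : nat -> nat) (lam lam' : nat -> circle R)
    (mu nu : forall n, 'I_(kn n) -> probability (circle R) R)
    (mu_ nu_ rho_ : nat -> probability (circle R) R) :
  is_free_id gamma' sigma' nu_free ->
  (forall n, (0 < kn n)%N) ->
  (forall n k, nonzero_mean (mu n k)) ->
  (forall n k, nonzero_mean (nu n k)) ->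
  infinitesimal mu ->
  infinitesimal nu ->
  (forall n, iterated is_cfree_conv
     ((\d_(lam n) : probability (circle R) R),
      (\d_(lam' n) : probability (circle R) R))
     [seq (mu n k, nu n k) | k <- enum 'I_(kn n)]
     (mu_ n, nu_ n)) ->
  (forall n, iterated is_bool_conv
     (\d_(lam n) : probability (circle R) R)
     [seq mu n k | k <- enum 'I_(kn n)]
     (rho_ n)) ->
  weak_cvg nu_ nu_free ->
  let stmt1 (mu0 : probability (circle R) R) :=
    nonzero_mean mu0 /\ weak_cvg mu_ mu0 in
  let stmt2 (gamma : circle R)
      (sigma : {finite_measure set (circle R) -> \bar R})
      (nu_bool : probability (circle R) R) :=
    is_bool_id gamma sigma nu_bool /\ weak_cvg rho_ nu_bool in
  let stmt3 (gamma : circle R)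
      (sigma : {finite_measure set (circle R) -> \bar R}) :=
    weak_cvg (fun n => sigma_row (mu n)) sigma /\
    ((gamma_row (lam n) (mu n) : R[i]) @[n --> \oo] --> (gamma : R[i])) in
  [/\ (exists mu0, stmt1 mu0) <->
        (exists gamma sigma nu_bool, stmt2 gamma sigma nu_bool),
      (forall gamma sigma,
        (exists nu_bool, stmt2 gamma sigma nu_bool) <-> stmt3 gamma sigma) &
      (forall gamma sigma mu0 nu_bool,
        stmt1 mu0 -> stmt2 gamma sigma nu_bool -> stmt3 gamma sigma ->
        \forall z \near (0 : R[i]),
          Sigma_transform mu0 nu_free z = B_transform nu_bool z)].
Proof.
move=> [nu_free0 _] _ _ nu0 mu_inf nu_inf cfree boolc nuW stmt1 stmt2 stmt3; split.
- split=> [[p [p0 pW]]|[gamma [sigma [nb [nbE nbW]]]]].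
    exact: (boolean_of_free nu_free0 nu0 mu_inf nu_inf cfree boolc nuW p0 pW).
  (* The mean is the value of [B] at 0, a unimodular number times an exponential. *)
  have nb0 : nonzero_mean nb.
    rewrite /nonzero_mean -Btr0 ((is_bool_idP _ _ _).1 nbE) ?cabs0//; apply/eqP.
    by rewrite mulf_neq0 ?cexp_neq0 ?circle_neq0.
  exact: (free_of_boolean nu_free0 nu0 mu_inf nu_inf cfree boolc nuW nb0 nbW).
- move=> gamma sigma; split => [[nb [nbE nbW]]|[sW gl]].
    exact: (array_of_boolean mu_inf boolc nbE nbW).
  exact: (boolean_of_array mu_inf boolc sW gl).
- move=> gamma sigma p nb [p0 pW] [_ nbW] _.
  exact: (Sigma_limit nu_free0 nu0 mu_inf nu_inf cfree boolc nuW p0 pW nbW).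
Qed.
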